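(* Let $V:\mathbb R\to\mathbb R$ be Lipschitz continuous with $V'\le 0$ (almost everywhere). Let $u_0\in L^\infty(\mathbb R)$ satisfy $0\le u_0(x)\le 1$ for a.e. $x\in\mathbb R$ and $\mathrm{TotVar}\,u_0<+\infty$. Let $\eta\in L^1(\mathbb R)\cap L^\infty(\mathbb R)$ satisfy $\eta\ge 0$, $\int_{\mathbb R}\eta(x)\,dx=1$, $\mathrm{supp}\,\eta\subseteq\mathbb R_-$, $\eta$ is non-decreasing on $\mathbb R_-$, and $\eta$ is convex on $\mathbb R_-$. For $\varepsilon>0$ set $\eta_\varepsilon(x):=\frac1\varepsilon\,\eta\left(\frac x\varepsilon\right)$, let $u_\varepsilon$ be the solution of the non-local Cauchy problem $$\partial_t u_\varepsilon+\partial_x\big[V(u_\varepsilon\ast\eta_\varepsilon)\,u_\varepsilon\big]=0 \ \text{ on } \mathbb R_+\times\mathbb R,\qquad u_\varepsilon(0,\cdot)=u_0,$$ and let $$w_\varepsilon(t,x):=(u_\varepsilon\ast\eta_\varepsilon)(t,x)=\frac1\varepsilon\int_x^{+\infty}\eta\left(\frac{x-y}{\varepsilon}\right)u_\varepsilon(t,y)\,dy .$$ Then $$\mathrm{TotVar}\,w_\varepsilon(t,\cdot)\le \mathrm{TotVar}\,w_\varepsilon(0,\cdot)\qquad\text{for every }\varepsilon>0\text{ and a.e. }t>0 .$$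
   Context: The symbol $\ast$ denotes convolution with respect to the space variable $x$ only. $\mathbb R_+$ is the positive half-line (time $t\in\mathbb R_+$) and $\mathbb R_-$ is the negative half-line; the inclusion $\mathrm{supp}\,\eta\subseteq\mathbb R_-$ means that $\eta$ vanishes a.e. on $]0,+\infty[$, and monotonicity and convexity of $\eta$ are required on $]-\infty,0[$. $\mathrm{TotVar}$ denotes the total variation of a function on $\mathbb R$ (for $u_0\in L^\infty(\mathbb R)$, in the sense of functions of bounded variation, i.e. up to a.e. modification). The solution $u_\varepsilon$ is the unique distributional solution in $L^\infty(\mathbb R_+\times\mathbb R)$ of the Cauchy problem, that is, for every $\varphi\in C^\infty_c([0,+\infty[\,\times\mathbb R)$, $$\int_0^{+\infty}\!\!\int_{\mathbb R}u_\varepsilon\big[\partial_t\varphi+V(u_\varepsilon\ast\eta_\varepsilon)\,\partial_x\varphi\big]\,dx\,dt+\int_{\mathbb R}u_0(x)\varphi(0,x)\,dx=0 .$$ Known facts (from the literature): under the stated hypotheses on $V$, $u_0$, $\eta$, such a solution exists and is unique, it satisfies the maximum principle $0\le u_\varepsilon(t,x)\le 1$ for a.e. $(t,x)\in\mathbb R_+\times\mathbb R$, and $w_\varepsilon$ is (has a representative that is) Lipschitz continuous, $w_\varepsilon\in W^{1,\infty}(\mathbb R_+\times\mathbb R)$, with $0\le w_\varepsilon\le 1$ and $w_\varepsilon(0,\cdot)=u_0\ast\eta_\varepsilon$. *)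

(* Defs.v *)
From mathcomp Require Import all_boot all_order all_algebra.
From mathcomp Require Import all_classical all_reals all_analysis.

Set Implicit Arguments.
Unset Strict Implicit.
Unset Printing Implicit Defensive.
Import Order.TTheory GRing.Theory Num.Theory.
Import numFieldNormedType.Exports.

Local Open Scope classical_set_scope.
Local Open Scope ring_scope.

Section total_variation_on_the_line.
Context {R : realType}.
Implicit Types f : R -> R.

Definition TotVar f : \bar R :=
  ereal_sup [set total_variation ab.1 ab.2 f | ab in [set ab | ab.1 <= ab.2]].

(* Total variation of an almost-everywhere equivalence class. *)
Definition ess_TotVar f : \bar R :=
  ereal_inf [set TotVar g | g in [set g | g = f %[ae lebesgue_measure]]].

End total_variation_on_the_line.

Section convolution.
Context {R : realType}.
Notation mu := (@lebesgue_measure R).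

Definition convolution (f g : R -> R) (x : R) : R :=
  \int[mu]_y (f y * g (x - y)).

Definition rescale (eta : R -> R) (eps x : R) : R := eps^-1 * eta (x / eps).

End convolution.

Section test_functions.
Context {R : realType}.
Implicit Types phi : R -> R -> R.

Definition partial_t phi : R -> R -> R := fun t x => derive1 (phi ^~ x) t.

Definition partial_x phi : R -> R -> R := fun t x => derive1 (phi t) x.

(* [true] stands for a derivative in t and [false] for a derivative in x. *)
Definition iter_partial (s : seq bool) phi : R -> R -> R :=
  foldr (fun b => if b then partial_t else partial_x) phi s.

Definition smooth phi : Prop :=
  forall s : seq bool, let g := iter_partial s phi in
    continuous (fun z : R * R => g z.1 z.2) /\
    forall t x, derivable (g ^~ x) t 1 /\ derivable (g t) x 1.

(* Elements of C^oo_c([0, +oo[ x R) are the restrictions to t >= 0 of functions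
   in C^oo_c(R x R); a test function is represented by such an extension, and
   only its values on t >= 0 are used in the weak formulation below. *)
Definition test_function phi : Prop :=
  smooth phi /\ compact (closure [set z : R * R | phi z.1 z.2 != 0]).

End test_functions.

Section nonlocal_conservation_law.
Context {R : realType}.
Notation mu := (@lebesgue_measure R).

Definition half_plane : set (R * R) := [set z | 0 <= z.1].

(* Bounded distributional solution of
     d_t u + d_x (V (u * k) u) = 0,   u (0, .) = u0.
   The value of the function [u] at t = 0 plays no role: the initial datum
   enters through the boundary term of the weak formulation. *)
Definition nonlocal_solution (V k u0 : R -> R) (u : R -> R -> R) : Prop :=
  ((fun z => u z.1 z.2) \_ half_plane) \in Lfun (mu \x mu)%E +oo%E /\
  forall phi, test_function phi ->
    \int[mu]_(t in `[0, +oo[)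
      (\int[mu]_x
        (u t x * (partial_t phi t x
                  + V (convolution (u t) k x) * partial_x phi t x)))
    + \int[mu]_x (u0 x * phi 0 x) = 0.

End nonlocal_conservation_law.

(* Main.v *)
Require Import Defs.
From mathcomp Require Import all_boot all_order all_algebra.
From mathcomp Require Import all_classical all_reals all_analysis.
From mathcomp Require Import measurable_realfun ess_sup_inf.
From mathcomp Require Import ring lra zify.

Set Implicit Arguments.
Unset Strict Implicit.
Unset Printing Implicit Defensive.
Import Order.TTheory GRing.Theory Num.Theory.
Import numFieldNormedType.Exports.

Local Open Scope classical_set_scope.
Local Open Scope ring_scope.

(* The average w = u * k is compared with a monotone finite-difference scheme whose total
   variation can be controlled by hand, instead of using the flow of the equation.

   The potential F (t, x) of u (a space primitive of u (t, .)) solves the transport equation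
   F_t + V (w) F_x = 0, and w is recovered from F by convolution with the derivative of k.
   The upwind discretisation of this equation, in the frame moving with the smallest speed
   V (sup w), keeps F monotone and w bounded. Its discrete average satisfies a
   transport equation with a memory term; since k is nondecreasing and convex, summation
   by parts gives this term nonnegative weights, whose total is exactly compensated by what
   the monotonicity of V takes away from the increments of w. Hence the total
   variation of the discrete average does not increase.

   To pass to the limit, F is mollified in space at scale delta: the weak formulation makes
   it Lipschitz in time, and at a.e. time a primitive of the mollified u. One step of the
   scheme then reproduces F up to an error that Gronwall's lemma turns into
   O (delta + D / delta + kappa), where D is the grid step and kappa the L^1 distance of k
   to its staircase approximation. Letting D, then delta, tend to 0, the discrete averages
   converge uniformly to w (t, .) for a.e. t, while their initial total variation tends to at
   most that of u0 * k. *)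

(** The comparison is made between potentials because a density that is merely bounded has no
    modulus of continuity in space or time. Summation by parts moves the differences onto k: if two
    potentials differ by at most e in the sup norm, their discrete averages differ by at most
    [2 * K * e], where K bounds k. As V is Lipschitz, the error made on the speed is then controlled
    by the very quantity being estimated, so Gronwall's lemma applies directly to the given weak
    solution.

    The moving frame makes the relative speed nonnegative, so that one and the same backward
    difference is always upwind. Transport and memory each consume up to [lam * L * W] of the step,
    which is the origin of the factor 2 in the CFL condition. *)

(** * The finite-difference scheme *)

Section total_variation_of_the_scheme.
Context {R : realFieldType}.
Variables (N : nat) (d mass a w w' : nat -> R) (lam : R).

Let S j := \sum_(m < N) d m * mass (j + m)%N.
Let A j : R := `|a j - a j.+1|.

Hypothesis lam_ge0 : 0 <= lam.
Hypothesis d_nonincr : forall m, d m.+1 <= d m.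
Hypothesis dN : d N = 0.
Hypothesis mass_ge0 : forall j, 0 <= mass j.
Hypothesis a_ge0 : forall j, 0 <= a j.
Hypothesis a_sign : forall j, 0 <= (a j - a j.+1) * (w j.+1 - w j).
Hypothesis cfl : forall j,
  lam * (A j * S j) <= (1 - lam * a j.+1) * `|w j.+1 - w j|.
Hypothesis w'E : forall j, w' j.+1 = w j.+1 - lam * a j.+1 * (w j.+1 - w j)
  + lam * \sum_(m < N) d m * (a j.+1 - a (j.+1 + m).+1) * mass (j.+1 + m)%N.

(** The memory sums of two neighbouring cells see the same masses after a shift by one. Splitting
    [a j.+1 - a i] at [a j.+2] leaves the weights [d m - d m.+1] on the common part and gathers the
    rest in [(a j.+1 - a j.+2) * S j.+1], a term whose sign is known from [a_sign]. *)
Let increment_step j : w' j.+2 - w' j.+1 =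
  ((1 - lam * a j.+2) * (w j.+2 - w j.+1)
    - lam * ((a j.+1 - a j.+2) * S j.+1))
  + lam * a j.+1 * (w j.+1 - w j)
  + lam * \sum_(m < N) (d m - d m.+1) * (a j.+2 - a (j.+2 + m).+1)
                        * mass (j.+2 + m)%N.
Proof.
have shift (f : nat -> R) : \sum_(m < N) d m * f m =
    d 0%N * f 0%N + \sum_(m < N) d m.+1 * f m.+1.
  transitivity (\sum_(m < N.+1) d m * f m).
    by rewrite big_ord_recr/= dN mul0r addr0.
  by rewrite big_ord_recl.
rewrite !w'E /S.
under [X in _ - (_ + lam * X)]eq_bigr do rewrite -mulrA.
rewrite (shift (fun m => (a j.+1 - a (j.+1 + m).+1) * mass (j.+1 + m)%N)).
rewrite (shift (fun m => mass (j.+1 + m)%N)) !addn0.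
have -> : \sum_(m < N) (d m - d m.+1) * (a j.+2 - a (j.+2 + m).+1)
            * mass (j.+2 + m)%N =
  \sum_(m < N) d m * (a j.+2 - a (j.+2 + m).+1) * mass (j.+2 + m)%N
  - (\sum_(m < N) d m.+1 * ((a j.+1 - a (j.+1 + m.+1).+1) * mass (j.+1 + m.+1)%N)
   - (a j.+1 - a j.+2) * \sum_(m < N) d m.+1 * mass (j.+1 + m.+1)%N).
  rewrite big_distrr/= -!sumrB; apply: eq_bigr => m _.
  by rewrite (addSnnS j.+1 m); ring.
ring.
Qed.

Let d_ge0 m : (m <= N)%N -> 0 <= d m.
Proof.
move=> mN; rewrite -dN; elim: (N) mN => [|n IH]; first by rewrite leqn0 => /eqP->.
rewrite leq_eqVlt => /predU1P[->//|/IH]; exact: le_trans.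
Qed.

Let e m := d m - d m.+1.

Let e_ge0 m : 0 <= e m.
Proof. by rewrite subr_ge0. Qed.

Let A_ge0 j : 0 <= A j.
Proof. exact: normr_ge0. Qed.

(** Abel summation: [S] is written with the same nonnegative weights [e m] as the memory term, so
    that the two can be matched pair by pair. *)
Let SE l : S l = \sum_(m < N) \sum_(q < N | (q <= m)%N) e m * mass (l + q)%N.
Proof.
have dE q : (q <= N)%N -> d q = \sum_(q <= m < N) e m.
  move=> qN; under eq_bigr do rewrite /e -opprB.
  by rewrite sumrN telescope_sumr// dN sub0r opprK.
rewrite (exchange_big_dep xpredT)//=; apply: eq_bigr => q _.
rewrite -big_distrl/= (dE _ (ltnW (ltn_ord q))); congr (_ * _).
by rewrite (big_nat_widenl _ 0)// big_mkord; apply: eq_bigl => i.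
Qed.

Let a_dist j m : `|a j - a (j + m)%N| <= \sum_(i < m) A (j + i)%N.
Proof.
elim: m => [|m IH]; first by rewrite addn0 subrr normr0 big_ord0.
rewrite big_ord_recr/= addnS (le_trans _ (lerD IH (lexx _)))// /A.
by rewrite -[leLHS](_ : `|(a j - a (j + m)%N) + (a (j + m)%N - a (j + m).+1)| = _)
  ?ler_normD//; congr `|_|; ring.
Qed.

Let nonlocal_term j :
  `|\sum_(m < N) e m * (a j.+2 - a (j.+2 + m).+1) * mass (j.+2 + m)%N| <=
  \sum_(m < N) \sum_(q < N | (q <= m)%N)
    e m * mass (j.+2 + m)%N * A (j.+2 + (m - q))%N.
Proof.
apply: (le_trans (ler_norm_sum _ _ _)); apply: ler_sum => m _.
rewrite !normrM (ger0_norm (e_ge0 m)) (ger0_norm (mass_ge0 _)) mulrAC.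
rewrite -big_distrr/= ler_wpM2l ?mulr_ge0// -addnS.
apply: (le_trans (a_dist _ _)).
(* The telescoped distance is enumerated from its far end, so that the indices of [A] and [mass]
   differ by exactly [q]. *)
rewrite -(big_mkord xpredT (fun i => A (j.+2 + i)%N)) big_nat_rev/= add0n.
rewrite -(big_mkord (fun q => (q <= m)%N) (fun q => A (j.+2 + (m - q))%N)).
rewrite [leRHS](_ : _ = \sum_(0 <= q < m.+1) A (j.+2 + (m - q))%N); last first.
  by rewrite [RHS](big_nat_widen _ _ N).

rewrite le_eqVlt; apply/orP; left; apply/eqP.
by apply: eq_big_nat => i /andP[_ im]; rewrite subSS.
Qed.

Let le_sum_shift (f : nat -> R) J s : (s <= N)%N -> (forall j, 0 <= f j) ->
  \sum_(j < J) f (j + s)%N <= \sum_(j < J + N) f j.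
Proof.
move=> sN f0.
have -> : (J + N = s + (J + (N - s)))%N by rewrite addnCA subnKC.
rewrite !big_split_ord/=; under eq_bigr do rewrite addnC.
by rewrite addrCA lerDl addr_ge0// sumr_ge0.
Qed.

Let S_ge0 l : 0 <= S l.
Proof. by apply: sumr_ge0 => m _; rewrite mulr_ge0// d_ge0// ltnW. Qed.

(** For fixed [m] and [q], the substitution [l.+1 = j.+2 + (m - q)] turns [mass (j.+2 + m)] into
    [mass (l.+1 + q)]. What remains is a segment of the sum over [l], shifted by [(m - q).+1 <= N]
    cells, and [SE] reassembles the weights. *)
Let nonlocal_sum J : \sum_(j < J)
    \sum_(m < N) \sum_(q < N | (q <= m)%N)
      e m * mass (j.+2 + m)%N * A (j.+2 + (m - q))%N
  <= \sum_(l < J + N) A l.+1 * S l.+1.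
Proof.
under [leRHS]eq_bigr do rewrite SE big_distrr/=.
rewrite [leLHS]exchange_big [leRHS]exchange_big/=; apply: ler_sum => m _.
under [leRHS]eq_bigr do rewrite big_distrr/=.
rewrite [leLHS]exchange_big [leRHS]exchange_big/=; apply: ler_sum => q qm.
pose f l := A l.+1 * (e m * mass (l.+1 + q)%N).
have f0 l : 0 <= f l by rewrite /f mulr_ge0 ?mulr_ge0.
have sN : ((m - q).+1 <= N)%N by rewrite (leq_ltn_trans (leq_subr _ _)).
apply: le_trans (le_sum_shift J sN f0).
rewrite le_eqVlt; apply/orP; left; apply/eqP; apply: eq_bigr => j _.
rewrite /f mulrC; congr (A _ * (_ * mass _)).
  by rewrite !addSn addnS.
by rewrite !addSn addnS addSn -addnA subnK.
Qed.

(* The frozen-speed part removes [lam * A j * S j] from the increments of [w], which is what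
   the memory term gives back to them: its weights [d m - d m.+1] are nonnegative. *)
Lemma scheme_total_variation J : \sum_(j < J) `|w' j.+2 - w' j.+1| <=
  \sum_(j < J.+1 + N) `|w j.+1 - w j|.
Proof.
have step j : `|w' j.+2 - w' j.+1| <=
    (1 - lam * a j.+2) * `|w j.+2 - w j.+1| - lam * (A j.+1 * S j.+1)
    + lam * a j.+1 * `|w j.+1 - w j|
    + lam * \sum_(m < N) \sum_(q < N | (q <= m)%N)
      e m * mass (j.+2 + m)%N * A (j.+2 + (m - q))%N.
  rewrite increment_step; apply: le_trans (ler_normD _ _) _.
  apply: lerD; last first.
    by rewrite normrM ger0_norm// ler_wpM2l// nonlocal_term.
  apply: le_trans (ler_normD _ _) _; apply: lerD; last first.
    by rewrite normrM ger0_norm// mulr_ge0.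
  have := cfl j.+1; have := a_sign j.+1; have := S_ge0 j.+1; rewrite /A.
  set x := 1 - _; set D := w _ - _; set y := a _ - _ => S0 yD cflj.
  (* [D] and [y] never have opposite signs and [cflj] makes the first product the larger one, so the
     absolute value of the difference is the difference of the absolute values. *)
  have [D0|D0|D0] := ltgtP D 0.
  - have y0 : y <= 0 by rewrite leNgt; apply/negP => y0; move: yD; rewrite leNgt nmulr_llt0 ?y0.
    move: cflj; rewrite (ltr0_norm D0) (ler0_norm y0) => cflj.
    by rewrite ler_norml; apply/andP; split; nra.
  - have y0 : 0 <= y by rewrite leNgt; apply/negP => y0; move: yD; rewrite leNgt pmulr_llt0 ?y0.
    move: cflj; rewrite (gtr0_norm D0) (ger0_norm y0) => cflj.
    by rewrite ler_norml; apply/andP; split; nra.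
  - move: cflj; rewrite D0 normr0 !mulr0 !sub0r normrN => cflj.
    rewrite normrM ger0_norm// normrM (ger0_norm S0).
    have : 0 <= lam * (`|y| * S j.+1) by rewrite !mulr_ge0.
    lra.
have sum_step : \sum_(j < J) `|w' j.+2 - w' j.+1| <=
   \sum_(j < J) ((1 - lam * a j.+2) * `|w j.+2 - w j.+1|
     + lam * a j.+1 * `|w j.+1 - w j|)
   - lam * \sum_(j < J) A j.+1 * S j.+1
   + lam * \sum_(l < J + N) A l.+1 * S l.+1.
  apply: le_trans (ler_sum _ (fun (j : 'I_J) _ => step j)) _.
  rewrite big_split/= -big_distrr/= lerD ?ler_wpM2l ?nonlocal_sum//.
  rewrite big_distrr/= -sumrB le_eqVlt; apply/orP; left; apply/eqP.
  by apply: eq_bigr => j _; ring.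
apply: (le_trans sum_step); rewrite big_split_ord/= mulrDr.
(* The transported parts telescope: the share [lam * a j.+2] lost by one increment is received by
   the next. *)
have transport : \sum_(j < J) ((1 - lam * a j.+2) * `|w j.+2 - w j.+1|
     + lam * a j.+1 * `|w j.+1 - w j|) =
   \sum_(j < J) `|w j.+2 - w j.+1|
     + lam * a 1%N * `|w 1%N - w 0%N| - lam * a J.+1 * `|w J.+1 - w J|.
  elim: (J) => [|K IH]; first by rewrite !big_ord0; ring.
  by rewrite !big_ord_recr/= IH; ring.
(* The memory looks [N] cells past the last increment counted. No loss term is available there, and
   [cfl] pays with the increments of [w] themselves; hence the range [J.+1 + N]. *)
have tail : lam * \sum_(i < N) A (J + i).+1 * S (J + i).+1
    <= \sum_(i < N) `|w (J + i).+2 - w (J + i).+1|.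
  rewrite big_distrr/=; apply: ler_sum => i _; apply: le_trans (cfl _) _.
  by rewrite ler_piMl// lerBlDr lerDl mulr_ge0.
have head : lam * a 1%N * `|w 1%N - w 0%N| <= `|w 1%N - w 0%N|.
  have := cfl 0; have : 0 <= lam * (A 0%N * S 0%N) by rewrite !mulr_ge0.
  by lra.
rewrite transport big_split_ord/= big_ord_recl/=.
have : 0 <= lam * a J.+1 * `|w J.+1 - w J| by rewrite !mulr_ge0.
set x1 := \sum_(i < J) `|_|.
by move: tail head; set x2 := \sum_(i < N) `|_|; rewrite -/x2; lra.
Qed.
End total_variation_of_the_scheme.

(** * Invariants of the scheme on the whole line *)

Section scheme_on_the_line.
Context {R : realFieldType}.
Variables (N : nat) (d : nat -> R) (D lam L W : R) (b : R -> R).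
Implicit Types Phi : R -> R.

(* For a potential [Phi] of the density, this is the summation by parts of
   [\sum_(m < N) k_m * (Phi (x + m.+1 * D) - Phi (x + m * D))] with [d m = k_m - k_m.+1]. *)
Definition discrete_conv Phi (x : R) : R :=
  \sum_(m < N) d m * (Phi (x + m.+1%:R * D) - Phi x).

Definition scheme Phi (x : R) : R :=
  Phi x - lam * b (discrete_conv Phi x) * (Phi x - Phi (x - D)).

Hypothesis lam_ge0 : 0 <= lam.
Hypothesis d_nonincr : forall m, d m.+1 <= d m.
Hypothesis dN : d N = 0.
Hypothesis b_lip : forall x y, `|b x - b y| <= L * `|x - y|.
Hypothesis b_nonincr : forall x y, x <= y -> b y <= b x.
Hypothesis b_W : b W = 0.
Hypothesis cfl : 2 * lam * L * W <= 1.

(** The potential lives on the whole line and all the grids of step [D] are treated at once: the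
    bound on the variation is uniform in the origin [x], so the grid may later be placed
    anywhere. *)
Definition scheme_invariant (B : R) Phi := [/\
  forall x, Phi x <= Phi (x + D),
  forall x, discrete_conv Phi x <= W &
  forall x J, \sum_(j < J) `|discrete_conv Phi (x + j.+1%:R * D)
                - discrete_conv Phi (x + j%:R * D)| <= B].

Let d_ge0 m : (m <= N)%N -> 0 <= d m.
Proof.
move=> mN; rewrite -dN; elim: (N) mN => [|n IH]; first by rewrite leqn0 => /eqP->.
rewrite leq_eqVlt => /predU1P[->//|/IH]; exact: le_trans.
Qed.

Let L_ge0 : 0 <= L.
Proof. by have := b_lip 1 0; rewrite subr0 normr1 mulr1; exact: le_trans. Qed.

Lemma discrete_conv_ge0 Phi x : (forall y, Phi y <= Phi (y + D)) -> 0 <= discrete_conv Phi x.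
Proof.
move=> Phi_mono; apply: sumr_ge0 => m _; rewrite mulr_ge0 ?d_ge0 1?ltnW// subr_ge0.
elim: m.+1 => [|i IH]; first by rewrite mul0r addr0.
by apply: le_trans IH _; rewrite -natr1 mulrDl mul1r addrA.
Qed.

(** The average stays in [[0, W]], where [b] lies between [b W = 0] and [L * W]. Hence each update
    is a convex combination of the values at [x] and [x - D]. *)
Lemma scheme_speed B Phi x : scheme_invariant B Phi -> 0 <= lam * b (discrete_conv Phi x) <= 1.
Proof.
move=> [Phi_mono conv_le _]; have w_ge0 := discrete_conv_ge0 x Phi_mono.
set w := discrete_conv Phi x in w_ge0 *; have wW : w <= W := conv_le x.
have b_ge0 : 0 <= b w by rewrite -b_W b_nonincr.
rewrite mulr_ge0//=.
have bw : b w <= L * W.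
  have := b_lip w W; rewrite b_W subr0 ger0_norm// => /le_trans; apply.
  by rewrite ler_wpM2l// ler0_norm ?subr_le0//; lra.
have : lam * b w <= lam * (L * W) by rewrite ler_wpM2l.
have : 0 <= lam * (L * W) by rewrite !mulr_ge0// (le_trans w_ge0).
by have := cfl; lra.
Qed.

Lemma scheme_preserves B Phi :
  scheme_invariant B Phi -> scheme_invariant B (scheme Phi).
Proof.
move=> [Phi_mono conv_le tv_le].
have grid x j : x + j%:R * D + D = x + j.+1%:R * D.
  by rewrite -natr1; ring.
have grid_mono x j i : Phi (x + j%:R * D) <= Phi (x + (j + i)%:R * D).
  elim: i => [|i IH]; first by rewrite addn0.
  by apply: le_trans IH _; rewrite addnS -grid.
pose w := discrete_conv Phi.
have w_ge0 x : 0 <= w x by exact: discrete_conv_ge0.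
have W_ge0 : 0 <= W := le_trans (w_ge0 0) (conv_le 0).
have b_ge0 x : 0 <= b (w x) by rewrite -b_W b_nonincr.
have b_leLW x : b (w x) <= L * W.
  have := b_lip (w x) W; rewrite b_W subr0 ger0_norm// => /le_trans; apply.
  rewrite ler_wpM2l// ler0_norm ?subr_le0//.
  by have := w_ge0 x; lra.
have lamLW : 0 <= lam * (L * W) by rewrite !mulr_ge0.
have lamLW_le : 2 * (lam * (L * W)) <= 1 by rewrite !mulrA.
have lamb_ge0 x : 0 <= lam * b (w x) by rewrite mulr_ge0.
have lamb_le1 x : lam * b (w x) <= lam * (L * W) by rewrite ler_wpM2l.
pose mass x j := Phi (x + j.+1%:R * D) - Phi (x + j%:R * D).
have mass_ge0 x j : 0 <= mass x j.
  by rewrite subr_ge0 /mass -addn1 grid_mono.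
pose S x j := \sum_(m < N) d m * mass x (j + m)%N.
have S_le x j : S x j <= w (x + j%:R * D).
  apply: ler_sum => m _; rewrite ler_wpM2l ?d_ge0 1?ltnW// /mass.
  rewrite -addrA -mulrDl -natrD addnS lerD2l lerN2.
  exact: grid_mono.
have S_ge0 x j : 0 <= S x j.
  by apply: sumr_ge0 => m _; rewrite mulr_ge0 ?d_ge0// ltnW.
(* A discrete product rule: the coefficient at the base point is pulled out, and its differences
   with the coefficients further right form the memory term. *)
have conv_step (a Psi : R -> R) x j :
    (forall y, Psi y = Phi y - lam * a y * (Phi y - Phi (y - D))) ->
    discrete_conv Psi (x + j.+1%:R * D) = w (x + j.+1%:R * D)
    - lam * a (x + j.+1%:R * D) * (w (x + j.+1%:R * D) - w (x + j%:R * D))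
    + lam * \sum_(m < N) d m * (a (x + j.+1%:R * D)
        - a (x + (j.+1 + m).+1%:R * D)) * mass x (j.+1 + m)%N.
  move=> PsiE; rewrite /w /discrete_conv mulrBr !big_distrr/= -!sumrB -big_split/=.
  apply: eq_bigr => m _; rewrite /mass !PsiE.
  have e1 : x + j.+1%:R * D + m.+1%:R * D = x + (j.+1 + m).+1%:R * D.
    by rewrite -addrA -mulrDl -natrD addnS.
  have e2 : x + j%:R * D + m.+1%:R * D = x + (j.+1 + m)%:R * D.
    by rewrite -addrA -mulrDl -natrD addnS addSn.
  rewrite e1 e2 -(grid x (j.+1 + m)%N) -(grid x j) !addrK.
  ring.
have conv_schemeE x j := conv_step _ (scheme Phi) x j (fun=> erefl).
split.
- move=> x; rewrite /scheme -/(discrete_conv Phi) addrK -/w.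
  have := Phi_mono x; have := Phi_mono (x - D); rewrite subrK.
  set p := Phi x; set q := Phi (x + D); set r := Phi (x - D) => rp pq.
  have : 0 <= lam * b (w x) * (p - r) by rewrite mulr_ge0// subr_ge0.
  have : 0 <= (1 - lam * b (w (x + D))) * (q - p).
    by rewrite mulr_ge0 ?subr_ge0// (le_trans (lamb_le1 _))//; lra.
  lra.
(* Maximum principle: since [b W = 0], the memory term is at most [L * (W - w x) * W], which is
   proportional to the distance left to [W]. Both this term and the transport take a fraction at
   most [lam * (L * W)] of that distance. *)
- move=> x; have := conv_schemeE (x - D) 0%N.
  rewrite mul1r mul0r addr0 subrK => ->.
  set rem := \sum_(m < N) _.
  have rem_le : rem <= L * (W - w x) * S (x - D) 1%N.
    rewrite /rem big_distrr/=; apply: ler_sum => m _.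
    rewrite mulrCA -mulrA ler_wpM2l ?d_ge0 1?ltnW// ler_wpM2r// -!/(w _).
    apply: (@le_trans _ _ (b (w x) - b W)); first by rewrite lerD2l lerN2 b_W.
    apply: le_trans (ler_norm _) _; apply: le_trans (b_lip _ _) _.
    by rewrite distrC ger0_norm// subr_ge0.
  have Sw : S (x - D) 1%N <= W.
    by apply: le_trans (S_le _ _) _; rewrite mul1r subrK.
  have := conv_le x; have := conv_le (x - D); have := S_ge0 (x - D) 1%N.
  have := lamb_le1 x; have := lamb_ge0 x; rewrite -/w.
  set s := S _ _ in rem_le Sw *; set p := w x in rem_le *.
  set q := w (x - D); set y := lam * b p => y0 y1 s0 qW pW.
  have lam_rem : lam * rem <= lam * (L * W) * (W - p).
    rewrite -mulrA ler_wpM2l//; apply: le_trans rem_le _.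
    by rewrite mulrAC ler_wpM2r ?subr_ge0// ler_wpM2l.
  have : 0 <= (1 - y - lam * (L * W)) * (W - p).
    by rewrite mulr_ge0 ?subr_ge0//; lra.
  have : 0 <= y * (W - q) by rewrite mulr_ge0 ?subr_ge0.
  lra.
(* [scheme_total_variation] controls the increments from index 1 on, since the update of a cell
   reads its left neighbour; the grid therefore starts at [x - D]. *)
- move=> x J; pose y := x - D.
  have xE j : x + j%:R * D = y + j.+1%:R * D.
    by rewrite -grid /y; ring.
  under eq_bigr do rewrite !xE.
  have b_sign j : 0 <= (b (w (y + j%:R * D)) - b (w (y + j.+1%:R * D)))
      * (w (y + j.+1%:R * D) - w (y + j%:R * D)).
    have [le|lt] := lerP (w (y + j%:R * D)) (w (y + j.+1%:R * D)).
      by rewrite mulr_ge0// subr_ge0// b_nonincr.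
    by rewrite mulr_le0// subr_le0 ?b_nonincr// ltW.
  have cflj j : lam * (`|b (w (y + j%:R * D)) - b (w (y + j.+1%:R * D))| * S y j)
    <= (1 - lam * b (w (y + j.+1%:R * D)))
        * `|w (y + j.+1%:R * D) - w (y + j%:R * D)|.
    have := b_lip (w (y + j%:R * D)) (w (y + j.+1%:R * D)).
    rewrite [X in L * X]distrC; set u : R := `|b _ - _|; set v : R := `|_ - _| => uv.
    have SW : S y j <= W := le_trans (S_le _ _) (conv_le _).
    have : lam * (u * S y j) <= lam * (L * v * W).
      by rewrite ler_wpM2l// ler_pM// normr_ge0.
    have : 0 <= (1 - lam * (L * W) - lam * b (w (y + j.+1%:R * D))) * v.
      by rewrite mulr_ge0 ?normr_ge0//; have := lamb_le1 (y + j.+1%:R * D); lra.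
    lra.
  have := @scheme_total_variation R N d (mass y) _ _
    (fun j => discrete_conv (scheme Phi) (y + j%:R * D)) lam lam_ge0 d_nonincr dN
    (mass_ge0 y) (fun j => b_ge0 (y + j%:R * D)) b_sign cflj (conv_schemeE y) J.
  by move/le_trans; apply; exact: tv_le.
Qed.
End scheme_on_the_line.

(** * Lebesgue integrals on the line *)

Section integrable_real_functions.
Context d (T : measurableType d) {R : realType} (mu : {measure set T -> \bar R}).
Implicit Types (f g : T -> R) (A : set T).

Lemma integrable_EFinD f g A : measurable A ->
  mu.-integrable A (EFin \o f) -> mu.-integrable A (EFin \o g) ->
  mu.-integrable A (EFin \o (fun x => f x + g x)).
Proof. by move=> mA fi gi; apply: (eq_integrable mA _ _ _ (integrableD mA fi gi)). Qed.

Lemma integrable_EFinB f g A : measurable A ->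
  mu.-integrable A (EFin \o f) -> mu.-integrable A (EFin \o g) ->
  mu.-integrable A (EFin \o (fun x => f x - g x)).
Proof. by move=> mA fi gi; apply: (eq_integrable mA _ _ _ (integrableB mA fi gi)). Qed.

Lemma integrable_EFinZl (c : R) f A : measurable A ->
  mu.-integrable A (EFin \o f) -> mu.-integrable A (EFin \o (fun x => c * f x)).
Proof. by move=> mA fi; apply: (eq_integrable mA _ _ _ (integrableZl mA c fi)). Qed.

Lemma ae_impl (P Q : T -> Prop) : (forall x, P x -> Q x) ->
  {ae mu, forall x, P x} -> {ae mu, forall x, Q x}.
Proof. by move=> PQ; apply: filterS. Qed.

Lemma ae_impl2 (P Q S : T -> Prop) : (forall x, P x -> Q x -> S x) ->
  {ae mu, forall x, P x} -> {ae mu, forall x, Q x} -> {ae mu, forall x, S x}.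
Proof. by move=> PQ; apply: filterS2. Qed.

End integrable_real_functions.

Section lebesgue_integral_tools.
Context {R : realType}.
Notation mu := (@lebesgue_measure R).
Implicit Types f v : R -> R.

Lemma measurable_affine (c b : R) : measurable_fun setT (fun y : R => c * y + b).
Proof. by apply: measurable_funD => //; exact: measurable_funM. Qed.

(** Multiplied by [c], the push-forward of Lebesgue measure under the affine map has the right value
    on bounded intervals, which characterises Lebesgue measure. *)
Lemma lebesgue_measure_affine (c b : R) (A : set R) : 0 < c -> measurable A ->
  mu ((fun y : R => c * y + b) @^-1` A) = (c^-1%:E * mu A)%E.
Proof.
move=> c0 mA; have c00 : 0 <= c by exact: ltW.
pose phi := (fun y : R => c * y + b) : measurableTypeR R -> measurableTypeR R.
have mphi : measurable_fun setT phi by exact: measurable_affine.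
pose nu := mscale (NngNum c00) (pushforward mu phi).
suff -> : mu A = nu mphi A.
  by rewrite /nu /mscale/= muleA -EFinM mulVf ?gt_eqF// mul1e.
apply: lebesgue_measure_unique => // _ [[p q]] _ <-/=.
rewrite /nu /mscale/= /pushforward.
have -> : phi @^-1` [set` `]p, q]] = [set` `](p - b) / c, (q - b) / c]].
  apply/seteqP; split => y /=; rewrite !in_itv/= /phi ltr_pdivrMr// ler_pdivlMr//;
    by rewrite ltrBlDr lerBrDr mulrC.
rewrite !lebesgue_measure_itv/= !lte_fin ltr_pM2r ?invr_gt0// ltrD2r.
case: ifPn => _; last by rewrite mule0.
by rewrite -!EFinD -EFinM; congr EFin; field; exact: lt0r_neq0.
Qed.

Lemma ge0_integral_affine (c b : R) (f : R -> \bar R) : 0 < c ->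
  measurable_fun setT f -> (forall x, 0 <= f x)%E ->
  (\int[mu]_y f (c * y + b)%R = c^-1%:E * \int[mu]_y f y)%E.
Proof.
move=> c0 mf f0; have c00 : 0 <= c^-1 by rewrite invr_ge0 ltW.
pose phi := (fun y : R => c * y + b) : measurableTypeR R -> measurableTypeR R.
have mphi : measurable_fun setT phi by exact: measurable_affine.
have := @ge0_integral_pushforward _ _ _ _ R phi mphi mu setT f measurableT mf.
rewrite preimage_setT => <- //.
rewrite -(ge0_integral_mscale mu measurableT (NngNum c00))//.
apply: eq_measure_integral => A mA _.
exact: lebesgue_measure_affine.
Qed.

Lemma ge0_integral_reflect (x : R) (f : R -> \bar R) :
  measurable_fun setT f -> (forall x, 0 <= f x)%E ->
  (\int[mu]_y f (x - y)%R = \int[mu]_y f y)%E.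
Proof.
move=> mf f0.
pose g y := f (1 * y + x).
have mg : measurable_fun setT g.
  by apply: measurableT_comp => //; exact: measurable_affine.
transitivity (\int[mu]_y g (- y)%R)%E.
  by apply: eq_integral => y _; rewrite /g mul1r addrC.
transitivity (\int[mu]_y g y)%E; last first.
  by rewrite (ge0_integral_affine x ltr01 mf f0) invr1 mul1e.
pose phi := (fun y : R => - y) : measurableTypeR R -> measurableTypeR R.
have mphi : measurable_fun setT phi by exact: oppr_measurable.
have := @ge0_integral_pushforward _ _ _ _ R phi mphi mu setT g measurableT mg.
rewrite preimage_setT => <- //; last by move=> y _; exact: f0.
by apply: eq_measure_integral => A mA _; exact: lebesgue_measureN.
Qed.

Lemma ae_reflect (x : R) (P : set R) :
  {ae mu, forall y, P y} -> {ae mu, forall y, P (x - y)}.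
Proof.
move=> [N [mN N0 PN]].
have mphi : measurable_fun setT (fun y : R => x - y).
  by apply: measurable_funB.
have mN' : measurable ((fun y : R => x - y) @^-1` N : set R).
  by rewrite -[X in measurable X]setTI; exact: mphi.
exists ((fun y => x - y) @^-1` N); split => //; last by move=> y /= /PN.
have mu_indic (B : set R) : measurable B -> (\int[mu]_y (\1_B y)%:E = mu B)%E.
  by move=> mB; rewrite integral_indic// setIT.
rewrite -N0 -(mu_indic _ mN) -(mu_indic _ mN').
rewrite -(@ge0_integral_reflect x (fun y => (\1_N y)%:E))//.
exact/measurable_EFinP/measurable_indic.
Qed.

Lemma ae_neq0 : {ae mu, forall x : R, x != 0}.
Proof.
exists [set 0]; split; [exact: measurable_set1|exact: lebesgue_measure_set1|].
by move=> x /negP; rewrite negbK => /eqP.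
Qed.

Lemma integrable_supported f (a b B : R) : a <= b ->
  measurable_fun setT f -> (forall y, `|f y| <= B) ->
  (forall y, f y != 0 -> a <= y <= b) ->
  mu.-integrable setT (EFin \o f) /\ `|\int[mu]_y f y| <= B * (b - a).
Proof.
move=> ab mf fB fs.
have B0 : 0 <= B by apply: le_trans (fB 0).
have fE : f = f \_ `[a, b].
  apply/funext => y; rewrite /patch; case: ifPn => // yab.
  apply/eqP/negPn/negP => /fs; apply/negP.
  by move: yab; rewrite notin_setE/= in_itv/= => /negP.
have muab : mu `[a, b] = (b - a)%:E.
  rewrite lebesgue_measure_itv/= lte_fin EFinB.
  by case: ltgtP ab => // -> _; rewrite subee.
have muab_lty : (mu `[a, b] < +oo)%E by rewrite muab ltry.
have iab : mu.-integrable `[a, b] (EFin \o f).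
  apply: measurable_bounded_integrable => //.
  - exact: measurable_funTS.
  - exists B; split; first exact: num_real.
    by move=> x Bx y _; apply: (le_trans (fB y)); exact: ltW.
split.
  rewrite fE -restrict_EFin; apply: (integrable_mkcond _ _).1 => //.
rewrite fE -Rintegral_mkcond.
apply: le_trans (le_normr_Rintegral _ iab) _ => //.
have : \int[mu]_(t in `[a, b]) `|f t| <= \int[mu]_(t in `[a, b]) B.
  apply: le_Rintegral => //.
    exact: integrable_norm.
  apply: measurable_bounded_integrable => //.
  exists B; split; first exact: num_real.
  by move=> x Bx y _ /=; rewrite ger0_norm// ltW.
move/le_trans; apply; rewrite Rintegral_cst// le_eqVlt; apply/orP; left.
by rewrite (_ : fine _ = b - a)// -[RHS]/(fine (b - a)%:E) -muab.
Qed.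
End lebesgue_integral_tools.

(** * Weak formulation and mollification *)

Section smooth_functions_of_one_variable.
Context {R : realType}.
Implicit Types f g : R -> R.

(** The derivative is an existential witness, so closure under products, inverses and affine changes
    of variable is an induction on the order, with no iterated [derive1] to unfold. *)
Fixpoint times_derivable (n : nat) f : Prop :=
  if n is n'.+1 then
    exists f' : R -> R, (forall x : R, is_derive x (1 : R) f (f' x)) /\ times_derivable n' f'
  else True.

Definition smooth1 f := forall n, times_derivable n f.

Lemma is_derive_derive1 f f' :
  (forall x : R, is_derive x (1 : R) f (f' x)) -> derive1 f = f'.
Proof. by move=> df; apply/funext => x; rewrite derive1E; exact: derive_val. Qed.

Lemma smooth1_is_derive f : smooth1 f ->
  (forall x : R, is_derive x (1 : R) f (derive1 f x)) /\ smooth1 (derive1 f).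
Proof.
move=> sf; have [f' [df _]] := sf 1%N.
split=> [x|n]; first by rewrite (is_derive_derive1 df).
by have [g [dg sg]] := sf n.+1; rewrite (is_derive_derive1 dg).
Qed.

Lemma times_derivableW n f : times_derivable n.+1 f -> times_derivable n f.
Proof.
elim: n f => [//|n IH] f [f' [df sf']]; exists f'; split => //.
exact: IH.
Qed.

Lemma times_derivable_cst n (c : R) : times_derivable n (cst c).
Proof.
elim: n c => [//|n IH] c; exists (cst 0); split => // x.
exact: is_derive_cst.
Qed.

Lemma times_derivableD n f g : times_derivable n f -> times_derivable n g ->
  times_derivable n (f \+ g).
Proof.
elim: n f g => [//|n IH] f g [f' [df sf']] [g' [dg sg']].
exists (f' \+ g'); split; last exact: IH.
by move=> x; apply: is_deriveD.
Qed.

Lemma times_derivableM n f g : times_derivable n f -> times_derivable n g ->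
  times_derivable n (f \* g).
Proof.
elim: n f g => [//|n IH] f g sf sg.
have [[f' [df sf']] [g' [dg sg']]] := (sf, sg).
exists ((f \* g') \+ (g \* f')); split.
  by move=> x; apply: is_deriveM.
by apply: times_derivableD; apply: IH => //; exact: times_derivableW.
Qed.

Lemma times_derivableV n f : (forall x, f x != 0) -> times_derivable n f ->
  times_derivable n (fun x => (f x)^-1).
Proof.
move=> f0; elim: n => [//|n IH] sf; have [f' [df sf']] := sf.
exists (cst (-1) \* ((fun x => (f x)^-1) \* ((fun x => (f x)^-1) \* f'))); split.
  move=> x; apply: (is_derive_eq (is_deriveV (f0 x) (df x))).
  by rewrite /= expr2 invfM /GRing.scale/=; ring.
apply: times_derivableM; first exact: times_derivable_cst.
have IHf := IH (times_derivableW sf).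
by do 2 apply: times_derivableM => //.
Qed.

Lemma times_derivable_affine n (c b : R) f : times_derivable n f ->
  times_derivable n (fun x => f (c * x + b)).
Proof.
elim: n f => [//|n IH] f [f' [df sf']].
exists (cst c \* (fun x => f' (c * x + b))); split; last first.
  apply: times_derivableM; first exact: times_derivable_cst.
  exact: IH.
move=> x; have d1 : is_derive x 1 (fun y : R => c * y + b) c.
  by apply: is_derive_eq; rewrite /= addr0 /GRing.scale/= mulr1.
have := @is_derive1_comp R f (fun y => c * y + b) x _ _ (df _) d1.
by rewrite mulrC.
Qed.

(** Derivatives of members of this family are linear combinations of members, so smoothness follows
    by an induction that treats all [n] together. *)
Let flat (n : nat) (x : R) : R := if 0 < x then x^-1 ^+ n * expR (- x^-1) else 0.

(** The term of order [n.+1] of the exponential series at [x^-1] beats the power [n] with one factor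
    [x] to spare; this gives continuity at 0. *)
Let flat_le n x : `|flat n x| <= (n.+1)`!%:R * `|x|.
Proof.
rewrite /flat; case: ifPn => x0; last by rewrite normr0 mulr_ge0.
rewrite (gtr0_norm x0) ger0_norm ?mulr_ge0 ?expR_ge0 ?exprn_ge0 ?invr_ge0 ?(ltW x0)//.
have y0 : 0 < x^-1 by rewrite invr_gt0.
have := expR_ge1Dxn n (ltW y0).
have e0 := expR_gt0 x^-1.
rewrite expRN ler_pdivrMr// => h.
have -> : x^-1 ^+ n = x * x^-1 ^+ n.+1.
  by rewrite exprS mulrA mulfV ?gt_eqF// mul1r.
rewrite mulrAC mulrC ler_wpM2r ?(ltW x0)//.
rewrite mulrC -ler_pdivrMr ?ltr0n ?fact_gt0//.
by apply: le_trans h; rewrite lerDr.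
Qed.

Let flat_gt0E n (x : R) : 0 < x -> flat n x = x^-1 ^+ n * expR (- x^-1).
Proof. by rewrite /flat => ->. Qed.

Let flat_le0E n (x : R) : x <= 0 -> flat n x = 0.
Proof. by rewrite /flat ltNge => ->. Qed.

Let flat_derive n (x : R) :
  is_derive x (1 : R) (flat n) (flat n.+2 x - n%:R * flat n.+1 x).
Proof.
have [x0|x0|->] := ltgtP x 0.
- rewrite !(flat_le0E _ (ltW x0)) mulr0 subr0.
  apply: (@near_eq_is_derive _ _ _ (cst 0)).
    by near=> y; rewrite flat_le0E//; near: y; exact: lt_le_nbhsl.
- have powE y : ((fun y : R => y^-1) ^+ n) y = y^-1 ^+ n.
    by elim: n => [//|n IH]; rewrite !exprS -IH.
  apply: (near_eq_is_derive (f := (fun y : R => y^-1) ^+ n * (expR \o (fun y : R => - y^-1)))).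
    near=> y; rewrite flat_gt0E; first by rewrite -powE.
    by near: y; exact: lt_nbhsr.
  rewrite !flat_gt0E//.
  have xn0 : x != 0 by rewrite gt_eqF.
  have di : is_derive x (1 : R) (fun y : R => y^-1) (- x ^- 2).
    apply: (is_derive_eq (is_deriveV (f := id) xn0 (is_derive_id _ _))).
    by rewrite /GRing.scale/= mulr1.
  have dp := is_deriveX n di.
  have dn : is_derive x (1 : R) (fun y : R => - y^-1) (x ^- 2).
    by apply: (is_derive_eq (is_deriveN di)); rewrite opprK.
  have de := @is_derive1_comp R expR _ x _ _ (is_derive_expR _) dn.
  apply: (is_derive_eq (is_deriveM dp de)).
  rewrite powE /GRing.scale/= -!exprVn; case: n {dp powE} => [|n]; first by rewrite mul0r; ring.
  by rewrite /= !exprS; ring.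
- rewrite !(flat_le0E _ (lexx 0)) mulr0 subr0.
  (* At 0 the difference quotient of [flat n] is exactly [flat n.+1], which is continuous there by
     [flat_le]. *)
  apply/is_derive1_caratheodory; exists (flat n.+1); split.
  + move=> z; rewrite subr0 (flat_le0E _ (lexx 0)) subr0.
    have [z0|z0] := ltP 0 z; last by rewrite !flat_le0E// mul0r.
    by rewrite !flat_gt0E// exprSr mulrAC divfK// gt_eqF.
  + apply/cvgrPdist_le => e e0; near=> y.
    rewrite (flat_le0E _ (lexx 0)) sub0r normrN.
    apply: le_trans (flat_le _ _) _.
    rewrite mulrC -ler_pdivlMr ?ltr0n ?fact_gt0//.
    near: y; apply/nbhs_normP; exists (e / (n.+2)`!%:R).
      by rewrite /= divr_gt0 ?ltr0n ?fact_gt0.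
    by move=> y /=; rewrite sub0r normrN => /ltW.
  + exact: flat_le0E.
Unshelve. all: by end_near. Qed.

Let smooth_flat n : smooth1 (flat n).
Proof.
move=> k; elim: k n => [//|k IH] n.
exists (flat n.+2 \+ (cst (- n%:R) \* flat n.+1)); split.
  by move=> x; rewrite /= mulNr; exact: flat_derive.
apply: times_derivableD => //; apply: times_derivableM => //.
exact: times_derivable_cst.
Qed.

(** The quotient of [flat 0 x] by [flat 0 x + flat 0 (1 - x)]: the denominator never vanishes, as
    [x] or [1 - x] is positive. *)
Lemma smooth_step_exists : exists H : R -> R, [/\ smooth1 H,
  forall x, x <= 0 -> H x = 0,
  forall x, 1 <= x -> H x = 1 &
  forall x, 0 <= H x <= 1].
Proof.
pose den x := flat 0 x + flat 0 ((-1) * x + 1).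
have flat_ge0 x : 0 <= flat 0 x.
  by rewrite /flat; case: ifPn => // _; rewrite mul1r expR_ge0.
have flat_gt0 x : 0 < x -> 0 < flat 0 x.
  by move=> x0; rewrite flat_gt0E// mul1r expR_gt0.
have den0 x : 0 < den x.
  have [x0|x0] := ltP 0 x; first by rewrite /den ltr_wpDr ?flat_gt0.
  by rewrite /den ltr_wpDl// flat_gt0//; lra.
exists (flat 0 \* (fun x => (den x)^-1)); split.
- move=> n; apply: times_derivableM; first exact: smooth_flat.
  apply: times_derivableV; first by move=> x; rewrite gt_eqF.
  apply: times_derivableD; first exact: smooth_flat.
  exact/times_derivable_affine/smooth_flat.
- by move=> x x0 /=; rewrite flat_le0E// mul0r.
- move=> x x1 /=; have := den0 x; rewrite /den.
  rewrite (flat_le0E 0 (_ : -1 * x + 1 <= 0)); last lra.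
  by rewrite addr0 => ?; rewrite divff// gt_eqF.
- move=> x /=; rewrite divr_ge0//= ?(ltW (den0 _))//=.
  by rewrite ler_pdivrMr// mul1r /den lerDl.
Qed.

End smooth_functions_of_one_variable.

Section smooth_step_function.
Context {R : realType}.
Implicit Types f : R -> R.

Lemma is_derive_continuous f f' :
  (forall x : R, is_derive x (1 : R) f (f' x)) -> continuous f.
Proof.
by move=> df x; apply/differentiable_continuous/derivable1_diffP; exact: ex_derive.
Qed.

Lemma smooth1_continuous f : smooth1 f -> continuous f.
Proof. by move=> /smooth1_is_derive[/is_derive_continuous]. Qed.

Lemma derive1_near_cst f (c x : R) : (\forall y \near x, f y = c) -> derive1 f x = 0.
Proof.
move=> fc; rewrite derive1E (@near_eq_derive _ _ _ f (cst c))//.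
by rewrite derive_cst.
Qed.

Lemma continuous_supported_bounded f (a b : R) : a <= b -> continuous f ->
  (forall x, f x != 0 -> a <= x <= b) -> exists C, forall x, `|f x| <= C.
Proof.
move=> ab cf fs.
have cfn : {within `[a, b], continuous (fun x => `|f x|)}.
  by apply: continuous_subspaceT => x; apply: continuous_comp; [exact: cf|exact: norm_continuous].
have [c _ cmax] := EVT_max ab cfn.
exists `|f c| => x; have [->|/fs xab] := eqVneq (f x) 0.
  by rewrite normr0.
by apply: cmax; rewrite in_itv.
Qed.

(** The bound on the first derivative controls the mollifier built from [H], the bound on the second
    its Lipschitz constant. *)
Record smooth_step (H : R -> R) (C : R) : Prop := SmoothStep {
  step_smooth : smooth1 H;
  step_le0 : forall x, x <= 0 -> H x = 0;
  step_ge1 : forall x, 1 <= x -> H x = 1;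
  step_01 : forall x, 0 <= H x <= 1;
  step_derive_supp : forall x, derive1 H x != 0 -> 0 <= x <= 1;
  step_derive_le : forall x, `|derive1 H x| <= C;
  step_derive2_le : forall x, `|derive1 (derive1 H) x| <= C }.

Lemma ex_smooth_step : exists H C, smooth_step H C.
Proof.
have [H [sH H0 H1 H01]] := @smooth_step_exists R.
have supp (f : R -> R) : (forall x, x < 0 -> f x = f (-1)) ->
    (forall x, 1 < x -> f x = f 2) -> forall x, derive1 f x != 0 -> 0 <= x <= 1.
  move=> f0 f1 x dx; rewrite leNgt [_ <= 1]leNgt -negb_or.
  apply: contraNN dx => /orP[x0|x1]; apply/eqP.
    apply: (derive1_near_cst (c := f (-1))).
    have := lt_nbhsl x0.
    apply: filterS.
    by move=> y; exact: f0.
  apply: (derive1_near_cst (c := f 2)).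
  have := lt_nbhsr x1.
  apply: filterS.
  by move=> y; exact: f1.
have supp1 : forall x, derive1 H x != 0 -> 0 <= x <= 1.
  apply: supp => x hx; first by rewrite !H0 ?(ltW hx)//; lra.
  by rewrite !H1 ?(ltW hx)//; lra.
have supp2 : forall x, derive1 (derive1 H) x != 0 -> 0 <= x <= 1.
  have d0 x : ~~ (0 <= x <= 1) -> derive1 H x = 0.
    by move=> hx; apply/eqP; apply: contraNT hx => /supp1.
  apply: supp => x hx; rewrite !d0// negb_and -!ltNge ?hx ?orbT//.
    by rewrite oppr_lt0 ltr01.
  by rewrite [1 < 2]ltr1n orbT.
have [_ sH'] := smooth1_is_derive sH; have [_ sH''] := smooth1_is_derive sH'.
have [C1 HC1] := continuous_supported_bounded ler01 (smooth1_continuous sH') supp1.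
have [C2 HC2] := continuous_supported_bounded ler01 (smooth1_continuous sH'') supp2.
exists H, (Num.max C1 C2); split; [exact: sH|exact: H0|exact: H1|exact: H01
  |exact: supp1|move=> x|move=> x].
  by rewrite le_max HC1.
by rewrite le_max HC2 orbT.
Qed.

(** Partial derivatives of a product of a function of [t] and a function of [x] are again such
    products, which reduces joint smoothness to one variable. *)
Lemma test_function_tensor (theta beta : R -> R) (a b a' b' : R) :
  smooth1 theta -> smooth1 beta ->
  (forall t, theta t != 0 -> a <= t <= b) ->
  (forall x, beta x != 0 -> a' <= x <= b') ->
  test_function (fun t x => theta t * beta x).
Proof.
move=> st sb supt supb; split; last first.
  apply: (@subclosed_compact _ _ (`[a, b] `*` `[a', b'])).
  - exact: closed_closure.
  - by apply: compact_setX; exact: segment_compact.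
  - rewrite closureE; apply: smallest_sub.
      rewrite (_ : _ `*` _ = fst @^-1` `[a, b] `&` snd @^-1` `[a', b'])//.
      apply: closedI; apply: closed_comp; try exact: itv_closed.
        by move=> [t x] _; exact: cvg_fst.
      by move=> [t x] _; exact: cvg_snd.
    move=> [t x] /=; rewrite mulf_eq0 negb_or => /andP[/supt ht /supb hx].
    by rewrite /= !in_itv.
have iterE s : exists theta1 beta1, [/\ smooth1 theta1, smooth1 beta1 &
    iter_partial s (fun t x => theta t * beta x) =
    (fun t x => theta1 t * beta1 x)].
  elim: s => [|[] s [th [be [sth sbe IH]]]]; first by exists theta, beta.
    have [dth sth'] := smooth1_is_derive sth.
    exists (derive1 th), be; split => //=; rewrite IH.
    apply/funext => t; apply/funext => x; rewrite /partial_t derive1E.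
    apply: derive_val; apply: (is_derive_eq (is_deriveM (dth t) (is_derive_cst _ _ _))).
    by rewrite /GRing.scale/= mulr0 add0r mulrC.
  have [dbe sbe'] := smooth1_is_derive sbe.
  exists th, (derive1 be); split => //=; rewrite IH.
  apply/funext => t; apply/funext => x; rewrite /partial_x derive1E.
  apply: derive_val; apply: (is_derive_eq (is_deriveM (is_derive_cst _ _ _) (dbe x))).
move=> s; have [th [be [sth sbe ->]]] := iterE s.
split.
  move=> [t x]; apply: continuousM.
    apply: continuous_comp; first exact: cvg_fst.
    exact: smooth1_continuous.
  apply: continuous_comp; first exact: cvg_snd.
  exact: smooth1_continuous.
have [dth _] := smooth1_is_derive sth; have [dbe _] := smooth1_is_derive sbe.
move=> t x; split.
  by apply: derivableM => //; exact: ex_derive.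
by apply: derivableM => //; exact: ex_derive.
Qed.
End smooth_step_function.

Section parametric_integrals.
Context d (T : measurableType d) {R : realType}.
Notation mu := (@lebesgue_measure R).

(** The integral is the difference of those of the positive and negative parts, each measurable by
    Tonelli; slices that are not integrable are covered too. *)
Lemma measurable_Rintegral_slice (f : T * R -> R) : measurable_fun setT f ->
  measurable_fun setT (fun t => \int[mu]_x f (t, x)).
Proof.
move=> mf; have mfE : measurable_fun setT (EFin \o f) by exact/measurable_EFinP.
apply: (measurableT_comp (fine_measurable measurableT)).
under eq_fun do rewrite integralE.
apply: emeasurable_funB.
  have H := measurable_fun_fubini_tonelli_F (m2 := mu) _ (measurable_funepos mfE)
    (funepos_ge0 _).
  by apply: (eq_measurable_fun _ _ H) => t _; apply: eq_integral => y _; rewrite !funeposE.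
have H := measurable_fun_fubini_tonelli_F (m2 := mu) _ (measurable_funeneg mfE)
  (funeneg_ge0 _).
by apply: (eq_measurable_fun _ _ H) => t _; apply: eq_integral => y _; rewrite !funenegE.
Qed.

End parametric_integrals.

Section partial_derivatives_of_tensors.
Context {R : realType}.
Implicit Types theta beta : R -> R.

Lemma partial_t_tensor theta beta t x : smooth1 theta ->
  partial_t (fun t x => theta t * beta x) t x = derive1 theta t * beta x.
Proof.
move=> /smooth1_is_derive[dth _]; rewrite /partial_t derive1E.
apply: derive_val; apply: (is_derive_eq (is_deriveM (dth t) (is_derive_cst _ _ _))).
by rewrite /GRing.scale/= mulr0 add0r mulrC.
Qed.

Lemma partial_x_tensor theta beta t x : smooth1 beta ->
  partial_x (fun t x => theta t * beta x) t x = theta t * derive1 beta x.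
Proof.
move=> /smooth1_is_derive[dbe _]; rewrite /partial_x derive1E.
by apply: derive_val; apply: (is_derive_eq (is_deriveM (is_derive_cst _ _ _) (dbe x))).
Qed.

Lemma smooth1_affine (c b : R) (f : R -> R) : smooth1 f ->
  smooth1 (fun x => f (c * x + b)).
Proof. by move=> sf n; exact: times_derivable_affine. Qed.

Lemma derive1_affine (c b : R) (f : R -> R) x : smooth1 f ->
  derive1 (fun x => f (c * x + b)) x = c * derive1 f (c * x + b).
Proof.
move=> /smooth1_is_derive[df _]; rewrite derive1E.
have d1 : is_derive x 1 (fun y : R => c * y + b) c.
  by apply: is_derive_eq; rewrite /= addr0 /GRing.scale/= mulr1.
have := @is_derive1_comp R f (fun y => c * y + b) x _ _ (df _) d1.
by move=> /@derive_val ->; rewrite mulrC.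
Qed.

Lemma smooth1B f g : @smooth1 R f -> smooth1 g -> smooth1 (fun x => f x - g x).
Proof.
move=> sf sg n; have := times_derivableD (sf n)
  (times_derivableM (times_derivable_cst n (-1)) (sg n)).
congr times_derivable; apply/funext => x /=; ring.
Qed.

Lemma derive1B f g (x : R) : @smooth1 R f -> smooth1 g ->
  derive1 (fun x => f x - g x) x = derive1 f x - derive1 g x.
Proof.
move=> /smooth1_is_derive[df _] /smooth1_is_derive[dg _].
rewrite [LHS]derive1E.
exact: (@derive_val _ _ _ _ _ _ _ (is_deriveB (df x) (dg x))).
Qed.

End partial_derivatives_of_tensors.

(** * One-sided mollification at Lebesgue points *)

Section mollification_at_lebesgue_points.
Context {R : realType}.
Notation mu := (@lebesgue_measure R).
Variables (H : R -> R) (C : R) (stepH : smooth_step H C).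

Lemma step_C_ge0 : 0 <= C.
Proof. exact: le_trans (normr_ge0 _) (step_derive_le stepH 0). Qed.

Lemma measurable_smooth1 (f : R -> R) : smooth1 f -> measurable_fun setT f.
Proof. by move=> /smooth1_continuous; exact: continuous_measurable_fun. Qed.

(** The derivative of the step of width [eta], supported on [[0, eta]]. It has integral 1 and is
    bounded by [C / eta]; its sign is left open. *)
Definition mollifier (eta z : R) : R := eta^-1 * derive1 H (z / eta).

Lemma mollifier_supp eta z : 0 < eta -> mollifier eta z != 0 -> 0 <= z <= eta.
Proof.
move=> e0; rewrite /mollifier mulf_eq0 negb_or => /andP[_ /(step_derive_supp stepH)].
by rewrite ler_pdivlMr// mul0r ler_pdivrMr// mul1r.
Qed.

Lemma mollifier_le eta z : 0 < eta -> `|mollifier eta z| <= C / eta.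
Proof.
move=> e0; rewrite normrM gtr0_norm ?invr_gt0// mulrC.
by rewrite ler_pM2r ?invr_gt0// (step_derive_le stepH).
Qed.

Lemma measurable_mollifier eta : measurable_fun setT (mollifier eta).
Proof.
apply: measurable_funM => //; apply: measurable_smooth1.
have [_ sH'] := smooth1_is_derive (step_smooth stepH).
have := smooth1_affine eta^-1 0 sH'.
by congr smooth1; apply/funext => x; rewrite addr0 mulrC.
Qed.

Lemma smooth_step_scaled eta s : smooth1 (fun t => H ((t - s) / eta)).
Proof.
have := smooth1_affine eta^-1 (- (s / eta)) (step_smooth stepH).
by congr smooth1; apply/funext => t; rewrite mulrBl mulrC.
Qed.

Lemma derive_step_scaled eta s (t : R) :
  is_derive t 1 (fun t => H ((t - s) / eta)) (mollifier eta (t - s)).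
Proof.
have sH := smooth1_affine eta^-1 (- (s / eta)) (step_smooth stepH).
have [d _] := smooth1_is_derive sH.
have := d t; rewrite (derive1_affine _ _ _ (step_smooth stepH)).
have e (x : R) : eta^-1 * x - s / eta = (x - s) / eta by rewrite mulrBl mulrC.
by rewrite e; under eq_fun do rewrite e.
Qed.

Lemma Rintegral_mollifier eta s : 0 < eta ->
  \int[mu]_t mollifier eta (t - s) = 1.
Proof.
move=> e0.
have supp : mollifier eta \o (fun t => t - s) =
   (mollifier eta \o (fun t => t - s)) \_ `[s, s + eta].
  apply/funext => t; rewrite /patch; case: ifPn => // /negP ts /=.
  apply/eqP/negPn/negP => /(mollifier_supp e0) tse; apply: ts.
  by rewrite inE/= in_itv/=; lra.
rewrite (_ : (fun t => _) = mollifier eta \o (fun t => t - s))// supp.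
rewrite -Rintegral_mkcond /Rintegral.
rewrite (@continuous_FTC2 _ _ (fun t => H ((t - s) / eta))) ?ltrDl//.
- rewrite subrr mul0r (step_le0 stepH (lexx 0)).
  have -> : (s + eta - s) / eta = 1 by field; exact: lt0r_neq0.
  by rewrite (step_ge1 stepH (lexx 1)) sube0.
- apply: continuous_subspaceT.
  have [_] := smooth1_is_derive (smooth_step_scaled eta s).
  move=> /smooth1_continuous; congr (continuous _).
  apply/funext => _; apply: is_derive_derive1 => t; exact: derive_step_scaled.
- have cH := smooth1_continuous (smooth_step_scaled eta s).
  split=> [t _||]; first by apply: ex_derive; exact: derive_step_scaled.
    by apply: cvg_at_right_filter; exact: cH.
  by apply: cvg_at_left_filter; exact: cH.
- by move=> t _; rewrite derive1E; apply: derive_val; exact: derive_step_scaled.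
Qed.

Lemma mollify_lebesgue_pt (g : R -> R) (B s e eta0 : R) :
  measurable_fun setT g -> (forall t, `|g t| <= B) -> lebesgue_pt g s ->
  0 < e -> 0 < eta0 -> exists2 eta, 0 < eta < eta0 &
    `|\int[mu]_t (mollifier eta (t - s) * g t) - g s| <= e.
Proof.
move=> mg gB gs e0 eta00.
(* With [eta = r / 2] the kernel is at most [2 * C / r] and lives in [ball s r], of length [2 * r],
   so the error is at most [4 * C] times the mean oscillation of [g] on that ball. *)
have C1 : 0 < 4 * (C + 1) by have := step_C_ge0; lra.
near (0 : R)^'+ => r.
have r0 : 0 < r by near: r; exact: nbhs_right_gt.
have r1 : r < 2 * eta0 by near: r; apply: nbhs_right_lt; rewrite mulr_gt0.
have : (davg g s r < (e / (4 * (C + 1)))%:E)%E.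
  near: r; move/fine_cvgP : gs => [fin lim].
  have c0 : 0 < e / (4 * (C + 1)) by rewrite divr_gt0.
  apply: filterS2 fin (cvgr_lt _ lim _ c0) => r fr.
  by rewrite -lte_fin fineK.
have eta_gt0 : 0 < r / 2 by lra.
rewrite /davg /iavg lebesgue_measure_ball ?(ltW r0)//.
set I := (\int[mu]_(y in ball s r) _)%E => Ilt.
have I_ge0 : (0 <= I)%E by exact: integral_ge0.
exists (r / 2); first by lra.
pose m t := mollifier (r / 2) (t - s).
have supp t : m t != 0 -> s <= t <= s + r / 2.
  by move=> /(mollifier_supp eta_gt0); lra.
have mm : measurable_fun setT m.
  by apply: measurableT_comp; [exact: measurable_mollifier|exact: measurable_funB].
have m_le t : `|m t| <= C / (r / 2) by exact: mollifier_le.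
have s_le : s <= s + r / 2 by lra.
have intm : mu.-integrable setT (EFin \o m).
  exact: (integrable_supported s_le mm m_le supp).1.
have intmg : mu.-integrable setT (EFin \o (fun t => m t * g t)).
  apply: (@integrable_supported _ _ s (s + r / 2) (C / (r / 2) * B) _ _ _ _).1 => //.
  - exact: measurable_funM.
  - by move=> y; rewrite normrM ler_pM.
  - by move=> y; rewrite mulf_eq0 negb_or => /andP[/supp].
have intms : mu.-integrable setT (EFin \o (fun t => m t * g s)).
  rewrite (_ : EFin \o _ = (fun t => (g s)%:E * (EFin \o m) t)%E).
    exact: integrableZl.
  by apply/funext => t /=; rewrite -EFinM mulrC.
have -> : g s = \int[mu]_t (m t * g s).
  by rewrite RintegralZr// Rintegral_mollifier// mul1r.
rewrite -RintegralB// -lee_fin.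
have intD : mu.-integrable setT (EFin \o (fun t => m t * g t - m t * g s)).
  exact: integrable_EFinB.
rewrite EFin_normr_Rintegral//.
apply: (le_trans (le_abse_integral mu measurableT (measurable_int _ intD))).
apply: (@le_trans _ _ ((C / (r / 2))%:E * I)%E).
  rewrite /I -ge0_integralZl//=; last 3 first.
  - exact: measurable_ball.
  - apply: measurable_funTS; apply/measurable_EFinP; apply: measurableT_comp => //.
    exact: measurable_funB.
  - by rewrite lee_fin (le_trans _ (m_le 0)).
  rewrite [leRHS]integral_mkcond; apply: ge0_le_integral => //=.
  - do 2 apply: measurableT_comp => //.
    by apply: measurable_funB; exact: measurable_funM.
  - apply/(measurable_restrictT _ _).1; first exact: measurable_ball.
    apply: measurable_funTS; apply/measurable_EFinP; apply: measurable_funM => //.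
    by apply: measurableT_comp => //; exact: measurable_funB.
  - move=> t _; rewrite /patch; case: ifPn => [_|].
      rewrite -EFinM lee_fin -mulrBr normrM ler_wpM2r//.
    rewrite notin_setE/= /ball/= => tr; rewrite -mulrBr normrM.
    rewrite (_ : m t = 0) ?normr0 ?mul0r//.
    apply/eqP/negPn/negP => /supp ts; apply: tr.
    by rewrite ltr_norml; lra.
have Ifin : I \is a fin_num.
  rewrite ge0_fin_numE// ltNge leye_eq; apply/negP => /eqP Iy.
  by move: Ilt; rewrite Iy inver mulrn_eq0/= gt_eqF//= gt0_muley// lte_fin invr_gt0 mulrn_wgt0.
rewrite -(fineK Ifin) -EFinM lee_fin.
have : 0 <= fine I by rewrite fine_ge0.
move: Ilt; rewrite -[in X in X -> _](fineK Ifin) inver mulrn_eq0/= gt_eqF//= -EFinM lte_fin.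
set i := fine I => ilt i0.
have r20 : 0 < r * 2 by rewrite mulr_gt0.
have {}ilt : i * (4 * (C + 1)) < e * (r * 2).
  rewrite -ltr_pdivlMr// mulrAC -ltr_pdivrMr//.
  by rewrite mulr_natr [ltLHS]mulrC.
rewrite invf_div mulrA mulrAC ler_pdivrMr//.
have := step_C_ge0; nra.
Unshelve. all: by end_near.
Qed.

End mollification_at_lebesgue_points.

(** The speed is an arbitrary given function [a], so the equation for [u] is linear; the test
    functions are only products, which is all that the argument uses. *)
Definition tensor_solution {R : realType} (u a : R -> R -> R) (u0 : R -> R) : Prop :=
  forall theta beta : R -> R, smooth1 theta -> smooth1 beta ->
  let phi t x := theta t * beta x in test_function phi ->
  \int[lebesgue_measure]_(t in `[0, +oo[)
    (\int[lebesgue_measure]_x (u t x * (partial_t phi t x + a t x * partial_x phi t x)))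
  + \int[lebesgue_measure]_x (u0 x * phi 0 x) = 0.

(** * Linear transport tested against a function of space *)

Section linear_transport.
Context {R : realType}.
Notation mu := (@lebesgue_measure R).
Variables (H : R -> R) (C : R) (stepH : smooth_step H C).
Variables (u a : R -> R -> R) (u0 : R -> R) (M Ba : R).
Hypothesis measurable_u : measurable_fun setT (fun z : R * R => u z.1 z.2).
Hypothesis measurable_a : measurable_fun setT (fun z : R * R => a z.1 z.2).
Hypothesis u_le : forall t x, `|u t x| <= M.
Hypothesis a_le : forall t x, `|a t x| <= Ba.
Hypothesis weak : tensor_solution u a u0.
Variables (beta : R -> R) (p q : R).
Hypothesis pq : p <= q.
Hypothesis smooth_beta : smooth1 beta.
Hypothesis beta_supp : forall x, beta x != 0 -> p <= x <= q.

Let g t := \int[mu]_x (u t x * beta x).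
Let G t := \int[mu]_x (u t x * (a t x * derive1 beta x)).

Let beta'_supp x : derive1 beta x != 0 -> p <= x <= q.
Proof.
have beta0 y : ~~ (p <= y <= q) -> beta y = 0.
  by move=> hy; apply/eqP; apply: contraNT hy => /beta_supp.
move=> dx; rewrite leNgt [_ <= q]leNgt -negb_or.
apply: contraNN dx => /orP[x0|x1]; apply/eqP; apply: (derive1_near_cst (c := 0)).
  have := lt_nbhsl x0; apply: filterS => y yp.
  by apply: beta0; rewrite negb_and -!ltNge yp.
have := lt_nbhsr x1; apply: filterS => y yp.
by apply: beta0; rewrite negb_and -!ltNge yp orbT.
Qed.

Let measurable_ut t : measurable_fun setT (u t).
Proof. exact: (measurable_fun_pair2 t measurable_u). Qed.

Let measurable_at t : measurable_fun setT (a t).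
Proof. exact: (measurable_fun_pair2 t measurable_a). Qed.

Let smooth_beta' : smooth1 (derive1 beta).
Proof. by have [] := smooth1_is_derive smooth_beta. Qed.

Let slice_bounds : exists Bg BG, forall t, [/\
  mu.-integrable setT (EFin \o (fun x => u t x * beta x)),
  mu.-integrable setT (EFin \o (fun x => u t x * (a t x * derive1 beta x))),
  `|g t| <= Bg & `|G t| <= BG].
Proof.
have [B1 hB1] := continuous_supported_bounded pq (smooth1_continuous smooth_beta) beta_supp.
have [B2 hB2] := continuous_supported_bounded pq (smooth1_continuous smooth_beta') beta'_supp.
exists (M * B1 * (q - p)), (M * (Ba * B2) * (q - p)) => t.
have [|||i1 b1] := @integrable_supported _ (fun x => u t x * beta x) p q (M * B1) pq.
- by apply: measurable_funM => //; exact: measurable_smooth1.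
- by move=> x; rewrite normrM ler_pM.
- by move=> x; rewrite mulf_eq0 negb_or => /andP[_ /beta_supp].
have [|||i2 b2] := @integrable_supported _ (fun x => u t x * (a t x * derive1 beta x))
  p q (M * (Ba * B2)) pq.
- apply: measurable_funM => //; apply: measurable_funM => //.
  exact: measurable_smooth1.
- by move=> x; rewrite !normrM ler_pM ?mulr_ge0// ler_pM.
- by move=> x; rewrite !mulf_eq0 !negb_or => /and3P[_ _ /beta'_supp].
by split.
Qed.

Let measurable_g : measurable_fun setT g.
Proof.
apply: (@measurable_Rintegral_slice _ _ _ (fun z => u z.1 z.2 * beta z.2)).
apply: measurable_funM => //; apply: measurableT_comp => //.
exact: measurable_smooth1.
Qed.

Let measurable_G : measurable_fun setT G.
Proof.
apply: (@measurable_Rintegral_slice _ _ _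
  (fun z => u z.1 z.2 * (a z.1 z.2 * derive1 beta z.2))).
apply: measurable_funM => //; apply: measurable_funM => //.
apply: measurableT_comp => //.
exact: measurable_smooth1.
Qed.

Lemma bounded_locally_integrable (f : R -> R) (B : R) : measurable_fun setT f ->
  (forall x, `|f x| <= B) -> locally_integrable setT f.
Proof.
move=> mf fB; split => //; first exact: openT.
move=> K _ cK.
have mK : measurable K by exact: compact_measurable.
apply: (@le_lt_trans _ _ (\int[mu]_(x in K) B%:E)%E).
  apply: ge0_le_integral => //.
  - apply: measurable_funTS; apply/measurable_EFinP; exact: measurableT_comp.
  - by move=> x _; rewrite lee_fin fB.
rewrite integral_cst//= lte_mul_pinfty ?lee_fin ?(le_trans _ (fB 0))//.
exact: compact_finite_measure.
Qed.

(** The test function is [beta] times a cut-off in time that falls from 1 to 0 on [[s, s + eta]].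
    Its derivative averages [g] just after [s], which is close to [g s] at a Lebesgue point of [g];
    the flux collected on [[s, s + eta]] is at most [BG * eta]. *)
Theorem transport_ae :
  {ae mu, forall s, 0 < s -> g s = \int[mu]_x (u0 x * beta x) + \int[mu]_(t in `[0, s]) G t}.
Proof.
have [Bg [BG slice]] := slice_bounds.
have g_le t : `|g t| <= Bg by have [] := slice t.
apply: ae_impl (lebesgue_differentiation (bounded_locally_integrable measurable_g g_le)).
move=> s gs s0.
apply/eqP; rewrite -subr_eq0 -normr_le0; apply/ler_addgt0Pl => e e0; rewrite addr0.
have e2 : 0 < e / 2 by rewrite divr_gt0.
have BG0 : 0 <= BG by have [_ _ _] := slice 0; exact: le_trans.
have e3 : 0 < e / (2 * (BG + 1)) by rewrite divr_gt0// mulr_gt0// ltr_wpDl.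
have [eta /andP[eta0 eta_lt] mollify_g] := mollify_lebesgue_pt stepH measurable_g g_le gs e2 e3.
pose m t := mollifier H eta (t - s).
(* The step from [-2] to [-1] makes the support compact; on [t >= 0] it equals 1 and does not affect
   the weak formulation. *)
pose theta t := H ((t - (-2)) / 1) - H ((t - s) / eta).
have sm_theta : smooth1 theta.
  by apply: smooth1B; exact: smooth_step_scaled stepH _ _.
have theta_supp t : theta t != 0 -> -2 <= t <= s + eta.
  apply: contra_neqT; rewrite negb_and -!ltNge => /orP[t1|t1].
    rewrite /theta (step_le0 stepH) ?(step_le0 stepH) ?subrr//.
      by rewrite ler_pdivrMr// mul0r; lra.
    by rewrite divr1; lra.
  rewrite /theta (step_ge1 stepH) ?(step_ge1 stepH) ?subrr//.
    by rewrite ler_pdivlMr// mul1r; lra.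
  by rewrite divr1; lra.
have theta_ge0 t : 0 <= t -> theta t = 1 - H ((t - s) / eta).
  by move=> t0; rewrite /theta (step_ge1 stepH)// divr1; lra.
have dtheta_ge0 t : 0 <= t -> derive1 theta t = - m t.
  move=> t0; rewrite derive1B; try exact: smooth_step_scaled stepH _ _.
  rewrite (is_derive_derive1 (derive_step_scaled stepH 1 (-2))).
  rewrite (is_derive_derive1 (derive_step_scaled stepH eta s)).
  rewrite [X in X - _](_ : _ = 0) ?sub0r//.
  apply/eqP/negPn/negP => /(mollifier_supp stepH ltr01); lra.
have := weak sm_theta smooth_beta (test_function_tensor sm_theta smooth_beta theta_supp beta_supp).
have -> : theta 0 = 1.
  rewrite theta_ge0// (step_le0 stepH) ?subr0// sub0r.
  by rewrite mulNr oppr_le0 divr_ge0// ltW.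
have inner t : \int[mu]_x (u t x *
      (partial_t (fun t x => theta t * beta x) t x +
       a t x * partial_x (fun t x => theta t * beta x) t x)) =
    derive1 theta t * g t + theta t * G t.
  have [i1 i2 _ _] := slice t.
  rewrite /g /G -!RintegralZl// -RintegralD//; try exact: integrable_EFinZl.
  apply: eq_Rintegral => x _.
  by rewrite partial_t_tensor// partial_x_tensor//; ring.
under eq_Rintegral do rewrite inner.
under [X in _ + X]eq_Rintegral do rewrite mul1r.
pose A : set R := `[0, +oo[%classic.
(* The part of the flux term after time [s], which lives on [[s, s + eta]]. *)
pose r t := ((fun t => (1 - H ((t - s) / eta)) * G t) \_ A) t - (G \_ `[0, s]) t.
have -> : \int[mu]_(t in `[0, +oo[) (derive1 theta t * g t + theta t * G t) =
    \int[mu]_t ((G \_ `[0, s]) t + r t - m t * g t).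
  rewrite Rintegral_mkcond; apply: eq_Rintegral => t _.
  rewrite /r [_ + (_ - _)]addrC subrK /patch; case: ifPn => [|tA].
    rewrite inE/= in_itv/= andbT => t0.
    by rewrite dtheta_ge0// theta_ge0//; ring.
  rewrite (_ : m t = 0) ?mul0r ?subr0//.
  apply/eqP/negPn/negP => /(mollifier_supp stepH eta0) ts.
  by move: tA; rewrite notin_setE/= in_itv/= andbT; apply; lra.
have rE t : r t = if s < t then (1 - H ((t - s) / eta)) * G t else 0.
  rewrite /r /patch /A !mem_setE !in_itv/= andbT.
  have [st|st] := ltP s t; first by rewrite (ltW (lt_trans s0 st)) andbF subr0.
  rewrite andbT; case: ifPn => _; last by rewrite subrr.
  rewrite (step_le0 stepH) ?subr0 ?mul1r ?subrr//.
  by rewrite ler_pdivrMr// mul0r subr_le0.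
have r_supp t : r t != 0 -> s <= t <= s + eta.
  rewrite rE; case: ifPn => [st|]; last by rewrite eqxx.
  rewrite (ltW st)/= leNgt; apply: contraNN => ts.
  rewrite (step_ge1 stepH) ?subrr ?mul0r//.
  by rewrite ler_pdivlMr// mul1r; lra.
have r_le t : `|r t| <= BG.
  rewrite rE; case: ifPn => [st|]; last by rewrite normr0.
  have [_ _ _ Gt] := slice t.
  rewrite normrM -[leRHS]mul1r ler_pM//.
  have := step_01 stepH ((t - s) / eta); rewrite ler_norml; lra.
have mA : measurable A by exact: measurable_itv.
have mr : measurable_fun setT r.
  apply: measurable_funB; last first.
    by apply/(measurable_restrictT _ _).1 => //; exact: measurable_funTS.
  apply/(measurable_restrictT _ _).1 => //; apply: measurable_funTS.
  apply: measurable_funM => //; apply: measurable_funB => //.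
  by apply: measurable_smooth1; exact: (smooth_step_scaled stepH).
have [|intr r_int] := @integrable_supported _ r s (s + eta) BG _ mr r_le r_supp.
  by lra.
have s_eta : s <= s + eta by lra.
have m_supp t : m t != 0 -> s <= t <= s + eta.
  by move=> /(mollifier_supp stepH eta0); lra.
have mm : measurable_fun setT m.
  by apply: measurableT_comp; [exact: (measurable_mollifier stepH)|exact: measurable_funB].
have intmg : mu.-integrable setT (EFin \o (fun t => m t * g t)).
  apply: (@integrable_supported _ _ s (s + eta) (C / eta * Bg) _ _ _ _).1 => //.
  - exact: measurable_funM.
  - by move=> y; rewrite normrM ler_pM// (mollifier_le stepH).
  - by move=> y; rewrite mulf_eq0 negb_or => /andP[/m_supp].
have intG : mu.-integrable setT (EFin \o (G \_ `[0, s])).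
  apply: (@integrable_supported _ _ 0 s BG _ _ _ _).1 => //; first exact: ltW.
  - by apply/(measurable_restrictT _ _).1 => //; exact: measurable_funTS.
  - move=> t; rewrite /patch; case: ifPn => _; last by rewrite normr0.
    by have [] := slice t.
  - by move=> t; rewrite /patch mem_setE in_itv/=; case: ifPn => //; rewrite eqxx.
rewrite RintegralB//; last exact: integrable_EFinD.
rewrite RintegralD// -Rintegral_mkcond.
have : BG * eta <= e / 2.
  have : eta * (2 * (BG + 1)) < e by rewrite -ltr_pdivlMr ?mulr_gt0// ltr_wpDl.
  nra.
move: mollify_g r_int; rewrite -/m addrAC subrr add0r.
set c := \int[mu]_x _; set I := \int[mu]_(t in `[0, s]) _.
set J := \int[mu]_t r t; set K := \int[mu]_t _.
rewrite !ler_norml => /andP[? ?] /andP[? ?] ? ?.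
by apply/andP; split; lra.
Qed.

End linear_transport.

(** * The potential of a weak solution *)

Section step_function_estimates.
Context {R : realType}.
Notation mu := (@lebesgue_measure R).
Variables (H : R -> R) (C : R) (stepH : smooth_step H C).
Variables (delta : R) (delta_gt0 : 0 < delta).
Implicit Types v : R -> R.

Lemma derive1_bounded_lipschitz (f : R -> R) (B : R) : smooth1 f ->
  (forall x, `|derive1 f x| <= B) -> forall x y, `|f x - f y| <= B * `|x - y|.
Proof.
move=> sf fB x y; wlog xy : x y / y <= x => [hw|].
  have [/hw//|/ltW/hw] := leP y x.
  by rewrite distrC [X in B * X]distrC.
have [df _] := smooth1_is_derive sf.
have [|z _ ->] := MVT_segment xy (fun z _ => df z).
  by apply: continuous_subspaceT; exact: smooth1_continuous.
by rewrite normrM ler_wpM2r.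
Qed.

Let H' : R -> R := derive1 H.

Let smooth_H' : smooth1 H'.
Proof. by have [] := smooth1_is_derive (step_smooth stepH). Qed.

Lemma step_scaled_lip z z' :
  `|H (z / delta) - H (z' / delta)| <= C / delta * `|z - z'|.
Proof.
apply: le_trans (derive1_bounded_lipschitz (step_smooth stepH) (step_derive_le stepH) _ _) _.
by rewrite -mulrBl normrM (gtr0_norm (_ : 0 < delta^-1)) ?invr_gt0// mulrCA mulrC mulrAC.
Qed.

Lemma mollifier_lip z z' :
  `|mollifier H delta z - mollifier H delta z'| <= C / delta ^+ 2 * `|z - z'|.
Proof.
rewrite /mollifier -mulrBr normrM gtr0_norm ?invr_gt0//.
have := derive1_bounded_lipschitz smooth_H' (step_derive2_le stepH) (z / delta) (z' / delta).
rewrite -mulrBl normrM (gtr0_norm (_ : 0 < delta^-1)) ?invr_gt0//.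
rewrite -(ler_pM2l (_ : 0 < delta^-1)) ?invr_gt0// => /le_trans; apply.
by rewrite le_eqVlt; apply/orP; left; apply/eqP; field; exact: lt0r_neq0.
Qed.

(** The mean value point lies within [|r|] of [z], so the Lipschitz bound of the mollifier supplies
    the second factor [|r|]. *)
Lemma step_taylor z r : `|H (z / delta) - H ((z - r) / delta)
    - r * mollifier H delta z| <= C / delta ^+ 2 * r ^+ 2.
Proof.
have [df _] := smooth1_is_derive (smooth_step_scaled stepH delta 0).
have dE t : derive1 (fun t => H ((t - 0) / delta)) t = mollifier H delta t.
  rewrite (is_derive_derive1 (derive_step_scaled stepH delta 0)).
  by rewrite subr0.
have key x y : x <= y -> exists2 c, x <= c <= y &
    H (y / delta) - H (x / delta) = mollifier H delta c * (y - x).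
  move=> xy; have [|c cxy] := MVT_segment xy (fun z _ => df z).
    apply: continuous_subspaceT; apply: smooth1_continuous.
    exact: (smooth_step_scaled stepH).
  rewrite !subr0 dE => ->; exists c => //.
have [c cz ->] : exists2 c, `|c - z| <= `|r| &
    H (z / delta) - H ((z - r) / delta) = mollifier H delta c * r.
  have [r0|r0] := leP 0 r.
    have [|c cz E] := key (z - r) z; first lra.
    exists c; first by rewrite (ger0_norm r0) ler_norml; lra.
    by rewrite E; congr (_ * _); ring.
  have [|c cz E] := key z (z - r); first lra.
  exists c; first by rewrite (ltr0_norm r0) ler_norml; lra.
  by rewrite -opprB E; ring.
rewrite [r * _]mulrC -mulrBl normrM -[r ^+ 2]real_normK ?num_real// expr2 mulrA.
rewrite ler_wpM2r//; apply: le_trans (mollifier_lip _ _) _.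
rewrite ler_wpM2l// divr_ge0 ?(step_C_ge0 stepH)// exprn_ge0// ltW//.
Qed.

Variables (v : R -> R) (M : R).
Hypothesis measurable_v : measurable_fun setT v.
Hypothesis v_le : forall y, `|v y| <= M.

Lemma Rintegral_bounded_supported (f : R -> R) (p q B : R) : p <= q ->
  measurable_fun setT f -> (forall y, `|f y| <= B) ->
  (forall y, f y != 0 -> p <= y <= q) ->
  mu.-integrable setT (EFin \o (fun y => v y * f y)) /\
  `|\int[mu]_y (v y * f y)| <= M * B * (q - p).
Proof.
move=> pq mf fB fs; apply: integrable_supported => //.
- exact: measurable_funM.
- by move=> y; rewrite normrM ler_pM.
- by move=> y; rewrite mulf_eq0 negb_or => /andP[_ /fs].
Qed.

Let M_ge0 : 0 <= M. Proof. exact: le_trans (v_le 0). Qed.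

Let C_ge0 : 0 <= C. Proof. exact: step_C_ge0 stepH. Qed.

Let measurable_mollifier_shift (x : R) : measurable_fun setT (fun y : R => mollifier H delta (y - x)).
Proof.
apply: measurableT_comp; first exact: measurable_mollifier stepH _.
exact: measurable_funB.
Qed.

Let measurable_step_shift (x : R) : measurable_fun setT (fun y : R => H ((y - x) / delta)).
Proof. by apply: measurable_smooth1; exact: smooth_step_scaled stepH _ _. Qed.

Lemma integrable_mollifier x : mu.-integrable setT
    (EFin \o (fun y => v y * mollifier H delta (y - x))) /\
  `|\int[mu]_y (v y * mollifier H delta (y - x))| <= M * C.
Proof.
have [|y|y|i b] := @Rintegral_bounded_supported _ x (x + delta) (C / delta) _
  (measurable_mollifier_shift x).
- by rewrite lerDl ltW.
- exact: mollifier_le stepH _ _ _.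
- by move=> /(mollifier_supp stepH delta_gt0); lra.
split => //; apply: le_trans b _; rewrite [x + _]addrC addrK -mulrA divfK//.
exact: lt0r_neq0.
Qed.

(** For [|x - x'| <= delta] both kernels live in [[x - delta, x + 2 * delta]], of length
    [3 * delta]; this is the origin of the 3, here and in the similar estimates below. *)
Lemma Rintegral_mollifier_lip x x' : `|x - x'| <= delta ->
  `|\int[mu]_y (v y * mollifier H delta (y - x))
    - \int[mu]_y (v y * mollifier H delta (y - x'))|
  <= 3 * M * C * `|x - x'| / delta.
Proof.
move=> xx'; rewrite -RintegralB//; try exact: (integrable_mollifier _).1.
under eq_Rintegral do rewrite -mulrBr.
have [||y|y|_ b] := @Rintegral_bounded_supported
  (fun y => mollifier H delta (y - x) - mollifier H delta (y - x'))
  (x - delta) (x + 2 * delta) (C / delta ^+ 2 * `|x - x'|).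
- by have := delta_gt0; lra.
- exact: measurable_funB.
- apply: le_trans (mollifier_lip _ _) _.
  by rewrite (_ : y - x - (y - x') = - (x - x')) ?normrN//; ring.
- move: xx'; rewrite ler_norml => hx.
  have [y0|y0] := eqVneq (mollifier H delta (y - x)) 0.
    rewrite y0 sub0r oppr_eq0 => /(mollifier_supp stepH delta_gt0) hy.
    by lra.
  by move=> _; move: y0 => /(mollifier_supp stepH delta_gt0) hy; lra.
apply: le_trans b _; rewrite le_eqVlt; apply/orP; left; apply/eqP.
by field; exact: lt0r_neq0.
Qed.

Lemma step_scaled_01 z : 0 <= H (z / delta) <= 1.
Proof. exact: step_01 stepH _. Qed.

Lemma step_scaled_le0 z : z <= 0 -> H (z / delta) = 0.
Proof. by move=> z0; rewrite (step_le0 stepH)// ler_pdivrMr// mul0r. Qed.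

Lemma step_scaled_ge1 z : delta <= z -> H (z / delta) = 1.
Proof. by move=> z1; rewrite (step_ge1 stepH)// ler_pdivlMr// mul1r. Qed.

Lemma step_diff_supp x x' y : H ((y - x) / delta) - H ((y - x') / delta) != 0 ->
  x - `|x - x'| <= y <= x + `|x - x'| + delta.
Proof.
have h1 := ler_norm (x - x'); have h2 := ler_norm (x' - x).
rewrite distrC in h2; apply: contra_neqT; rewrite negb_and -!ltNge => /orP[hy|hy].
  rewrite !step_scaled_le0 ?subrr//; lra.
rewrite !step_scaled_ge1 ?subrr//; lra.
Qed.

Lemma Rintegral_step_diff x x' :
  mu.-integrable setT (EFin \o
    (fun y => v y * (H ((y - x) / delta) - H ((y - x') / delta)))) /\
  `|\int[mu]_y (v y * (H ((y - x) / delta) - H ((y - x') / delta)))|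
  <= M * (C / delta * `|x - x'|) * (2 * `|x - x'| + delta).
Proof.
have n0 := normr_ge0 (x - x').
have [||y||i b] := @Rintegral_bounded_supported
  (fun y => H ((y - x) / delta) - H ((y - x') / delta))
  (x - `|x - x'|) (x + `|x - x'| + delta) (C / delta * `|x - x'|).
- by have := delta_gt0; lra.
- exact: measurable_funB.
- apply: le_trans (step_scaled_lip _ _) _.
  by rewrite (_ : y - x - (y - x') = - (x - x')) ?normrN//; ring.
- exact: step_diff_supp.
split => //; apply: le_trans b _; rewrite le_eqVlt; apply/orP; left; apply/eqP.
by congr (_ * _); ring.
Qed.

Lemma Rintegral_step_lip x x' : `|x - x'| <= delta ->
  `|\int[mu]_y (v y * (H ((y - x) / delta) - H ((y - x') / delta)))|
  <= 3 * M * C * `|x - x'|.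
Proof.
set d : R := `|x - x'| => dd; have d0 : 0 <= d by exact: normr_ge0.
apply: le_trans (Rintegral_step_diff x x').2 _; rewrite -/d.
have k0 : 0 <= M * C * d by rewrite !mulr_ge0.
rewrite (_ : _ * _ * _ = M * C * d * (2 * d + delta) / delta); last first.
  by field; exact: lt0r_neq0.
rewrite ler_pdivrMr// (_ : 3 * M * C * d * delta = M * C * d * (3 * delta)); last by ring.
by rewrite ler_wpM2l//; lra.
Qed.

Lemma Rintegral_step_taylor x r : `|r| <= delta ->
  `|\int[mu]_y (v y * (H ((y - x) / delta) - H ((y - (x + r)) / delta)))
    - r * \int[mu]_y (v y * mollifier H delta (y - x))|
  <= 3 * M * C * r ^+ 2 / delta.
Proof.
move=> rd; have [im _] := integrable_mollifier x.
have [is_ _] := Rintegral_step_diff x (x + r).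
rewrite -RintegralZl// -RintegralB//; last exact: integrable_EFinZl.
under eq_Rintegral do rewrite mulrCA -mulrBr opprD addrA.
have [||y|y|_ b] := @Rintegral_bounded_supported
  (fun y => H ((y - x) / delta) - H ((y - x - r) / delta) - r * mollifier H delta (y - x))
  (x - delta) (x + 2 * delta) (C / delta ^+ 2 * r ^+ 2).
- by have := delta_gt0; lra.
- apply: measurable_funB; last exact: measurable_funM.
  apply: measurable_funB => //; have := measurable_step_shift (x + r).
  by congr measurable_fun; apply/funext => y; rewrite opprD addrA.
- exact: step_taylor.
- move=> ne; have [y0|y0] := eqVneq (mollifier H delta (y - x)) 0; last first.
    by move: y0 => /(mollifier_supp stepH delta_gt0) hy; have := delta_gt0; lra.
  move: ne; rewrite y0 mulr0 subr0 -addrA -opprD => /step_diff_supp.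
  by rewrite opprD addrA subrr sub0r normrN; lra.
apply: le_trans b _; rewrite le_eqVlt; apply/orP; left; apply/eqP.
by field; exact: lt0r_neq0.
Qed.

Definition heaviside (x y : R) : R := (x < y)%R%:R.

Lemma measurable_heaviside x : measurable_fun setT (heaviside x).
Proof.
rewrite (_ : heaviside x = \1_(`]x, +oo[%classic)).
  by apply: measurable_indic; exact: measurable_itv.
by apply/funext => y; rewrite indicE mem_setE in_itv/= andbT.
Qed.

(* Replacing the jumps of [heaviside x0 - heaviside (x0 + s)] by smooth steps
   of width [delta] starting [delta]-close to them. *)
Lemma Rintegral_step_heaviside x x0 s : `|x0 - x| <= delta ->
  mu.-integrable setT (EFin \o (fun y => v y * (heaviside x0 y - heaviside (x0 + s) y))) /\
  `|\int[mu]_y (v y * (H ((y - x) / delta) - H ((y - (x + s)) / delta)))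
    - \int[mu]_y (v y * (heaviside x0 y - heaviside (x0 + s) y))|
  <= 4 * M * delta.
Proof.
rewrite ler_norml => x0x.
have s1 := ler_norm s; have s2 := ler_norm (- s); rewrite normrN in s2.
have [||y|y|ih _] := @Rintegral_bounded_supported
  (fun y => heaviside x0 y - heaviside (x0 + s) y) (x0 - `|s|) (x0 + `|s|) 1.
- lra.
- by apply: measurable_funB; exact: measurable_heaviside.
- by rewrite /heaviside; case: ltP => _; case: ltP => _; rewrite ?subrr ?subr0 ?sub0r ?normrN ?normr0 ?normr1.
- rewrite /heaviside; case: (ltP x0 y) => h1; case: (ltP (x0 + s) y) => h2;
    rewrite ?subrr ?eqxx//; lra.
split => //.
have [is_ _] := Rintegral_step_diff x (x + s).
rewrite -RintegralB//; under eq_Rintegral do rewrite -mulrBr.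
(* A smooth step and the nearby jump differ by at most 1, and only within [delta] of [x1]: the cost
   is [2 * M * delta]. Two such replacements give the 4, whatever the distance between the two
   jumps. *)
have jump x1 z1 : `|z1 - x1| <= delta ->
   mu.-integrable setT (EFin \o (fun y => v y * (H ((y - x1) / delta) - heaviside z1 y))) /\
   `|\int[mu]_y (v y * (H ((y - x1) / delta) - heaviside z1 y))| <= 2 * M * delta.
  rewrite ler_norml => zx.
  have [||y|y|ii b] := @Rintegral_bounded_supported
    (fun y => H ((y - x1) / delta) - heaviside z1 y) (x1 - delta) (x1 + delta) 1.
  - by have := delta_gt0; lra.
  - by apply: measurable_funB => //; exact: measurable_heaviside.
  - have := step_scaled_01 (y - x1); rewrite /heaviside ler_norml.
    by case: ltP => _ /=; lra.
  - apply: contra_neqT; rewrite negb_and -!ltNge /heaviside => /orP[h|h].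
      have yz : y <= z1 by lra.
      by rewrite step_scaled_le0 ?ltNge ?yz ?subrr//; lra.
    have zy : z1 < y by have := delta_gt0; lra.
    by rewrite step_scaled_ge1 ?zy ?subrr//; lra.
  by split => //; apply: le_trans b _; lra.
have [|i1 b1] := jump x x0; first by rewrite ler_norml.
have [|i2 b2] := jump (x + s) (x0 + s).
  by rewrite opprD addrACA subrr addr0 ler_norml.
rewrite (_ : \int[mu]_x1 _ = \int[mu]_y (v y * (H ((y - x) / delta) - heaviside x0 y)
   - v y * (H ((y - (x + s)) / delta) - heaviside (x0 + s) y))); last first.
  by apply: eq_Rintegral => y _; ring.
rewrite RintegralB//; apply: le_trans (ler_normB _ _) _; lra.
Qed.

End step_function_estimates.

Section interval_integrals.
Context {R : realType}.
Notation mu := (@lebesgue_measure R).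
Variables (f : R -> R) (B : R).
Hypothesis measurable_f : measurable_fun setT f.
Hypothesis f_le : forall t, `|f t| <= B.

Lemma integrable_itv_bounded (s t : R) : mu.-integrable `[s, t] (EFin \o f).
Proof.
apply: measurable_bounded_integrable => //.
- rewrite /= lebesgue_measure_itv/=; case: ifPn => // _.
  by rewrite -EFinB ltry.
- exact: measurable_funTS.
- exists B; split; first exact: num_real.
  by move=> x Bx y _; apply: (le_trans (f_le y)); exact: ltW.
Qed.

Lemma Rintegral_itv_cat (t h : R) : 0 <= t -> 0 <= h ->
  \int[mu]_(s in `[0, t + h]) f s =
  \int[mu]_(s in `[0, t]) f s + \int[mu]_(s in `[t, t + h]) f s.
Proof.
move=> t0 h0; have i1 := integrable_itv_bounded 0 (t + h).
rewrite -(@Rintegral_itv_obnd_cbnd _ t) -?(Rintegral_itvB i1) ?bnd_simp ?lerDl//.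
  by rewrite [RHS]addrC subrK.
by apply: integrableS (integrable_itv_bounded t (t + h)) => //; exact: subset_itv_oc_cc.
Qed.

Lemma Rintegral_itv_ae_le (t h e : R) : 0 <= e -> 0 <= h ->
  {ae mu, forall s, t <= s <= t + h -> `|f s| <= e} ->
  `|\int[mu]_(s in `[t, t + h]) f s| <= e * h.
Proof.
move=> e0 h0 fe.
have i1 := integrable_itv_bounded t (t + h).
rewrite -lee_fin EFin_normr_Rintegral//.
apply: (le_trans (le_abse_integral _ _ (measurable_int _ i1))) => //.
have le_e : (\int[mu]_(s in `[t, (t + h)%R]) `|(EFin \o f) s|
    <= \int[mu]_(s in `[t, (t + h)%R]) e%:E)%E.
  apply: ae_ge0_le_integral => //.
  by apply: measurable_funTS; do 2 apply: measurableT_comp => //.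
apply: (le_trans le_e); rewrite integral_cst//= lebesgue_measure_itv/= lte_fin.
case: ifPn => _; last by rewrite mule0 lee_fin mulr_ge0.
by rewrite -EFinD -EFinM lee_fin addrAC subrr add0r.
Qed.

Lemma Rintegral_itv_le (t h : R) : 0 <= h ->
  `|\int[mu]_(s in `[t, t + h]) f s| <= B * h.
Proof.
move=> h0; apply: Rintegral_itv_ae_le => //; first exact: le_trans (f_le 0).
by apply: aeW => s _; exact: f_le.
Qed.

End interval_integrals.

Lemma subrACA (V : zmodType) (a b c d : V) : (a - b) - (c - d) = (a - c) - (b - d).
Proof. by rewrite !opprD !opprK addrACA. Qed.

(** * Evolution of the mollified potential *)

Section regularized_potential.
Context {R : realType}.
Notation mu := (@lebesgue_measure R).
Variables (H : R -> R) (C : R) (stepH : smooth_step H C).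
Variables (delta : R) (delta_gt0 : 0 < delta).
Variables (u a : R -> R -> R) (u0 : R -> R) (M Ba : R).
Hypothesis measurable_u : measurable_fun setT (fun z : R * R => u z.1 z.2).
Hypothesis measurable_a : measurable_fun setT (fun z : R * R => a z.1 z.2).
Hypothesis measurable_u0 : measurable_fun setT u0.
Hypothesis u_le : forall t x, `|u t x| <= M.
Hypothesis a_le : forall t x, `|a t x| <= Ba.
Hypothesis u0_le : forall x, `|u0 x| <= M.
Hypothesis weak : tensor_solution u a u0.

Definition mollified_flux s x := \int[mu]_y (u s y * a s y * mollifier H delta (y - x)).

Definition step_diff x x' y := H ((y - x) / delta) - H ((y - x') / delta).

(* Formally the integral of the mollified [u t] from 0 to [x], up to a function of time; the
   definition by the flux is continuous in time whatever the representative of [u]. *)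
Definition potential t x :=
  \int[mu]_y (u0 y * step_diff 0 x y) - \int[mu]_(s in `[0, t]) mollified_flux s x.

Let M_ge0 : 0 <= M. Proof. exact: le_trans (u0_le 0). Qed.

Let Ba_ge0 : 0 <= Ba. Proof. exact: le_trans (a_le 0 0). Qed.

Let C_ge0 : 0 <= C. Proof. exact: step_C_ge0 stepH. Qed.

Let measurable_us s : measurable_fun setT (u s).
Proof. exact: (measurable_fun_pair2 s measurable_u). Qed.

Let measurable_ua s : measurable_fun setT (fun y => u s y * a s y).
Proof. by apply: measurable_funM => //; exact: (measurable_fun_pair2 s measurable_a). Qed.

Let ua_le s y : `|u s y * a s y| <= M * Ba.
Proof. by rewrite normrM ler_pM. Qed.

Let measurable_flux x : measurable_fun setT (mollified_flux ^~ x).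
Proof.
apply: (@measurable_Rintegral_slice _ _ _
  (fun z => u z.1 z.2 * a z.1 z.2 * mollifier H delta (z.2 - x))).
apply: measurable_funM; first exact: measurable_funM.
apply: measurableT_comp; first exact: measurable_mollifier stepH _.
exact: measurable_funB.
Qed.

Let flux_le s x : `|mollified_flux s x| <= M * Ba * C.
Proof. exact: (integrable_mollifier stepH delta_gt0 (measurable_ua s) (ua_le s) x).2. Qed.

Lemma flux_lip s x x' : `|x - x'| <= delta ->
  `|mollified_flux s x - mollified_flux s x'| <= 3 * (M * Ba) * C * `|x - x'| / delta.
Proof. exact: Rintegral_mollifier_lip. Qed.

Lemma potentialD t h x : 0 <= t -> 0 <= h ->
  potential (t + h) x = potential t x - \int[mu]_(s in `[t, t + h]) mollified_flux s x.
Proof.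
move=> t0 h0; rewrite /potential (Rintegral_itv_cat (measurable_flux x) (flux_le^~ x))//.
by rewrite opprD addrA.
Qed.

Lemma potential_time_lip t h x : 0 <= t -> 0 <= h ->
  `|potential (t + h) x - potential t x| <= M * Ba * C * h.
Proof.
move=> t0 h0; rewrite potentialD// addrAC subrr add0r normrN.
exact: (Rintegral_itv_le (measurable_flux x) (flux_le^~ x) t h0).
Qed.

(** [transport_ae] with [beta = step_diff 0 x]: the derivative of this [beta] is a difference of two
    mollifiers, so the flux term is that of [potential s x - potential s 0]. *)
Let potential_ae_at x :
  {ae mu, forall s, 0 < s -> potential s x - potential s 0 = \int[mu]_y (u s y * step_diff 0 x y)}.
Proof.
have sm : smooth1 (step_diff 0 x).
  by apply: smooth1B; exact: smooth_step_scaled stepH _ _.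
have supp y : step_diff 0 x y != 0 -> - `|x| <= y <= `|x| + delta.
  by move/(step_diff_supp stepH delta_gt0); rewrite !sub0r add0r normrN.
have x0 : - `|x| <= `|x| + delta by have := normr_ge0 x; have := delta_gt0; lra.
apply: ae_impl (transport_ae stepH measurable_u measurable_a u_le a_le weak x0 sm supp).
move=> s hs s0; rewrite hs// /potential.
have dsd : derive1 (step_diff 0 x) =
    (fun y => mollifier H delta (y - 0) - mollifier H delta (y - x)).
  by apply: is_derive_derive1 => y; apply: is_deriveB; exact: (derive_step_scaled stepH).
under [X in _ = _ + X]eq_Rintegral => t _.
  rewrite dsd; under eq_Rintegral do rewrite mulrA mulrBr.
  rewrite RintegralB//; try exact: (integrable_mollifier stepH delta_gt0
    (measurable_ua t) (ua_le t) _).1.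
  over.
rewrite RintegralB//; try exact: (integrable_itv_bounded (measurable_flux _) (flux_le^~ _)).
have -> : \int[mu]_y (u0 y * step_diff 0 0 y) = 0.
  under eq_Rintegral do rewrite /step_diff subrr mulr0.
  by rewrite Rintegral_cst// mul0r.
by rewrite sub0r opprK -addrA; congr (_ + _); rewrite addrC.
Qed.

Let potential_lip s x x' : 0 <= s -> `|x - x'| <= delta ->
  `|potential s x - potential s x'| <=
  (3 * M * C + 3 * (M * Ba) * C / delta * s) * `|x - x'|.
Proof.
move=> s0 xx'.
have i z : mu.-integrable setT (EFin \o (fun y => u0 y * step_diff 0 z y)).
  exact: (Rintegral_step_diff stepH delta_gt0 measurable_u0 u0_le _ _).1.
have j z : mu.-integrable `[0, s] (EFin \o mollified_flux ^~ z).
  exact: (integrable_itv_bounded (measurable_flux _) (flux_le^~ _)).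
have -> : potential s x - potential s x' =
    \int[mu]_y (u0 y * step_diff x' x y)
    - \int[mu]_(t in `[0, s]) (mollified_flux t x - mollified_flux t x').
  rewrite RintegralB//.
  have -> : \int[mu]_y (u0 y * step_diff x' x y) =
      \int[mu]_y (u0 y * step_diff 0 x y) - \int[mu]_y (u0 y * step_diff 0 x' y).
    rewrite -RintegralB//; apply: eq_Rintegral => y _.
    by rewrite /step_diff; ring.
  exact: subrACA.
apply: le_trans (ler_normB _ _) _; rewrite mulrDl; apply: lerD.
  have := @Rintegral_step_lip _ _ _ stepH _ delta_gt0 _ _ measurable_u0 u0_le x' x.
  by rewrite (distrC x' x) => /(_ xx').
have mB : measurable_fun setT (fun t => mollified_flux t x - mollified_flux t x').
  exact: measurable_funB.
have e0 : 0 <= 3 * (M * Ba) * C * `|x - x'| / delta.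
  by rewrite !mulr_ge0// invr_ge0 ltW.
have leB t : `|mollified_flux t x - mollified_flux t x'| <=
    3 * (M * Ba) * C * `|x - x'| / delta by exact: flux_lip.
have := Rintegral_itv_le mB leB 0 s0; rewrite add0r => /le_trans; apply.
by rewrite le_eqVlt; apply/orP; left; apply/eqP; ring.
Qed.

Local Opaque potential.

(** The exceptional set of [potential_ae_at] depends on [x]. Countably many [x] share one null set,
    and at a fixed time both sides are locally Lipschitz in [x], so rational [x] suffice. *)
Lemma potential_ae : {ae mu, forall s, 0 < s ->
  forall x, potential s x - potential s 0 = \int[mu]_y (u s y * step_diff 0 x y)}.
Proof.
(* Rationals are enumerated by [unpickle]; an integer that codes none carries no condition. *)
have rat_ae : {ae mu, forall s, forall n : nat, 0 < s ->
    if unpickle n is Some q then potential s (ratr (q : rat)) - potential s 0 =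
      \int[mu]_y (u s y * step_diff 0 (ratr q) y) else True}.
  apply: ae_foralln => n; case: (unpickle n) => [q|]; first exact: potential_ae_at.
  exact: aeW.
apply: ae_impl rat_ae => s hs s0 x.
have {}hs (q : rat) : potential s (ratr q) - potential s 0 =
    \int[mu]_y (u s y * step_diff 0 (ratr q) y).
  by have := hs (pickle q) s0; rewrite pickleK.
pose K := (3 * M * C + 3 * (M * Ba) * C / delta * s) + 3 * M * C.
have K0 : 0 <= K.
  by rewrite /K !addr_ge0// !mulr_ge0// ?invr_ge0 ltW.
apply/eqP; rewrite -subr_eq0 -normr_le0; apply/ler_addgt0Pl => e e0; rewrite addr0.
pose r := Num.min delta (e / (K + 1)).
have r0 : 0 < r by rewrite lt_min delta_gt0 divr_gt0// ltr_wpDl.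
have [|q] := @rat_in_itvoo R (x - r) (x + r); first by lra.
rewrite in_itv/= => /andP[q1 q2].
have xq : `|x - ratr q| <= r by rewrite ler_norml; lra.
have xqd : `|x - ratr q| <= delta by rewrite (le_trans xq)// ge_min lexx.
have xqe : `|x - ratr q| * (K + 1) <= e.
  by rewrite -ler_pdivlMr ?ltr_wpDl// (le_trans xq)// ge_min lexx orbT.
have step_sub y : step_diff 0 x y - step_diff 0 (ratr q) y = step_diff (ratr q) x y.
  by rewrite /step_diff; ring.
have diff : \int[mu]_y (u s y * step_diff 0 x y) - \int[mu]_y (u s y * step_diff 0 (ratr q) y)
    = \int[mu]_y (u s y * step_diff (ratr q) x y).
  rewrite -RintegralB//; try exact: (Rintegral_step_diff stepH delta_gt0 (measurable_us s) (u_le s) _ _).1.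
  by under eq_Rintegral do rewrite -mulrBr step_sub.
have bd : `|\int[mu]_y (u s y * step_diff (ratr q) x y)| <= 3 * M * C * `|x - ratr q|.
  have := @Rintegral_step_lip _ _ _ stepH _ delta_gt0 _ _ (measurable_us s) (u_le s) (ratr q) x.
  by rewrite (distrC (ratr q) x) => /(_ xqd).
have pl := potential_lip (ltW s0) xqd.
rewrite (_ : _ - _ - _ = (potential s x - potential s (ratr q))
  - \int[mu]_y (u s y * step_diff (ratr q) x y)); last first.
  rewrite -diff -hs; move: (\int[mu]_y _) (potential s x) (potential s (ratr q)) (potential s 0).
  by move=> *; ring.
apply: le_trans (ler_normB _ _) _.
have := normr_ge0 (x - ratr q); rewrite -/K in xqe *.
by move: xqe pl bd; rewrite /K; lra.
Qed.

Definition mollified_u s x := \int[mu]_y (u s y * mollifier H delta (y - x)).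

(** At such a time the increments of [potential] are the space integrals of [mollified_u]. Almost
    every positive time qualifies, but an intermediate grid time of the scheme may fail to. *)
Definition slice_identity s :=
  forall x, potential s x - potential s 0 = \int[mu]_y (u s y * step_diff 0 x y).

Lemma slice_identityB s x x' : slice_identity s ->
  potential s x' - potential s x = \int[mu]_y (u s y * step_diff x x' y).
Proof.
move=> hs.
have e : (potential s x' - potential s 0) - (potential s x - potential s 0) =
    \int[mu]_y (u s y * step_diff x x' y).
  apply: (etrans (f_equal2 (fun b c => b - c) (hs x') (hs x))).
  rewrite -RintegralB//; try exact: (Rintegral_step_diff stepH delta_gt0 (measurable_us s) (u_le s) _ _).1.
  apply: eq_Rintegral => y _; rewrite /step_diff.
  by move: (H _) (H _) (H _) (u s y) => *; ring.
rewrite -e; move: (potential s x) (potential s x') (potential s 0) => *; ring.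
Qed.

(** The time [t] may be exceptional, and a good time [s] of the same step serves as a relay:
    Taylor's formula is used at [s], and the way from [t] to [s] costs at most [h] times the space
    increment of the flux. *)
Lemma potential_increment t h s x r : slice_identity s -> 0 <= t ->
  t <= s <= t + h -> `|r| <= delta ->
  `|potential t (x + r) - potential t x - r * mollified_u s x| <=
  3 * M * C * r ^+ 2 / delta + 3 * (M * Ba) * C * `|r| / delta * h.
Proof.
move=> hs t0 /andP[ts sth] rd.
have st0 : 0 <= s - t by rewrite subr_ge0.
have pot z : potential t z = potential s z + \int[mu]_(s in `[t, s]) mollified_flux s z.
  by have := potentialD z t0 st0; rewrite subrKC => ->; rewrite subrK.
have i z : mu.-integrable `[t, s] (EFin \o mollified_flux ^~ z).
  exact: (integrable_itv_bounded (measurable_flux _) (flux_le^~ _)).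
have -> : potential t (x + r) - potential t x - r * mollified_u s x =
   (\int[mu]_y (u s y * step_diff x (x + r) y) - r * mollified_u s x)
   + \int[mu]_(s in `[t, s]) (mollified_flux s (x + r) - mollified_flux s x).
  rewrite RintegralB//.
  have alg (p p' q q' i1 i2 v m : R) : p' = q' + i1 -> p = q + i2 -> q' - q = v ->
    p' - p - m = (v - m) + (i1 - i2) by move=> -> -> <-; ring.
  exact: (alg _ _ _ _ _ _ _ _ (pot (x + r)) (pot x) (slice_identityB x (x + r) hs)).
apply: le_trans (ler_normD _ _) _; apply: lerD.
  exact: Rintegral_step_taylor.
have e0 : 0 <= 3 * (M * Ba) * C * `|r| / delta.
  by rewrite !mulr_ge0// invr_ge0 ltW.
have mB : measurable_fun setT (fun s => mollified_flux s (x + r) - mollified_flux s x).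
  exact: measurable_funB.
have leB s' : `|mollified_flux s' (x + r) - mollified_flux s' x| <=
    3 * (M * Ba) * C * `|r| / delta.
  by have := @flux_lip s' (x + r) x; rewrite addrAC subrr add0r; exact.
have := Rintegral_itv_le mB leB t st0; rewrite subrKC => /le_trans; apply.
by rewrite ler_wpM2l//; lra.
Qed.

(* One step of the upwind scheme with frozen coefficient [A]: the time integral
   of the flux is compared with the space increments of the potential. *)
Lemma potential_one_step t h x r1 r2 theta A rho : 0 <= t -> 0 < h ->
  `|r1| <= delta -> `|r2| <= delta -> 0 <= theta <= 1 -> 0 <= rho -> h * A = r1 - theta * r2 ->
  {ae mu, forall s, t <= s <= t + h ->
    slice_identity s /\ forall y, x <= y <= x + delta -> `|a s y - A| <= rho} ->
  `|potential (t + h) (x + r1) - (potential t x - theta * (potential t x - potential t (x + r2)))|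
  <= h * (M * rho * C + 3 * (M * Ba) * C * `|r1| / delta)
     + (3 * M * C * r1 ^+ 2 / delta + 3 * (M * Ba) * C * `|r1| / delta * h)
     + (3 * M * C * r2 ^+ 2 / delta + 3 * (M * Ba) * C * `|r2| / delta * h).
Proof.
move=> t0 h0 r1d r2d /andP[th0 th1] rho0 hA ae_s.
have supp y : mollifier H delta (y - x) != 0 -> x <= y <= x + delta.
  by move/(mollifier_supp stepH delta_gt0); lra.
set E1 := 3 * M * C * r1 ^+ 2 / delta + _; set E2 := 3 * M * C * r2 ^+ 2 / delta + _.
have [delta_ge0 h_ge0] := (ltW delta_gt0, ltW h0).
have E_ge0 r : 0 <= 3 * M * C * r ^+ 2 / delta + 3 * (M * Ba) * C * `|r| / delta * h.
  apply: addr_ge0; last by rewrite !mulr_ge0 ?invr_ge0.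
  by rewrite divr_ge0// mulr_ge0 ?sqr_ge0// !mulr_ge0.
have [E1_ge0 E2_ge0] : 0 <= E1 /\ 0 <= E2 by split; exact: E_ge0.
(* [K] is the increment that the flux has to match. Spread over the step as [K / h], it is compared
   with the flux under the time integral, so that an estimate at almost every time is enough. *)
pose K := potential t (x + r1) - potential t x + theta * (potential t x - potential t (x + r2)).
have mK : measurable_fun setT (fun s => K / h - mollified_flux s (x + r1)).
  exact: measurable_funB.
have KB s : `|K / h - mollified_flux s (x + r1)| <= `|K / h| + M * Ba * C.
  by apply: (le_trans (ler_normB _ _)); rewrite lerD2l flux_le.
have KE : potential (t + h) (x + r1) - (potential t x - theta * (potential t x - potential t (x + r2)))
   = \int[mu]_(s in `[t, t + h]) (K / h - mollified_flux s (x + r1)).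
  rewrite RintegralB//; last 2 first.
  - exact: (@integrable_itv_bounded _ (fun=> K / h) `|K / h| (measurable_cst _) (fun=> lexx _)).
  - exact: (integrable_itv_bounded (measurable_flux _) (flux_le^~ _)).
  rewrite Rintegral_cst//= lebesgue_measure_itv/= lte_fin ltrDl h0.
  have -> : fine ((t + h)%R%:E - t%:E) = h by rewrite -EFinB/= addrAC subrr add0r.
  rewrite (divfK (lt0r_neq0 h0)) (potentialD _ t0 (ltW h0)) /K.
  move: (\int[mu]_(s in _) _) (potential t (x + r1)) (potential t x) (potential t (x + r2)).
  by move=> *; ring.
rewrite {}KE.
set e1 := M * rho * C; set e2 := 3 * (M * Ba) * C * `|r1| / delta.
have e_ge0 : 0 <= e1 + e2 + (E1 + E2) / h.
  have e1_ge0 : 0 <= e1 by rewrite !mulr_ge0.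
  have e2_ge0 : 0 <= e2 by rewrite !mulr_ge0 ?invr_ge0.
  exact: (addr_ge0 (addr_ge0 e1_ge0 e2_ge0) (divr_ge0 (addr_ge0 E1_ge0 E2_ge0) h_ge0)).
apply: (@le_trans _ _ ((e1 + e2 + (E1 + E2) / h) * h)); last first.
  by rewrite mulrDl (divfK (lt0r_neq0 h0)) (mulrC _ h) addrA lexx.
apply: (Rintegral_itv_ae_le mK KB e_ge0 (ltW h0)).
apply: ae_impl ae_s => s hs tsh; have [ids a_near] := hs tsh.
have i1 := potential_increment x ids t0 tsh r1d.
have i2 := potential_increment x ids t0 tsh r2d.
have fl : `|mollified_flux s x - mollified_flux s (x + r1)| <= e2.
  have := @flux_lip s x (x + r1); rewrite opprD addNKr normrN; exact.
have fz : `|A * mollified_u s x - mollified_flux s x| <= e1.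
  have fzE : A * mollified_u s x - mollified_flux s x =
      \int[mu]_y (u s y * (A - a s y) * mollifier H delta (y - x)).
    rewrite -RintegralZl//; last exact: (integrable_mollifier stepH delta_gt0
      (measurable_us s) (u_le s) _).1.
    rewrite -RintegralB//; last 2 first.
    - apply: integrable_EFinZl => //.
      exact: (integrable_mollifier stepH delta_gt0 (measurable_us s) (u_le s) _).1.
    - exact: (integrable_mollifier stepH delta_gt0 (measurable_ua s) (ua_le s) _).1.
    by apply: eq_Rintegral => y _; ring.
  rewrite fzE.
  have [|||y mo|_] := @integrable_supported R
    (fun y => u s y * (A - a s y) * mollifier H delta (y - x))
    x (x + delta) (M * rho * (C / delta)).
  - by rewrite lerDl.
  - apply: measurable_funM; last first.
      apply: (measurableT_comp (measurable_mollifier stepH delta)).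
      exact: measurable_funB.
    apply: measurable_funM => //; apply: measurable_funB => //.
    exact: (measurable_fun_pair2 s measurable_a).
  - move=> y; have [->|mo] := eqVneq (mollifier H delta (y - x)) 0.
      by rewrite mulr0 normr0 !mulr_ge0 ?invr_ge0.
    rewrite 2!normrM; apply: ler_pM => //; last exact: (mollifier_le stepH).
    by apply: ler_pM => //; rewrite distrC; exact: a_near (supp _ mo).
  - by apply: supp; apply: contraNN mo => /eqP->; rewrite mulr0.
  move/le_trans; apply; rewrite [x + _]addrC addrK -mulrA divfK ?lt0r_neq0//.
have -> : K / h - mollified_flux s (x + r1) = (A * mollified_u s x - mollified_flux s x)
   + (mollified_flux s x - mollified_flux s (x + r1))
   + ((potential t (x + r1) - potential t x - r1 * mollified_u s x)
      - theta * (potential t (x + r2) - potential t x - r2 * mollified_u s x)) / h.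
  have -> : A = (r1 - theta * r2) / h by rewrite -hA mulrAC mulfV ?mul1r ?lt0r_neq0.
  rewrite /K; move: (potential t x) (potential t (x + r1)) (potential t (x + r2)).
  move: (mollified_u s x) (mollified_flux s x) (mollified_flux s (x + r1)) => *.
  by ring.
apply: (le_trans (ler_normD _ _)); apply: lerD.
  by apply: (le_trans (ler_normD _ _)); exact: lerD.
rewrite normrM normfV (gtr0_norm h0) ler_wpM2r ?invr_ge0//.
apply: (le_trans (ler_normB _ _)); apply: lerD => //.
by rewrite normrM (ger0_norm th0); apply: le_trans i2; exact: ler_piMl.
Qed.

End regularized_potential.

(** * Convergence of the scheme *)

(** The weights sum to at most [K] and each multiplies a difference of two values, so the constant
    does not see the grid step. Separate base points [x] and [y] absorb the shift of the frame. *)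
Lemma discrete_conv_le {R : realFieldType} (N : nat) (d : nat -> R) (D K e : R)
    (Phi Psi : R -> R) x y :
  (forall m, (m < N)%N -> 0 <= d m) -> \sum_(m < N) d m <= K ->
  (forall z, `|Phi (x + z) - Psi (y + z)| <= e) ->
  `|discrete_conv N d D Phi x - discrete_conv N d D Psi y| <= 2 * K * e.
Proof.
move=> d0 dK e_le; have e0 : 0 <= e := le_trans (normr_ge0 _) (e_le 0).
rewrite /discrete_conv -sumrB; apply: (le_trans (ler_norm_sum _ _ _)).
apply: (@le_trans _ _ (\sum_(m < N) d m * (2 * e))); last first.
  by rewrite -mulr_suml (mulrC 2 K) -mulrA ler_wpM2r// mulr_ge0.
apply: ler_sum => m _; rewrite -mulrBr normrM ger0_norm ?d0// ler_wpM2l ?d0//.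
have := e_le (m.+1%:R * D); have := e_le 0; rewrite !addr0 !ler_norml.
by move=> /andP[p1 p2] /andP[q1 q2]; apply/andP; split; lra.
Qed.

Lemma upwind_contraction {R : realFieldType} (theta p q p' q' e : R) :
  0 <= theta <= 1 -> `|p - p'| <= e -> `|q - q'| <= e ->
  `|p - theta * (p - q) - (p' - theta * (p' - q'))| <= e.
Proof.
move=> /andP[th0 th1] pp qq.
have -> : p - theta * (p - q) - (p' - theta * (p' - q')) =
    (1 - theta) * (p - p') + theta * (q - q') by ring.
apply: (le_trans (ler_normD _ _)); rewrite !normrM (ger0_norm th0) ger0_norm ?subr_ge0//.
have : (1 - theta) * `|p - p'| <= (1 - theta) * e by rewrite ler_wpM2l ?subr_ge0.
have : theta * `|q - q'| <= theta * e by rewrite ler_wpM2l.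
lra.
Qed.

(** The three summands are the factors of [M * kappa], [delta] and [D / delta] in the error. Since
    time and space steps are tied by [h = lam * D], neither scale remains in the constant, which can
    be fixed before [delta] and [D] are chosen. *)
Definition scheme_const {R : realType} (M Ba L C lam c K t : R) : R :=
  let e := 2 * K * expR (t * (2 * M * C * L * K)) in
  (1 + e * t * (M * C * L))
  + (4 * M * K + e * (4 * M + t * (M * C * L * (4 * M * K + 2 * K * (M * Ba * C * lam)))))
  + e * t * (6 * (M * Ba) * C * `|c| * lam + 3 * M * C * c ^+ 2 * lam + 3 * M * C / lam
             + 3 * (M * Ba) * C).

Section convergence_of_the_scheme.
Context {R : realType}.
Notation mu := (@lebesgue_measure R).
Variables (H : R -> R) (C : R) (stepH : smooth_step H C).
Variables (delta : R) (delta_gt0 : 0 < delta).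
Variables (V k : R -> R) (u : R -> R -> R) (u0 : R -> R) (M Ba L : R).
Let a t x := V (convolution (u t) k x).
Hypothesis measurable_u : measurable_fun setT (fun z : R * R => u z.1 z.2).
Hypothesis measurable_a : measurable_fun setT (fun z : R * R => a z.1 z.2).
Hypothesis measurable_u0 : measurable_fun setT u0.
Hypothesis u_le : forall t x, `|u t x| <= M.
Hypothesis a_le : forall t x, `|a t x| <= Ba.
Hypothesis u0_le : forall x, `|u0 x| <= M.
Hypothesis weak : tensor_solution u a u0.
Hypothesis V_lip : forall x y, `|V x - V y| <= L * `|x - y|.

Variables (N : nat) (d : nat -> R) (D lam c K kappa : R).
Hypothesis D_gt0 : 0 < D.
Hypothesis lam_gt0 : 0 < lam.
Hypothesis D_le : D <= delta.
Hypothesis h_le : `|c| * (lam * D) <= delta.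
Hypothesis d_ge0 : forall m, (m < N)%N -> 0 <= d m.
Hypothesis d_sum : \sum_(m < N) d m <= K.
Hypothesis kernel_close : forall (v : R -> R) (x : R), measurable_fun setT v -> (forall y, `|v y| <= M) ->
  `|convolution v k x
    - \sum_(m < N) d m * \int[mu]_y (v y * (heaviside x y - heaviside (x + m.+1%:R * D) y))|
  <= M * kappa.

Definition initial_potential x := \int[mu]_y (u0 y * (heaviside 0 y - heaviside x y)).

Let h := lam * D.
Let b w := V w - c.
Let Phi n := iter n (scheme N d D lam b) initial_potential.
Let dconv := discrete_conv N d D.
Let F := potential H delta u a u0.

Hypothesis speed_01 : forall n x, 0 <= lam * b (dconv (Phi n) x) <= 1.

Let M_ge0 : 0 <= M. Proof. exact: le_trans (u0_le 0). Qed.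
Let Ba_ge0 : 0 <= Ba. Proof. exact: le_trans (a_le 0 0). Qed.
Let C_ge0 : 0 <= C. Proof. exact: step_C_ge0 stepH. Qed.
Let L_ge0 : 0 <= L.
Proof. by have := V_lip 1 0; rewrite subr0 normr1 mulr1; apply: le_trans. Qed.
Let K_ge0 : 0 <= K.
Proof. by apply: le_trans d_sum; apply: sumr_ge0 => m _; exact: d_ge0. Qed.
Let h_gt0 : 0 < h. Proof. exact: mulr_gt0. Qed.
Let kappa_M_ge0 : 0 <= M * kappa.
Proof. exact: le_trans (normr_ge0 _) (kernel_close 0 measurable_u0 u0_le). Qed.

Let measurable_us s : measurable_fun setT (u s).
Proof. exact: (measurable_fun_pair2 s measurable_u). Qed.

(** Two replacements: the kernel by its staircase, at the cost [M * kappa], and the jumps of the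
    staircase by smooth steps, at the cost [4 * M * delta] per unit of weight. *)
Lemma conv_close s x y : slice_identity H delta u a u0 s -> `|y - x| <= delta ->
  `|convolution (u s) k y - dconv (F s) x| <= M * kappa + 4 * M * delta * K.
Proof.
move=> ids yx.
have -> : dconv (F s) x = \sum_(m < N) d m *
    \int[mu]_y (u s y * step_diff H delta x (x + m.+1%:R * D) y).
  apply: eq_bigr => m _; congr (_ * _).
  exact: (slice_identityB stepH delta_gt0 measurable_u u_le x _ ids).
pose hv m := \int[mu]_z (u s z * (heaviside y z - heaviside (y + m.+1%:R * D) z)).
pose sv m := \int[mu]_z (u s z * step_diff H delta x (x + m.+1%:R * D) z).
have close m : `|sv m - hv m| <= 4 * M * delta.
  exact: (Rintegral_step_heaviside stepH delta_gt0 (measurable_us s) (u_le s) _ yx).2.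
have kc := kernel_close y (measurable_us s) (u_le s).
rewrite -/(sv _) (_ : _ - _ = (convolution (u s) k y - \sum_(m < N) d m * hv m)
  - (\sum_(m < N) d m * sv m - \sum_(m < N) d m * hv m)); last first.
  by rewrite opprB addrA subrK.
apply: (le_trans (ler_normB _ _)); apply: lerD; first exact: kc.
rewrite -sumrB; apply: (le_trans (ler_norm_sum _ _ _)).
apply: (@le_trans _ _ (\sum_(m < N) d m * (4 * M * delta))); last first.
  rewrite -mulr_suml (mulrC _ K) ler_wpM2r// !mulr_ge0//; exact: ltW.
by apply: ler_sum => m _; rewrite -mulrBr normrM ger0_norm ?d_ge0// ler_wpM2l ?d_ge0.
Qed.

Lemma initial_close x : `|initial_potential x - F 0 x| <= 4 * M * delta.
Proof.
have := (Rintegral_step_heaviside stepH delta_gt0 measurable_u0 u0_le x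
  (_ : `|0 - 0| <= delta)).2; rewrite subrr normr0 !add0r => /(_ (ltW delta_gt0)).
rewrite distrC /F /potential (_ : \int[mu]_(s in `[0, 0]) _ = 0) ?subr0//.
by rewrite set_itv1 Rintegral_set1.
Qed.

Let err r := 3 * M * C * r ^+ 2 / delta + 3 * (M * Ba) * C * `|r| / delta * h.
Let alpha := 2 * M * C * L * K.
Let beta := M * C * L * (M * kappa + 4 * M * delta * K + 2 * K * (M * Ba * C * h))
  + 3 * (M * Ba) * C * `|c * h| / delta + (err (c * h) + err D) / h.

(** Along the moving point the potential nearly satisfies the scheme with the speed that the scheme
    itself uses. The convex combination carries the old error [e] over without amplification; [e]
    enters a second time through the speed, which produces [alpha]. *)
Lemma scheme_error_step n e : 0 <= e ->
  (forall x, `|Phi n x - F (n%:R * h) (x + n%:R * (c * h))| <= e) ->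
  forall x, `|Phi n.+1 x - F (n.+1%:R * h) (x + n.+1%:R * (c * h))| <=
    (1 + alpha * h) * e + h * beta.
Proof.
move=> e0 IH x.
pose t := n%:R * h; pose X := x + n%:R * (c * h).
have t0 : 0 <= t by rewrite mulr_ge0// ltW.
(* Bound on the speed error, in order: staircase, smoothing of the jumps, motion of the potential
   during one time step, and the error already made. *)
pose rho := L * (M * kappa + 4 * M * delta * K + 2 * K * (M * Ba * C * h) + 2 * K * e).
have rho0 : 0 <= rho.
  rewrite mulr_ge0// !addr_ge0// !mulr_ge0//; exact: ltW.
have near_A : {ae mu, forall s, t <= s <= t + h -> slice_identity H delta u a u0 s /\
    forall y, X <= y <= X + delta -> `|a s y - V (dconv (Phi n) x)| <= rho}.
  (* For [n = 0] the time interval contains 0, where [potential_ae] says nothing; this single point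
     is discarded. *)
  apply: ae_impl2 ae_neq0 (potential_ae stepH delta_gt0 measurable_u measurable_a
    measurable_u0 u_le a_le u0_le weak) => s s0 hs tsh.
  have ids : slice_identity H delta u a u0 s by apply: hs; lra.
  split=> // y Xy; apply: (le_trans (V_lip _ _)); rewrite ler_wpM2l//.
  move: tsh => /andP[ts sth].
  have w1 : `|convolution (u s) k y - dconv (F s) X| <= M * kappa + 4 * M * delta * K.
    apply: conv_close => //; rewrite ger0_norm; lra.
  have w2 : `|dconv (F s) X - dconv (F t) X| <= 2 * K * (M * Ba * C * h).
    apply: discrete_conv_le => // z.
    have st0 : 0 <= s - t by rewrite subr_ge0.
    have := potential_time_lip stepH delta_gt0 u0 measurable_u measurable_a u_le a_le
      (X + z) t0 st0.
    rewrite subrKC => /le_trans; apply; rewrite ler_wpM2l ?mulr_ge0//.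
    by rewrite lerBlDl.
  have w3 : `|dconv (F t) X - dconv (Phi n) x| <= 2 * K * e.
    apply: discrete_conv_le => // z; rewrite distrC.
    by have := IH (x + z); rewrite -/t addrAC.
  rewrite (_ : _ - _ = (convolution (u s) k y - dconv (F s) X)
    + (dconv (F s) X - dconv (F t) X) + (dconv (F t) X - dconv (Phi n) x)); last first.
    by rewrite !addrA !subrK.
  apply: (le_trans (ler_normD _ _)); apply: lerD => //.
  by apply: (le_trans (ler_normD _ _)); exact: lerD.
set theta := lam * b (dconv (Phi n) x).
have hA : h * V (dconv (Phi n) x) = c * h - theta * (- D).
  by rewrite /theta /b /h; move: (V _) => *; ring.
have ch : `|c * h| <= delta by rewrite normrM (gtr0_norm h_gt0).
have ND : `|- D| <= delta by rewrite normrN gtr0_norm.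
have := potential_one_step stepH delta_gt0 measurable_u measurable_a u_le a_le u0_le t0 h_gt0 ch ND (speed_01 n x) rho0 hA near_A.
rewrite sqrrN normrN (gtr0_norm D_gt0) -/F.
have -> : 3 * M * C * (c * h) ^+ 2 / delta + 3 * (M * Ba) * C * `|c * h| / delta * h = err (c * h) by [].
have -> : 3 * M * C * D ^+ 2 / delta + 3 * (M * Ba) * C * D / delta * h = err D.
  by rewrite /err (gtr0_norm D_gt0).
pose G := F t X - theta * (F t X - F t (X - D)).
move=> one_step0; have {one_step0} one_step : `|F (t + h) (X + c * h) - G| <=
  h * (M * rho * C + 3 * (M * Ba) * C * `|c * h| / delta) + err (c * h) + err D := one_step0.
have -> : F (n.+1%:R * h) (x + n.+1%:R * (c * h)) = F (t + h) (X + c * h).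
  by congr F; rewrite /t /X -natr1; ring.
have GPhi : `|Phi n.+1 x - G| <= e.
  have p1 := IH x; have p2 := IH (x - D); rewrite -/t -/X addrAC -/X in p1 p2.
  exact: (upwind_contraction (speed_01 n x) p1 p2).
have -> : (1 + alpha * h) * e + h * beta = e + (alpha * h * e + h * beta).
  by rewrite mulrDl mul1r addrA.
apply: (le_trans (ler_distD G _ _)); apply: lerD => //.
rewrite distrC; apply: (le_trans one_step).
rewrite le_eqVlt; apply/orP; left; apply/eqP.
have hh : h * ((err (c * h) + err D) / h) = err (c * h) + err D.
  by rewrite mulrC (divfK (lt0r_neq0 h_gt0)).
rewrite /beta (mulrDr h (_ + _) (_ / h)) hh /rho /alpha.
by move: (err _) (err D) (3 * (M * Ba) * C * _ / _) => *; ring.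
Qed.

Let err_ge0 r : 0 <= err r.
Proof.
apply: addr_ge0; last by rewrite !mulr_ge0 ?invr_ge0//; exact: ltW.
by rewrite divr_ge0 ?(ltW delta_gt0)// mulr_ge0 ?sqr_ge0// !mulr_ge0.
Qed.

Let beta_ge0 : 0 <= beta.
Proof.
rewrite /beta; apply: addr_ge0; last first.
  exact: (divr_ge0 (addr_ge0 (err_ge0 _) (err_ge0 _)) (ltW h_gt0)).
apply: addr_ge0; last by rewrite !mulr_ge0 ?invr_ge0//; exact: ltW.
apply: mulr_ge0; first by rewrite !mulr_ge0.
by rewrite !addr_ge0// !mulr_ge0//; exact: ltW.
Qed.

(** Discrete Gronwall: [E j] dominates the recursion, since each new [h * beta] may be multiplied by
    a power that is at least 1. *)
Lemma scheme_error n x : `|Phi n x - F (n%:R * h) (x + n%:R * (c * h))| <=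
  expR (n%:R * h * alpha) * (4 * M * delta + n%:R * h * beta).
Proof.
have alpha_ge0 : 0 <= alpha by rewrite !mulr_ge0.
have g_ge1 : 1 <= 1 + alpha * h by rewrite lerDl mulr_ge0// ltW.
pose E j := (1 + alpha * h) ^+ j * (4 * M * delta + j%:R * h * beta).
have base_ge0 j : 0 <= 4 * M * delta + j%:R * h * beta.
  by rewrite addr_ge0 ?mulr_ge0//; exact: ltW.
have E_ge0 j : 0 <= E j by rewrite mulr_ge0// exprn_ge0// (le_trans ler01).
have : `|Phi n x - F (n%:R * h) (x + n%:R * (c * h))| <= E n.
  elim: n x => [x|n IH x].
    by rewrite /E expr0 !mul0r !addr0 mul1r; exact: initial_close.
  apply: (le_trans (scheme_error_step (E_ge0 n) IH x)).
  have -> : E n.+1 = (1 + alpha * h) * E n + (1 + alpha * h) ^+ n.+1 * (h * beta).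
    by rewrite /E exprS -natr1; ring.
  rewrite lerD2l; apply: ler_peMl; first by rewrite mulr_ge0// ltW.
  exact: exprn_ege1.
move=> /le_trans; apply; rewrite /E ler_wpM2r//.
rewrite -mulrA expRM_natl [h * _]mulrC lerXn2r ?nnegrE ?expR_ge0 ?(le_trans ler01 g_ge1)//.
exact: expR_ge1Dx.
Qed.

Lemma conv_scheme_error n x y (t := n%:R * h) : slice_identity H delta u a u0 t ->
  `|y - (x + c * t)| <= delta ->
  `|convolution (u t) k y - dconv (Phi n) x| <=
  scheme_const M Ba L C lam c K t * (M * kappa + delta + D / delta).
Proof.
move=> ids yx; set rhs := scheme_const _ _ _ _ _ _ _ _ * _.
have t_ge0 : 0 <= t by rewrite mulr_ge0// ltW.
set e := expR (t * alpha) * (4 * M * delta + t * beta).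
have E_le : M * kappa + 4 * M * delta * K + 2 * K * e <= rhs.
  rewrite /e /rhs /scheme_const -/alpha (mulrA (2 * K)).
  clear e rhs.
  set q := D / delta; set B3 := 6 * (M * Ba) * C * `|c| * lam + _ + _ + _.
  set B2 := M * C * L * (4 * M * K + _); set f := 2 * K * expR (t * alpha).
  have betaE : beta = M * C * L * (M * kappa) + M * C * L * (4 * M * K * delta
     + 2 * K * (M * Ba * C * lam) * D) + B3 * q.
    rewrite /beta /err normrM (gtr0_norm h_gt0) (gtr0_norm D_gt0) /B3 /q /h.
    by field; rewrite !lt0r_neq0.
  have beta_le : beta <= M * C * L * (M * kappa) + B2 * delta + B3 * q.
    rewrite betaE lerD2r lerD2l /B2 -[leRHS]mulrA ler_wpM2l ?mulr_ge0//.
    rewrite [leRHS]mulrDl lerD2l ler_wpM2l//.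
    by rewrite !mulr_ge0 ?(ltW lam_gt0).
  have f_ge0 : 0 <= f by rewrite !mulr_ge0 ?expR_ge0.
  have q_ge0 : 0 <= q by rewrite divr_ge0 ?(ltW D_gt0) ?(ltW delta_gt0).
  have B3_ge0 : 0 <= B3.
    rewrite /B3; move: (c ^+ 2) (sqr_ge0 c) => c2 c2_ge0.
    by rewrite !addr_ge0// !mulr_ge0 ?invr_ge0 ?(ltW lam_gt0).
  have B2_ge0 : 0 <= B2.
    by rewrite mulr_ge0 ?addr_ge0// !mulr_ge0// ltW.
  have mono (p1 p2 p3 q1 q2 q3 : R) : 0 <= p1 -> 0 <= p2 -> 0 <= p3 ->
      0 <= q1 -> 0 <= q2 -> 0 <= q3 ->
      p1 * q1 + p2 * q2 + p3 * q3 <= (p1 + p2 + p3) * (q1 + q2 + q3).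
    move=> p10 p20 p30 q10 q20 q30.
    have : 0 <= p1 * (q2 + q3) + p2 * (q1 + q3) + p3 * (q1 + q2).
      by rewrite !addr_ge0 ?mulr_ge0 ?addr_ge0.
    lra.
  have MCL_ge0 : 0 <= M * C * L by rewrite !mulr_ge0.
  clearbody f B2 B3 q t.
  have p1 : 0 <= 1 + f * t * (M * C * L) by rewrite addr_ge0// !mulr_ge0.
  have p2 : 0 <= 4 * M * K + f * (4 * M + t * B2).
    by rewrite addr_ge0 ?mulr_ge0// addr_ge0// mulr_ge0.
  have p3 : 0 <= f * t * B3 by rewrite !mulr_ge0.
  apply: le_trans (mono _ _ _ _ _ _ p1 p2 p3 kappa_M_ge0 (ltW delta_gt0) q_ge0).
  have fb : f * (t * beta) <= f * (t * (M * C * L * (M * kappa) + B2 * delta + B3 * q)).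
    by do 2 rewrite ler_wpM2l//.
  rewrite [f * (_ + _)]mulrDr addrA; apply: (le_trans (lerD (lexx _) fb)).
  by rewrite le_eqVlt; apply/orP; left; apply/eqP; ring.
apply: le_trans E_le.
have w1 := conv_close ids yx.
have w2 : `|dconv (F t) (x + c * t) - dconv (Phi n) x| <= 2 * K * e.
  apply: discrete_conv_le => // z; rewrite distrC.
  by have := scheme_error n (x + z); rewrite -/t mulrCA -/t addrAC.
apply: (le_trans (ler_distD (dconv (F t) (x + c * t)) _ _)).
exact: lerD.
Qed.

End convergence_of_the_scheme.

(** * Convolution of bounded and integrable functions *)

Section convolution_tools.
Context {R : realType}.
Notation mu := (@lebesgue_measure R).

Lemma Rintegral_reflect (f : R -> R) (x : R) : mu.-integrable setT (EFin \o f) ->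
  mu.-integrable setT (EFin \o (fun y : R => f (x - y))) /\
  \int[mu]_y f (x - y) = \int[mu]_y f y.
Proof.
move=> fi; have mf : measurable_fun setT f by apply/measurable_EFinP; exact: measurable_int fi.
have refl : (\int[mu]_y (f (x - y))%:E = \int[mu]_y (f y)%:E)%E.
  have mEf : measurable_fun setT (EFin \o f) by exact/measurable_EFinP.
  have hp := ge0_integral_reflect x (measurable_funepos mEf) (fun y => funepos_ge0 _ y).
  have hn := ge0_integral_reflect x (measurable_funeneg mEf) (fun y => funeneg_ge0 _ y).
  rewrite integralE [RHS]integralE; congr (_ - _)%E.
    by rewrite -[RHS]hp; apply: eq_integral => y _; rewrite !funeposE.
  by rewrite -[RHS]hn; apply: eq_integral => y _; rewrite !funenegE.
split; last by rewrite /Rintegral refl.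
apply/integrableP; split.
  by apply/measurable_EFinP; apply: measurableT_comp => //; exact: measurable_funB.
rewrite (@ge0_integral_reflect _ x (fun y => `|(f y)%:E|)%E)//.
  by have /integrableP[] := fi.
by do 2 apply: measurableT_comp => //.
Qed.

Lemma convolution_bound (v q : R -> R) (M x : R) : measurable_fun setT v ->
  (forall y, `|v y| <= M) -> mu.-integrable setT (EFin \o q) ->
  mu.-integrable setT (EFin \o (fun y : R => v y * q (x - y))) /\
  `|convolution v q x| <= M * \int[mu]_w `|q w|.
Proof.
move=> mv vM qi; have mq : measurable_fun setT q by apply/measurable_EFinP; exact: measurable_int qi.
have aqi : mu.-integrable setT (EFin \o (fun w => `|q w|)) by exact: integrable_norm.
have [qxi qxE] := Rintegral_reflect x aqi.
have mvq : measurable_fun setT (fun y : R => v y * q (x - y)).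
  by apply: measurable_funM => //; apply: measurableT_comp => //; exact: measurable_funB.
have Mqi : mu.-integrable setT (EFin \o (fun y : R => M * `|q (x - y)|)).
  exact: integrable_EFinZl.
have i1 : mu.-integrable setT (EFin \o (fun y : R => v y * q (x - y))).
  apply: (@le_integrable _ _ _ _ _ measurableT _ _ _ _ Mqi).
    exact/measurable_EFinP.
  move=> y _; rewrite /= lee_fin normrM.
  by apply: le_trans (ler_norm _); rewrite ler_wpM2r.
split=> //; rewrite -qxE -RintegralZl//.
apply: le_trans (le_normr_Rintegral _ i1) _ => //.
apply: le_Rintegral => //; first exact: integrable_norm.
by move=> y _; rewrite normrM ler_wpM2r.
Qed.

Lemma integrable_heaviside (v : R -> R) (M x z : R) : measurable_fun setT v ->
  (forall y, `|v y| <= M) ->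
  mu.-integrable setT (EFin \o (fun y : R => v y * (heaviside x y - heaviside z y))).
Proof.
move=> mv vM; have [||||//] := @integrable_supported R
  (fun y => v y * (heaviside x y - heaviside z y)) (Num.min x z) (Num.max x z) M.
- by rewrite le_max ge_min lexx.
- by apply: measurable_funM => //; apply: measurable_funB; exact: measurable_heaviside.
- move=> y; rewrite normrM; apply: le_trans (vM y); apply: ler_piMr => //.
  by rewrite /heaviside; case: ltP => _; case: ltP => _;
    rewrite ?subrr ?subr0 ?sub0r ?normrN ?normr0 ?normr1.
- move=> y; rewrite ge_min le_max /heaviside.
  have [h1|h1] := ltP x y; have [h2|h2] := ltP z y; rewrite ?subrr ?mulr0 ?eqxx// => _;
    by rewrite ?h1 ?h2 ?(ltW h1) ?(ltW h2) ?orbT.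
Qed.

End convolution_tools.

Lemma Rintegral_sum_ord d (T : measurableType d) (R : realType) (mu : {measure set T -> \bar R})
    (N : nat) (f : nat -> T -> R) :
  (forall m, mu.-integrable setT (EFin \o f m)) ->
  mu.-integrable setT (EFin \o (fun x => \sum_(m < N) f m x)) /\
  \int[mu]_x (\sum_(m < N) f m x) = \sum_(m < N) \int[mu]_x f m x.
Proof.
move=> fi; elim: N => [|N [i1 e1]].
  rewrite big_ord0; under eq_Rintegral do rewrite big_ord0.
  split; last by rewrite Rintegral_cst// mul0r.
  apply: (eq_integrable measurableT _ _ _ (integrable0 _ _)) => //.
  by move=> x _; rewrite /= big_ord0.
rewrite big_ord_recr/= -e1; under eq_Rintegral do rewrite big_ord_recr/=.
split; last by rewrite RintegralD.
apply: (eq_integrable measurableT _ _ _ (integrableD measurableT i1 (fi N))) => //.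
by move=> x _; rewrite /= big_ord_recr.
Qed.

(** * Staircase approximation of a monotone convex kernel *)

Section kernel_discretisation.
Context {R : realType}.
Notation mu := (@lebesgue_measure R).
Variables (k : R -> R) (Kb : R).
Hypothesis k_ge0 : forall w, w < 0 -> 0 <= k w.
Hypothesis k_le : forall w, w < 0 -> k w <= Kb.
Hypothesis k_mono : forall x y, x <= y -> y < 0 -> k x <= k y.
Hypothesis k_convex : forall x y l, x < 0 -> y < 0 -> 0 <= l <= 1 ->
  k ((1 - l) * x + l * y) <= (1 - l) * k x + l * k y.

(* The staircase with values [k (- (m.+1 * D)) - k (- (N * D))]: subtracting the last value
   avoids a final jump, which would break the monotonicity of the slopes. *)
Definition grid_value D N m := k (- ((minn m.+1 N)%:R * D)).

Definition grid_slope D N m := grid_value D N m - grid_value D N m.+1.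

Definition grid_kernel D N w :=
  \sum_(m < N) grid_slope D N m * (heaviside 0 (- w) - heaviside (m.+1%:R * D) (- w)).

Section fixed_grid.
Variables (D : R) (N : nat).
Hypothesis D_gt0 : 0 < D.
Hypothesis N_gt0 : (0 < N)%N.
Let G := grid_value D N.

Let arg_lt0 m : - ((minn m.+1 N)%:R * D) < 0.
Proof. by rewrite oppr_lt0 mulr_gt0// ltr0n leq_min N_gt0. Qed.

Lemma grid_slope_ge0 m : 0 <= grid_slope D N m.
Proof.
rewrite subr_ge0; apply: k_mono => //.
by rewrite lerN2 ler_wpM2r ?(ltW D_gt0)// ler_nat; lia.
Qed.

Lemma grid_slopeN : grid_slope D N N = 0.
Proof.
apply/eqP; rewrite subr_eq0; apply/eqP; congr (k (- (_%:R * D))); lia.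
Qed.

(** Midpoint convexity inside the grid; at its end the truncated index makes the next slope
    vanish. *)
Lemma grid_slope_nonincr m : grid_slope D N m.+1 <= grid_slope D N m.
Proof.
have [mN|Nm] := leqP m.+3 N; last first.
  apply: le_trans (grid_slope_ge0 m); rewrite subr_le0 le_eqVlt; apply/orP; left.
  by apply/eqP; congr (k (- (_%:R * D))); lia.
have := grid_slope_ge0 m; rewrite /grid_slope /grid_value.
have mid : k (- (m.+2%:R * D)) <= (1 - 2^-1) * k (- (m.+1%:R * D)) + 2^-1 * k (- (m.+3%:R * D)).
  have -> : - (m.+2%:R * D) = (1 - 2^-1) * (- (m.+1%:R * D)) + 2^-1 * (- (m.+3%:R * D)).
    by rewrite -(@natr1 _ m.+2) -(@natr1 _ m.+1); field.
  by apply: k_convex; rewrite ?oppr_lt0 ?mulr_gt0//; lra.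
have -> : minn m.+1 N = m.+1 by lia.
have -> : minn m.+2 N = m.+2 by lia.
have -> : minn m.+3 N = m.+3 by lia.
by move: mid; lra.
Qed.

Lemma sum_grid_slope i : (i <= N)%N -> \sum_(i <= m < N) grid_slope D N m = G i - k (- (N%:R * D)).
Proof.
move=> iN; rewrite /grid_slope; under eq_bigr do rewrite -opprB.
rewrite sumrN telescope_sumr// opprB /G /grid_value.
by congr (_ - k (- (_%:R * D))); lia.
Qed.

Lemma sum_grid_slope_le : \sum_(m < N) grid_slope D N m <= Kb.
Proof.
rewrite -(big_mkord xpredT (grid_slope D N)) sum_grid_slope//.
rewrite lerBlDr ler_wpDr ?k_ge0 ?k_le ?oppr_lt0 ?mulr_gt0 ?ltr0n//; lia.
Qed.

Lemma grid_kernel_ge0_arg w : 0 <= w -> grid_kernel D N w = 0.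
Proof.
move=> w0; apply: big1 => m _; rewrite /heaviside !ltNge.
have -> : - w <= 0 by lra.
have -> : - w <= m.+1%:R * D.
  by have : 0 <= m.+1%:R * D by [rewrite mulr_ge0// ltW]; lra.
by rewrite subrr mulr0.
Qed.

(** On a cell of the grid the slopes telescope to the value of [k] at the left end minus its value
    at the end of the grid; monotonicity places the former between [k (w - D)] and [k w]. *)
Lemma grid_kernel_bounds w : w < 0 ->
  [/\ 0 <= grid_kernel D N w, grid_kernel D N w <= k w &
   - w <= N%:R * D -> k (w - D) - k (- (N%:R * D)) <= grid_kernel D N w].
Proof.
move=> w0.
have [i /andP[iw wi]] : exists i : nat, i%:R * D < - w <= i.+1%:R * D.
  have ex : exists i : nat, - w <= i.+1%:R * D.
    exists (Num.truncn (- w / D)); rewrite -ler_pdivrMr//.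
    exact/ltW/truncnS_gt.
  case: (ex_minnP ex) => -[|i] wi imin.
    by exists 0%N; rewrite mul0r wi andbT oppr_gt0.
  exists i.+1; rewrite wi andbT ltNge; apply/negP => /imin; by rewrite ltnn.
have gkE : grid_kernel D N w = \sum_(i <= m < N) grid_slope D N m.
  rewrite (big_nat_widenl i 0)// big_mkord [RHS]big_mkcond; apply: eq_bigr => m _ /=.
  rewrite /heaviside oppr_gt0 w0; case: leqP => im.
    rewrite ltNge (le_trans wi) ?subr0 ?mulr1//.
    by rewrite ler_wpM2r ?ler_nat// ltW.
  rewrite (le_lt_trans _ iw) ?subrr ?mulr0//.
  by rewrite ler_wpM2r ?ler_nat// ltW.
have [iN|Ni] := leqP i.+1 N; last first.
  rewrite gkE big_geq//; split=> //; first exact: k_ge0.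
  move=> wN; exfalso; have : N%:R * D <= i%:R * D by rewrite ler_wpM2r ?ler_nat// ltW.
  lra.
have ND : - (N%:R * D) <= - (i.+1%:R * D) by rewrite lerN2 ler_wpM2r ?ler_nat// ltW.
have i0 : - (i.+1%:R * D) < 0 by rewrite oppr_lt0 mulr_gt0.
rewrite gkE sum_grid_slope ?(ltnW iN)// /G /grid_value (minn_idPl iN); split.
- by rewrite subr_ge0 k_mono.
- have : k (- (i.+1%:R * D)) <= k w by apply: k_mono => //; lra.
  have : 0 <= k (- (N%:R * D)) by apply: k_ge0; lra.
  lra.
- move=> _; rewrite lerD2r; apply: k_mono => //.
  by move: iw; rewrite -natr1; lra.
Qed.

Lemma grid_kernel_norm_le w : `|grid_kernel D N w| <= `|k w|.
Proof.
have [w0|w0] := ltP w 0; last by rewrite grid_kernel_ge0_arg// normr0.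
have [h1 h2 _] := grid_kernel_bounds w0.
by rewrite ger0_norm// (le_trans h2)// ler_norm.
Qed.

End fixed_grid.

Hypothesis integrable_k : mu.-integrable setT (EFin \o k).
Hypothesis k_supp : {ae mu, forall w, 0 < w -> k w = 0}.

Lemma measurable_grid_kernel D N : measurable_fun setT (grid_kernel D N).
Proof.
apply: measurable_sum => m; apply: measurable_funM => //.
by apply: measurable_funB; apply: measurableT_comp => //; exact: measurable_heaviside.
Qed.

Let integrable_indic_itv (a b : R) : mu.-integrable setT (EFin \o \1_(`]a, b[ : set R)).
Proof.
have [||||//] := @integrable_supported R (\1_(`]a, b[ : set R)) a (Num.max a b) 1.
- by rewrite le_max lexx.
- by apply: measurable_indic; exact: measurable_itv.
- by move=> y; rewrite indicE; case: (_ \in _); rewrite ?normr1 ?normr0.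
- move=> y; rewrite indicE mem_setE in_itv/=; case: ltP => //= h1; case: ltP => //= h2.
  by rewrite (ltW h1) le_max (ltW h2) orbT.
  all: by rewrite eqxx.
Qed.

Lemma integrable_grid_kernel D N : 0 < D -> (0 < N)%N ->
  mu.-integrable setT (EFin \o grid_kernel D N).
Proof.
move=> D0 N0; apply: (@le_integrable _ _ _ _ _ measurableT _ _ _ _ integrable_k).
  by apply/measurable_EFinP; exact: measurable_grid_kernel.
by move=> w _; rewrite /= lee_fin grid_kernel_norm_le.
Qed.

(** Chebyshev's inequality for a monotone kernel: on []- A, 0[] it is at least [k (- A)]. *)
Lemma kernel_tail A : 0 < A -> A * k (- A) <= \int[mu]_w `|k w|.
Proof.
move=> A0.
have ik : mu.-integrable setT (EFin \o (fun w => `|k w|)) by exact: integrable_norm.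
have kA : 0 <= k (- A) by apply: k_ge0; lra.
have [||||i _] := @integrable_supported R (fun w => k (- A) * \1_(`]- A, 0[ : set R) w) (- A) 0 (k (- A)).
- lra.
- apply: measurable_funM => //; apply: measurable_indic; exact: measurable_itv.
- move=> y; rewrite normrM (ger0_norm kA) ler_piMr// indicE.
  by case: (_ \in _); rewrite ?normr1 ?normr0.
- move=> y; rewrite indicE mem_setE in_itv/=; case: ltP => // h1; case: ltP => // h2; rewrite ?mulr0 ?eqxx//=.
  by move=> _; lra.
have <- : \int[mu]_w (k (- A) * \1_(`]- A, 0[ : set R) w) = A * k (- A).
  have h := RintegralZl (k (- A)) measurableT (integrable_indic_itv (- A) 0); rewrite h {h}.
  pose I : set R := `]- A, 0[%classic; have mI : measurable I by exact: measurable_itv.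
  have hi : (\int[mu]_w (\1_I w)%:E = mu I)%E by rewrite integral_indic ?setIT.
  by rewrite /Rintegral hi/= lebesgue_measure_itv/= lte_fin oppr_lt0 A0 -EFinD/= sub0r opprK mulrC.
apply: le_Rintegral => // w _; rewrite indicE mem_setE in_itv/=.
case: ltP => h1; case: ltP => h2; rewrite ?mulr0 ?mulr1//=.
by apply: le_trans (ler_norm _); apply: k_mono => //; lra.
Qed.

(** A bounded convex function is Lipschitz away from the end of its interval: [w] is a convex
    combination of [w - D] and [w / 2], with weight [l <= 2 * D / (- w)] on the second point, where
    [k] is bounded by [Kb]. *)
Lemma kernel_left_modulus w D : w < 0 -> 0 < D -> k w - k (w - D) <= 2 * Kb * D / (- w).
Proof.
move=> w0 D0; pose l := D / (D - w / 2).
have den : 0 < D - w / 2 by lra.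
have l01 : 0 <= l <= 1.
  by rewrite /l divr_ge0 ?ler_pdivrMr ?mul1r//=; lra.
have cvx := @k_convex (w - D) (w / 2) l _ _ l01.
have wE : (1 - l) * (w - D) + l * (w / 2) = w by rewrite /l; field; lra.
rewrite wE in cvx; have {cvx} cvx : k w <= (1 - l) * k (w - D) + l * k (w / 2) by apply: cvx; lra.
have k1 : k (w / 2) <= Kb by apply: k_le; lra.
have k2 : 0 <= k (w - D) by apply: k_ge0; lra.
have Kb0 : 0 <= Kb by apply: le_trans (k_le (w := w - D) _) => //; lra.
have h1 : k w - k (w - D) <= l * Kb.
  have /andP[l0 _] := l01.
  have : l * (k (w / 2) - k (w - D)) <= l * Kb by rewrite ler_wpM2l//; lra.
  lra.
apply: (le_trans h1); rewrite (_ : 2 * Kb * D / (- w) = (2 * D / (- w)) * Kb); last by field; lra.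
rewrite ler_wpM2r// /l ler_pdivrMr// mulrAC ler_pdivlMr; last by lra.
rewrite mulrBr.
have := mulr_ge0 (ltW D0) (ltW D0); lra.
Qed.

(** With [n.+1 ^ 2] cells of width [D0 / n.+1] the grid becomes fine while its length [n.+1 * D0]
    tends to infinity. Convexity bounds the shift by one cell and [kernel_tail] the subtracted
    value; at fixed [w] both are of order [1 / n.+1]. *)
Lemma grid_kernel_cvg w (D0 : R) : 0 < D0 -> w < 0 ->
  grid_kernel (D0 / n.+1%:R) (n.+1 ^ 2)%N w @[n --> \oo] --> k w.
Proof.
move=> D00 w0; set W := \int[mu]_w `|k w|.
pose P := 2 * Kb * D0 / (- w) + W / D0.
apply/cvgrPdist_le => e e0.
exists (maxn (Num.truncn (P / e)) (Num.truncn (- w / D0))) => // n /=.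
rewrite geq_max => /andP[n1 n2].
have n1r : (0 : R) < n.+1%:R by [].
have Pe : P / n.+1%:R <= e.
  rewrite ler_pdivrMr// mulrC -ler_pdivrMr//; apply: le_trans (ltW (truncnS_gt _)) _.
  by rewrite ler_nat ltnS.
have wn : - w <= n.+1%:R * D0.
  rewrite -ler_pdivrMr//; apply: le_trans (ltW (truncnS_gt _)) _.
  by rewrite ler_nat ltnS.
have ND : (n.+1 ^ 2)%:R * (D0 / n.+1%:R) = n.+1%:R * D0.
  by rewrite natrX; field; rewrite lt0r_neq0.
have Dn : 0 < D0 / n.+1%:R by rewrite divr_gt0.
have [gk0 gkk gkl] := @grid_kernel_bounds (D0 / n.+1%:R) (n.+1 ^ 2) Dn isT _ w0.
rewrite ND in gkl; rewrite ger0_norm ?subr_ge0//.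
apply: le_trans Pe; have := kernel_left_modulus w0 Dn.
have : k (- (n.+1%:R * D0)) <= W / (n.+1%:R * D0).
  by rewrite ler_pdivlMr ?mulr_gt0// mulrC; apply: kernel_tail; rewrite mulr_gt0.
have -> : P / n.+1%:R = 2 * Kb * (D0 / n.+1%:R) / - w + W / (n.+1%:R * D0).
  rewrite /P; move: (n.+1%:R) n1r => r r0; field.
  by rewrite (ltr0_neq0 w0) (lt0r_neq0 r0) (lt0r_neq0 D00).
move=> a1 a2; apply: (le_trans _ (lerD a2 a1)); rewrite -addrA lerD2l addrC -[leRHS]opprB lerN2.
exact: gkl.
Qed.

(** Dominated convergence with the absolute value of [k] as majorant. The point 0 is left out, as
    the value [k 0] is not prescribed. *)
Lemma grid_kernel_L1 (D0 e : R) : 0 < D0 -> 0 < e -> exists n0 : nat, forall n, (n0 <= n)%N ->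
  \int[mu]_w `|k w - grid_kernel (D0 / n.+1%:R) (n.+1 ^ 2)%N w| <= e.
Proof.
move=> D00 e0; pose gk n := grid_kernel (D0 / n.+1%:R) (n.+1 ^ 2)%N.
have mk : measurable_fun setT k by apply/measurable_EFinP; exact: measurable_int integrable_k.
have dom n w : `|gk n w| <= `|k w| by rewrite grid_kernel_norm_le// divr_gt0.
have cvg : {ae mu, forall w, setT w -> (EFin (gk n w)) @[n --> \oo] --> (EFin \o k) w}.
  apply: ae_impl2 ae_neq0 k_supp => w w0 kw _.
  apply/cvg_EFin; first by apply: nearW.
  have [wlt|wgt|/eqP wE] := ltgtP w 0.
  - exact: grid_kernel_cvg.
  - rewrite /comp kw//; apply: cvg_near_cst; apply: nearW => n /=.
    by rewrite /gk grid_kernel_ge0_arg// ?divr_gt0// ltW.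
  - by rewrite wE in w0.
have mgk n : measurable_fun setT (EFin \o gk n).
  by apply/measurable_EFinP; exact: measurable_grid_kernel.
have mEk : measurable_fun setT (EFin \o k) by exact/measurable_EFinP.
have iak : mu.-integrable setT (EFin \o (fun w => `|k w|)) by exact: integrable_norm.
have domE : {ae mu, forall w, forall n : nat, setT w ->
    (abse (EFin (gk n w)) <= EFin (`|k w|)%R)%E}.
  by apply: aeW => w n _; rewrite /= lee_fin.
have [//|//|//|//|//|_ h _] := @dominated_convergence _ _ R mu setT measurableT
  (fun n => EFin \o gk n) (EFin \o k) (EFin \o (fun w => `|k w|)).
move/fine_cvgP : h => [_ /cvgrPdist_le /(_ e e0) [n0 _ h]].
exists n0 => n n0n; have := h n n0n; rewrite sub0r normrN => /(le_trans (ler_norm _)).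
congr (_ <= _); rewrite /= /Rintegral; congr fine.
by apply: eq_integral => w _; rewrite distrC.
Qed.

Lemma grid_kernel_conv (v : R -> R) (M D : R) N x : 0 < D -> (0 < N)%N -> measurable_fun setT v ->
  (forall y, `|v y| <= M) ->
  convolution v (grid_kernel D N) x = \sum_(m < N) grid_slope D N m *
    \int[mu]_y (v y * (heaviside x y - heaviside (x + m.+1%:R * D) y)).
Proof.
move=> D0 N0 mv vM.
have j m : mu.-integrable setT (EFin \o (fun y : R =>
    v y * (heaviside x y - heaviside (x + m.+1%:R * D) y))).
  exact: integrable_heaviside mv vM.
have i m : mu.-integrable setT (EFin \o (fun y : R => grid_slope D N m *
    (v y * (heaviside x y - heaviside (x + m.+1%:R * D) y)))) by exact: integrable_EFinZl.
have [_ s] := Rintegral_sum_ord N i.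
under [RHS]eq_bigr => m _ do rewrite -(RintegralZl _ measurableT (j m)).
rewrite -s; apply: eq_Rintegral => y _; rewrite /grid_kernel mulr_sumr; apply: eq_bigr => m _.
rewrite mulrCA; congr (_ * (_ * (_ - _))); rewrite /heaviside opprB.
  by rewrite subr_gt0.
by rewrite ltrBrDl.
Qed.

Lemma grid_kernel_close (v : R -> R) (M D : R) N x : 0 < D -> (0 < N)%N -> measurable_fun setT v ->
  (forall y, `|v y| <= M) ->
  `|convolution v k x - \sum_(m < N) grid_slope D N m *
      \int[mu]_y (v y * (heaviside x y - heaviside (x + m.+1%:R * D) y))|
  <= M * \int[mu]_w `|k w - grid_kernel D N w|.
Proof.
move=> D0 N0 mv vM; rewrite -(grid_kernel_conv x D0 N0 mv vM).
have igk := integrable_grid_kernel D0 N0.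
have [i1 _] := convolution_bound x mv vM integrable_k.
have [i2 _] := convolution_bound x mv vM igk.
rewrite /convolution -RintegralB//.
have [_] := convolution_bound x mv vM (integrable_EFinB measurableT integrable_k igk).
congr (`| _ | <= _); apply: eq_Rintegral => y _; exact: mulrBr.
Qed.

End kernel_discretisation.

(** * Variation along finite samples *)

Section total_variation_sums.
Context {R : realType}.
Implicit Types (f : R -> R) (p : nat -> R).

Lemma sum_le_TotVar f p J : (forall j, p j <= p j.+1) ->
  ((\sum_(j < J) `|f (p j.+1) - f (p j)|)%:E <= TotVar f)%E.
Proof.
move=> pS; have p0J j : p 0%N <= p j by elim: j => // j IH; exact: le_trans (pS j).
apply: (@le_trans _ _ (total_variation (p 0%N) (p J) f)); last first.
  by apply: ereal_sup_ubound; exists (p 0%N, p J) => /=.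
elim: J => [|J IH]; first by rewrite big_ord0 total_variationxx.
rewrite big_ord_recr/= EFinD (total_variationD f (p0J J) (pS J)); apply: leeD => //.
exact: total_variation_ge.
Qed.

Lemma TotVar_le f (B : R) :
  (forall p J, (forall j, (j < J)%N -> p j <= p j.+1) ->
    \sum_(j < J) `|f (p j.+1) - f (p j)| <= B) ->
  (TotVar f <= B%:E)%E.
Proof.
move=> fB; apply: ge_ereal_sup => _ [[a b]/= ab <-].
apply: ge_ereal_sup => _ [_ [s [ps _] <-] <-].
rewrite lee_fin /variation big_mkord; apply: fB => j js.
by apply: ltW; have /(pathP b)/(_ j js) := ps.
Qed.

(** Indices that coincide contribute nothing; the other differences telescope over disjoint
    ranges. *)
Lemma sum_monotone_indices (a : nat -> R) (i : nat -> nat) J :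
  (forall j, (j < J)%N -> (i j <= i j.+1)%N) ->
  \sum_(j < J) `|a (i j.+1) - a (i j)| <= \sum_(m < i J) `|a m.+1 - a m|.
Proof.
elim: J => [|J IH] iS; first by rewrite big_ord0; exact: sumr_ge0.
rewrite big_ord_recr/=; have {}IH := IH (fun j jJ => iS j (ltnW jJ)).
rewrite -!(big_mkord xpredT (fun m => `|a m.+1 - a m|)).
rewrite (big_cat_nat (leq0n (i J)) (iS J (ltnSn J)))/= big_mkord; apply: lerD => //.
rewrite -(telescope_sumr a (iS J (ltnSn J))); exact: ler_norm_sum.
Qed.

End total_variation_sums.

(** * Total variation of the initial averages *)

Section initial_datum.
Context {R : realType}.
Notation mu := (@lebesgue_measure R).
Variables (u0 g : R -> R) (T : R).
Hypothesis measurable_u0 : measurable_fun setT u0.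
Hypothesis u0_01 : forall x, 0 <= u0 x <= 1.
Hypothesis u0_g : {ae mu, forall x, u0 x = g x}.
Hypothesis g_TotVar : (TotVar g <= T%:E)%E.

Let u0_le x : `|u0 x| <= 1.
Proof. by have /andP[? ?] := u0_01 x; rewrite ger0_norm. Qed.

Let T_ge0 : 0 <= T.
Proof.
rewrite -lee_fin; apply: le_trans g_TotVar.
by have := @sum_le_TotVar _ g (fun=> 0) 0 (fun=> lexx _); rewrite big_ord0.
Qed.

(** After reflection the translations act on [u0], so the sum is bounded under the integral by the
    variation of [g]. For almost every [w] all the points [p j - w] avoid the null set where [u0]
    and [g] differ. *)
Lemma convolution_TotVar (q : R -> R) (p : nat -> R) J : mu.-integrable setT (EFin \o q) ->
  (forall j, p j <= p j.+1) ->
  \sum_(j < J) `|convolution u0 q (p j.+1) - convolution u0 q (p j)| <=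
  T * \int[mu]_w `|q w|.
Proof.
move=> qi pS.
have iaq : mu.-integrable setT (EFin \o (fun w => `|q w|)) by exact: integrable_norm.
have reflE z : mu.-integrable setT (EFin \o (fun w : R => u0 (z - w) * q w)) /\
    convolution u0 q z = \int[mu]_w (u0 (z - w) * q w).
  have [i _] := convolution_bound z measurable_u0 u0_le qi.
  have [ri rE] := Rintegral_reflect z i.
  have fE (w : R) : u0 (z - w) * q w = u0 (z - w) * q (z - (z - w)) by rewrite subKr.
  split; last by rewrite /convolution -rE; apply: eq_Rintegral => w _; rewrite fE.
  by apply: (eq_integrable measurableT _ _ _ ri) => w _; rewrite /= fE.
pose df j w := (u0 (p j.+1 - w) - u0 (p j - w)) * q w.
have idf' j : mu.-integrable setT (EFin \o df j).
  apply: (eq_integrable measurableT _ _ _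
    (integrable_EFinB measurableT (reflE (p j.+1)).1 (reflE (p j)).1)).
  by move=> w _; rewrite /= /df mulrBl.
have idf j : mu.-integrable setT (EFin \o (fun w => `|df j w|)) by exact: integrable_norm.
have [iS sE] := Rintegral_sum_ord J idf.
apply: (@le_trans _ _ (\sum_(j < J) \int[mu]_w `|df j w|)).
  apply: ler_sum => j _; rewrite (reflE (p j.+1)).2 (reflE (p j)).2 -RintegralB//;
    try exact: (reflE _).1.
  under eq_Rintegral do rewrite -mulrBl.
  exact: (le_normr_Rintegral measurableT (idf' j)).
rewrite -sE -RintegralZl//.
have TI : mu.-integrable setT (EFin \o (fun w => T * `|q w|)) by exact: integrable_EFinZl.
have le_ae : {ae mu, forall w, \sum_(j < J) `|df j w| <= T * `|q w|}.
  have all_j : {ae mu, forall w, forall j, u0 (p j - w) = g (p j - w)}.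
    by apply: ae_foralln => j; exact: (ae_reflect (p j) u0_g).
  apply: ae_impl all_j => w ug.
  have -> : \sum_(j < J) `|df j w| = (\sum_(j < J) `|g (p j.+1 - w) - g (p j - w)|) * `|q w|.
    by rewrite mulr_suml; apply: eq_bigr => j _; rewrite /df !ug normrM.
  rewrite ler_wpM2r//; rewrite -lee_fin; apply: le_trans g_TotVar.
  by apply: (@sum_le_TotVar _ g (fun j => p j - w)) => j; rewrite lerD2r.
rewrite /Rintegral; apply: fine_le.
- exact: integrable_fin_num iS.
- exact: integrable_fin_num TI.
- apply: ae_ge0_le_integral => //.
  + by move=> w _; rewrite lee_fin; exact: sumr_ge0.
  + exact: measurable_int iS.
  + by move=> w _; rewrite lee_fin mulr_ge0.
  + exact: measurable_int TI.
  + by apply: ae_impl le_ae => w h _; rewrite lee_fin.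
Qed.

Lemma initial_potentialB x z :
  initial_potential u0 z - initial_potential u0 x =
  \int[mu]_y (u0 y * (heaviside x y - heaviside z y)).
Proof.
have i a : mu.-integrable setT (EFin \o (fun y => u0 y * (heaviside 0 y - heaviside a y))).
  exact: integrable_heaviside.
rewrite /initial_potential -RintegralB//; apply: eq_Rintegral => y _.
by rewrite -mulrBr opprB addrC addrA subrK.
Qed.

Section initial_invariant.
Variables (k : R -> R) (T0 : R).
Hypothesis k_ge0 : forall w, w < 0 -> 0 <= k w.
Hypothesis k_mono : forall x y, x <= y -> y < 0 -> k x <= k y.
Hypothesis integrable_k : mu.-integrable setT (EFin \o k).
Hypothesis conv_TotVar : (TotVar (convolution u0 k) <= T0%:E)%E.
Variables (D : R) (N : nat).
Hypothesis D_gt0 : 0 < D.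
Hypothesis N_gt0 : (0 < N)%N.

Lemma discrete_conv_initial x :
  discrete_conv N (grid_slope k D N) D (initial_potential u0) x =
  convolution u0 (grid_kernel k D N) x.
Proof.
rewrite (grid_kernel_conv _ x D_gt0 N_gt0 measurable_u0 u0_le).
by apply: eq_bigr => m _; rewrite initial_potentialB.
Qed.

(** The staircase average is the exact one minus the convolution of [u0] with the kernel error. The
    first has variation at most [T0]; that of the second is small because [u0] has bounded variation
    and the kernel error is small in [L^1]. *)
Lemma initial_invariant :
  scheme_invariant N (grid_slope k D N) D (\int[mu]_w `|k w|)
    (T0 + T * \int[mu]_w `|k w - grid_kernel k D N w|) (initial_potential u0).
Proof.
have igk : mu.-integrable setT (EFin \o grid_kernel k D N).
  exact: integrable_grid_kernel.
have iak : mu.-integrable setT (EFin \o (fun w => `|k w|)) by exact: integrable_norm.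
split.
- move=> x; rewrite -subr_ge0 initial_potentialB; apply: Rintegral_ge0 => // y _.
  have /andP[u00 _] := u0_01 y; rewrite mulr_ge0// subr_ge0 /heaviside ler_nat.
  by have [h|h] := ltP (x + D) y => //; rewrite (lt_trans _ h)// ltrDl.
- move=> x; rewrite discrete_conv_initial.
  have [_] := convolution_bound x measurable_u0 u0_le igk.
  rewrite mul1r => /(le_trans (ler_norm _))/le_trans; apply.
  apply: le_Rintegral => //; first exact: integrable_norm.
  by move=> w _; exact: (grid_kernel_norm_le k_ge0 k_mono).
- move=> x J.
  have pS j : x + j%:R * D <= x + j.+1%:R * D.
    by rewrite lerD2l ler_wpM2r ?ler_nat// ltW.
  have convB z : convolution u0 (grid_kernel k D N) z = convolution u0 k z -
      convolution u0 (fun w => k w - grid_kernel k D N w) z.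
    have [i1 _] := convolution_bound z measurable_u0 u0_le integrable_k.
    have [i2 _] := convolution_bound z measurable_u0 u0_le igk.
    have -> : convolution u0 (fun w => k w - grid_kernel k D N w) z =
        convolution u0 k z - convolution u0 (grid_kernel k D N) z.
      by rewrite /convolution -RintegralB//; apply: eq_Rintegral => y _; exact: mulrBr.
    by rewrite opprB addrC subrK.
  under eq_bigr do rewrite !discrete_conv_initial !convB subrACA.
  apply: (@le_trans _ _ (\sum_(j < J) `|convolution u0 k (x + j.+1%:R * D) - convolution u0 k (x + j%:R * D)|
    + \sum_(j < J) `|convolution u0 (fun w => k w - grid_kernel k D N w) (x + j.+1%:R * D)
      - convolution u0 (fun w => k w - grid_kernel k D N w) (x + j%:R * D)|)).
    by rewrite -big_split; apply: ler_sum => j _; exact: ler_normB.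
  apply: lerD.
    by rewrite -lee_fin; apply: le_trans conv_TotVar; exact: (@sum_le_TotVar _ _ (fun j => x + j%:R * D)).
  apply: (@convolution_TotVar _ (fun j => x + j%:R * D)) => //.
  exact: integrable_EFinB.
Qed.

End initial_invariant.

End initial_datum.

Lemma dist_perturb {R : realDomainType} (x y x' y' e : R) :
  `|x - x'| <= e -> `|y - y'| <= e -> `|x - y| <= `|x' - y'| + 2 * e.
Proof.
move=> xx yy; have -> : x - y = (x - x') + (x' - y') + (y' - y) by ring.
have := ler_normD (x - x' + (x' - y')) (y' - y); have := ler_normD (x - x') (x' - y').
by rewrite (distrC y' y); lra.
Qed.

Lemma lipschitz_bound_continuous {R : realType} (V : R -> R) (L : R) :
  (forall x y, `|V x - V y| <= L * `|x - y|) -> continuous V.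
Proof.
move=> V_lip; have L_ge0 : 0 <= L.
  by have := V_lip 1 0; rewrite subr0 normr1 mulr1; apply: le_trans.
move=> x; apply/cvgrPdist_le => e e0.
apply/nbhs_ballP; exists (e / (L + 1)) => /=; first by rewrite divr_gt0// ltr_wpDl.
move=> y; rewrite /ball/= => /ltW xy; apply: (le_trans (V_lip x y)).
apply: (@le_trans _ _ ((L + 1) * (e / (L + 1)))).
  by rewrite ler_pM// lerDl.
by rewrite mulrC divfK// lt0r_neq0// ltr_wpDl.
Qed.

Lemma measurable_nonlocal_speed {R : realType} (u : R -> R -> R) (k V : R -> R) :
  measurable_fun setT (fun z : R * R => u z.1 z.2) -> measurable_fun setT k ->
  continuous V -> measurable_fun setT (fun z : R * R => V (convolution (u z.1) k z.2)).
Proof.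
move=> measurable_u measurable_k V_continuous.
apply: measurableT_comp; first exact: continuous_measurable_fun.
apply: (@measurable_Rintegral_slice _ _ _
  (fun z : (R * R) * R => u z.1.1 z.2 * k (z.1.2 - z.2))).
apply: measurable_funM.
  have m11 : measurable_fun setT (fun z : (R * R) * R => z.1.1).
    exact: measurableT_comp measurable_fst measurable_fst.
  have mp : measurable_fun setT (fun z : (R * R) * R => (z.1.1, z.2)).
    exact: (measurable_fun_pair m11 measurable_snd).
  exact: (measurableT_comp measurable_u mp).
apply: measurableT_comp => //.
apply: measurable_funB => //; exact: measurableT_comp measurable_snd measurable_fst.
Qed.

(** * Passage to the limit for regular data *)

Section regular_data.
Context {R : realType}.
Notation mu := (@lebesgue_measure R).
Variables (V k u0 g : R -> R) (u : R -> R -> R) (L M Kb T : R).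
Hypothesis V_lip : forall x y, `|V x - V y| <= L * `|x - y|.
Hypothesis V_nonincr : forall x y, x <= y -> V y <= V x.
Hypothesis measurable_u : measurable_fun setT (fun z : R * R => u z.1 z.2).
Hypothesis u_le : forall t x, `|u t x| <= M.
Hypothesis M_ge1 : 1 <= M.
Hypothesis measurable_u0 : measurable_fun setT u0.
Hypothesis u0_01 : forall x, 0 <= u0 x <= 1.
Hypothesis u0_g : {ae mu, forall x, u0 x = g x}.
Hypothesis g_TotVar : (TotVar g <= T%:E)%E.
Hypothesis k_ge0 : forall w, w < 0 -> 0 <= k w.
Hypothesis k_le : forall w, w < 0 -> k w <= Kb.
Hypothesis k_mono : forall x y, x <= y -> y < 0 -> k x <= k y.
Hypothesis k_convex : forall x y l, x < 0 -> y < 0 -> 0 <= l <= 1 ->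
  k ((1 - l) * x + l * y) <= (1 - l) * k x + l * k y.
Hypothesis integrable_k : mu.-integrable setT (EFin \o k).
Hypothesis k_supp : {ae mu, forall w, 0 < w -> k w = 0}.
Let a t x := V (convolution (u t) k x).
Hypothesis weak : tensor_solution u a u0.

Let W := \int[mu]_w `|k w|.

Let measurable_us s : measurable_fun setT (u s).
Proof. exact: (measurable_fun_pair2 s measurable_u). Qed.

Let L_ge0 : 0 <= L.
Proof. by have := V_lip 1 0; rewrite subr0 normr1 mulr1; apply: le_trans. Qed.

Let measurable_a : measurable_fun setT (fun z : R * R => a z.1 z.2).
Proof.
apply: (measurable_nonlocal_speed measurable_u _ (lipschitz_bound_continuous V_lip)).
by apply/measurable_EFinP; exact: measurable_int integrable_k.
Qed.

Let a_le t x : `|a t x| <= `|V 0| + L * (M * W).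
Proof.
have [_ h] := convolution_bound x (measurable_us t) (u_le t) integrable_k.
rewrite -(subrK (V 0) (a t x)) addrC; apply: (le_trans (ler_normD _ _)); rewrite lerD2l.
by apply: (le_trans (V_lip _ _)); rewrite ler_wpM2l// subr0.
Qed.

(** For a fixed finite partition [p] and tolerance [e], the scales are chosen so that each [p j] is
    near a grid node where the discrete average is close to the exact one. *)
Lemma conv_TotVar_decreases : {ae mu, forall t, 0 < t ->
  (TotVar (convolution (u t) k) <= TotVar (convolution u0 k))%E}.
Proof.
have [H [C stepH]] := @ex_smooth_step R.
have u0_le x : `|u0 x| <= M.
  by have /andP[? ?] := u0_01 x; rewrite ger0_norm// (le_trans _ M_ge1).
(* One null set serves all the scales [delta = 1 / m.+1], so that [delta] can be chosen after
   [t]. *)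
have good : {ae mu, forall t, forall m : nat, 0 < t ->
    slice_identity H m.+1%:R^-1 u a u0 t}.
  apply: ae_foralln => m.
  by apply: (potential_ae stepH _ measurable_u measurable_a measurable_u0 u_le a_le u0_le weak).
apply: ae_impl good => t t_good t0; have {}t_good m := t_good m t0.
have [->|finTV] := eqVneq (TotVar (convolution u0 k)) +oo%E; first by rewrite leey.
pose T0 := fine (TotVar (convolution u0 k)).
have T0E : TotVar (convolution u0 k) = T0%:E.
  rewrite /T0 fineK// ge0_fin_numE ?ltey//.
  by have := @sum_le_TotVar _ (convolution u0 k) (fun=> 0) 0 (fun=> lexx _); rewrite big_ord0.
rewrite T0E; apply: TotVar_le => p J pS.
apply/ler_addgt0Pl => e e0; rewrite addrC.
have W_ge0 : 0 <= W by apply: Rintegral_ge0.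
have T_ge0 : 0 <= T.
  rewrite -lee_fin; apply: le_trans g_TotVar.
  by have := @sum_le_TotVar _ g (fun=> 0) 0 (fun=> lexx _); rewrite big_ord0.
(* [W] bounds the discrete averages, and subtracting [c = V W] makes the relative speed nonnegative
   below it; the [+ 1] covers the case [L * W = 0]. *)
pose c := V W; pose lam := (2 * L * W + 1)^-1.
have lamV : 0 < 2 * L * W + 1 by rewrite ltr_wpDl// !mulr_ge0.
have lam0 : 0 < lam by rewrite invr_gt0.
have cfl : 2 * lam * L * W <= 1.
  have -> : 2 * lam * L * W = lam * (2 * L * W) by ring.
  by rewrite ler_pdivrMl// mulr1 lerDl.
pose P := `|scheme_const M (`|V 0| + L * (M * W)) L C lam c Kb t|.
have P_ge0 : 0 <= P by exact: normr_ge0.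
(* [Q] collects the coefficients of [e'] in the final bound: [T] from the initial variation and
   [2 * Err] for each of the [J] increments. *)
pose Q := T + 2 * J%:R * (P * (M + 2)) + 1.
have M_ge0 : 0 <= M by exact: le_trans M_ge1.
have Q_gt0 : 0 < Q.
  by rewrite ltr_wpDl// addr_ge0// !mulr_ge0// addr_ge0.
pose e' := e / Q; have e'0 : 0 < e' by rewrite divr_gt0.
have [m delta_le] : exists m : nat, m.+1%:R^-1 <= e'.
  exists (Num.truncn e'^-1); rewrite -[leRHS]invrK lef_pV2 ?posrE ?invr_gt0//.
  exact/ltW/truncnS_gt.
pose delta : R := m.+1%:R^-1; have delta0 : 0 < delta by rewrite invr_gt0.
(* With cells of width [D0 / n.+1], the time [t] is exactly that of step [n.+1]. *)
pose D0 := t / lam; have D00 : 0 < D0 by rewrite divr_gt0.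
have [n0 kappa_le] := grid_kernel_L1 k_ge0 k_le k_mono k_convex integrable_k k_supp D00 e'0.
have [n [n0n [Dd [hd De]]]] : exists n : nat, (n0 <= n)%N /\
    D0 / n.+1%:R <= delta /\ `|c| * (lam * (D0 / n.+1%:R)) <= delta /\
    D0 / n.+1%:R / delta <= e'.
  pose r := Num.min delta (Num.min (delta / (`|c| * lam + 1)) (delta * e')).
  have den : 0 < `|c| * lam + 1 by rewrite ltr_wpDl// mulr_ge0// ltW.
  have r0 : 0 < r by rewrite !lt_min delta0 divr_gt0//= mulr_gt0.
  exists (maxn n0 (Num.truncn (D0 / r))); rewrite leq_maxl; split=> //.
  have Dr : D0 / (maxn n0 (Num.truncn (D0 / r))).+1%:R <= r.
    rewrite ler_pdivrMr// mulrC -ler_pdivrMr//; apply: le_trans (ltW (truncnS_gt _)) _.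
    by rewrite ler_nat ltnS leq_maxr.
  move: Dr; set d := D0 / _; rewrite !le_min => /and3P[d1 d2 d3]; split=> //; split.
    rewrite mulrA; move: d2; rewrite ler_pdivlMr//.
    have d0 : 0 <= d by rewrite divr_ge0 ?(ltW D00).
    lra.
  by rewrite ler_pdivrMr// mulrC.
pose D := D0 / n.+1%:R; pose N := (n.+1 ^ 2)%N.
have D_gt0 : 0 < D by rewrite divr_gt0.
have N_gt0 : (0 < N)%N by [].
pose kappa := \int[mu]_w `|k w - grid_kernel k D N w|.
have kappa_e : kappa <= e' by exact: kappa_le.
have tE : t = n.+1%:R * (lam * D).
  by rewrite /D /D0; field; rewrite !lt0r_neq0.
pose b w := V w - c.
pose Phi i := iter i (scheme N (grid_slope k D N) D lam b) (initial_potential u0).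
have b_lip x y : `|b x - b y| <= L * `|x - y|.
  by rewrite /b opprB addrA subrK.
have b_nonincr x y : x <= y -> b y <= b x by move=> xy; rewrite lerD2r V_nonincr.
have bW : b W = 0 by rewrite /b subrr.
have inv i : scheme_invariant N (grid_slope k D N) D W (T0 + T * kappa) (Phi i).
  elim: i => [|i IH].
    have tv0 : (TotVar (convolution u0 k) <= T0%:E)%E by rewrite T0E.
    exact: (initial_invariant measurable_u0 u0_01 u0_g g_TotVar k_ge0 k_mono integrable_k tv0 D_gt0 N_gt0).
  rewrite /Phi iterS; apply: (scheme_preserves (ltW lam0) _ _ b_lip b_nonincr bW cfl IH).
  - exact: grid_slope_nonincr.
  - exact: grid_slopeN.
have speed i x : 0 <= lam * b (discrete_conv N (grid_slope k D N) D (Phi i) x) <= 1.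
  apply: (scheme_speed (ltW lam0) _ _ b_lip b_nonincr bW cfl _ (inv i)).
  - exact: grid_slope_nonincr.
  - exact: grid_slopeN.
(* The nodes start at [p 0 - c * t], which the frame carries to [p 0] at time [t]; [i j] numbers the
   cell that contains [p j]. *)
pose A (i : nat) := discrete_conv N (grid_slope k D N) D (Phi n.+1) (p 0%N - c * t + i%:R * D).
pose i j := Num.truncn ((p j - p 0%N) / D).
pose Err := P * ((M + 2) * e').
have p0 j : (j <= J)%N -> p 0%N <= p j.
  elim: j => // j IH jJ; exact: le_trans (IH (ltnW jJ)) (pS j jJ).
have close j : (j <= J)%N -> `|convolution (u t) k (p j) - A (i j)| <= Err.
  move=> jJ; have pj0 : 0 <= (p j - p 0%N) / D.
    by rewrite divr_ge0 ?(ltW D_gt0)// subr_ge0 p0.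
  have ids : slice_identity H delta u a u0 (n.+1%:R * (lam * D)) by rewrite -tE; exact: t_good.
  have yx : `|p j - (p 0%N - c * t + (i j)%:R * D + c * (n.+1%:R * (lam * D)))| <= delta.
    rewrite -tE; have /andP[] := truncn_itv pj0; rewrite -/(i j) -natr1 ler_pdivlMr// ltr_pdivrMr//.
    by rewrite ler_norml; have := Dd; rewrite -/D; lra.
  have d_ge0 m' : (m' < N)%N -> 0 <= grid_slope k D N m'.
    by move=> _; exact: grid_slope_ge0.
  have kc (v : R -> R) x : measurable_fun setT v -> (forall y, `|v y| <= M) ->
      `|convolution v k x - \sum_(m < N) grid_slope k D N m *
        \int[mu]_y (v y * (heaviside x y - heaviside (x + m.+1%:R * D) y))| <= M * kappa.
    by move=> mv vM; exact: grid_kernel_close.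
  have := conv_scheme_error stepH delta0 measurable_u measurable_a measurable_u0 u_le a_le
    u0_le weak V_lip D_gt0 lam0 Dd hd d_ge0 (sum_grid_slope_le k_ge0 k_le D_gt0 N_gt0) kc speed ids yx.
  rewrite /= -tE => /le_trans; apply.
  have pos : 0 <= M * kappa + delta + D / delta.
    have kappa_ge0 : 0 <= kappa by exact: Rintegral_ge0.
    exact: (addr_ge0 (addr_ge0 (mulr_ge0 M_ge0 kappa_ge0) (ltW delta0))
      (divr_ge0 (ltW D_gt0) (ltW delta0))).
  apply: (@le_trans _ _ (P * (M * kappa + delta + D / delta))).
    by rewrite ler_wpM2r// ler_norm.
  rewrite ler_wpM2l//; have : M * kappa <= M * e' by rewrite ler_wpM2l.
  by have := De; rewrite -/D; move: delta_le; rewrite -/delta; lra.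
have iS j : (j < J)%N -> (i j <= i j.+1)%N.
  by move=> jJ; apply: le_truncn; rewrite ler_wpM2r ?invr_ge0 ?(ltW D_gt0)// lerD2r pS.
have [_ _ tvA] := inv n.+1.
have sumA : \sum_(j < J) `|A (i j.+1) - A (i j)| <= T0 + T * kappa.
  apply: le_trans (sum_monotone_indices A iS) _.
  exact: tvA.
apply: (@le_trans _ _ (\sum_(j < J) (`|A (i j.+1) - A (i j)| + 2 * Err))).
  apply: ler_sum => -[j jJ] _ /=.
  exact: dist_perturb (close _ jJ) (close _ (ltnW jJ)).
rewrite big_split/= sumr_const card_ord -mulr_natl.
apply: (le_trans (lerD sumA (lexx _))).
rewrite -addrA lerD2l.
have -> : e = Q * e' by rewrite mulrC divfK// lt0r_neq0.
have : T * kappa <= T * e' by rewrite ler_wpM2l.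
rewrite /Err /Q; move: (e'0); lra.
Qed.

End regular_data.

(** * Reduction to regular data *)

Section monotonicity_from_derivative.
Context {R : realType}.
Notation mu := (@lebesgue_measure R).

Lemma le_lebesgue_measure (A B : set R) : measurable A -> measurable B -> A `<=` B ->
  (mu A <= mu B)%E.
Proof. by move=> mA mB AB; apply: le_measure; rewrite ?inE. Qed.

(* A Lipschitz function grows by at most [e * h] on short intervals [x, x + h] where its
   derivative is nonpositive, and by at most [L * h] inside an open set of small measure
   covering the exceptional points. *)
Lemma lipschitz_nonincreasing (V : R -> R) (L : R) : (forall x y, `|V x - V y| <= L * `|x - y|) ->
  {ae mu, forall x, derivable V x 1 /\ derive1 V x <= 0} ->
  forall a b, a <= b -> V b <= V a.
Proof.
move=> V_lip [E [mE E0 V_dec]] a b ab.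
have L_ge0 : 0 <= L.
  by have := V_lip 1 0; rewrite subr0 normr1 mulr1; apply: le_trans.
apply/ler_addgt0Pl => e0 e00.
(* Chosen so that the total growth [e * (b - a) + L * e] stays below [e0]. *)
pose e := e0 / (b - a + L + 1).
have den : 0 < b - a + L + 1 by lra.
have e_gt0 : 0 < e by rewrite divr_gt0.
have [U [oU EU mU]] : exists U : set R, [/\ open U, E `<=` U & (mu U <= e%:E)%E].
  have [|U [oU EU mUE]] := @lebesgue_regularity_outer R E e mE _ e_gt0.
    by move: E0; rewrite /= => ->.
  exists U; split=> //; have mU := open_measurable oU.
  have -> : (mu U = mu (U `\` E) + mu (U `&` E))%E by exact: measureDI.
  rewrite (_ : mu (U `&` E) = 0)%E ?adde0; first exact: ltW.
  by apply/eqP; rewrite -measure_le0 -[leRHS]E0 le_measure ?inE//; exact: measurableI.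
have mU_meas : measurable U by exact: open_measurable.
pose m x := fine (mu (U `&` `[a, x])).
have mI x : measurable (U `&` `[a, x]) by exact: measurableI.
have mI_le x : (mu (U `&` `[a, x]) <= e%:E)%E.
  apply: le_trans mU; apply: le_lebesgue_measure => //; exact: subIsetl.
have mI_fin x : mu (U `&` `[a, x]) \is a fin_num.
  by rewrite ge0_fin_numE// (le_lt_trans (mI_le x))// ltry.
have m_ge0 x : 0 <= m x by exact: fine_ge0.
have m_le x y : x <= y -> m x <= m y.
  move=> xy; apply: fine_le => //; apply: le_lebesgue_measure => //.
  by apply: setIS; apply: subset_itvl; rewrite bnd_simp.
have m_e x : m x <= e by rewrite -lee_fin fineK.
have m_add x h : a <= x -> 0 <= h -> `]x, x + h]%classic `<=` U -> m x + h <= m (x + h).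
  move=> ax h0 hU; rewrite -lee_fin EFinD !fineK//.
  pose I : set R := `]x, x + h]%classic.
  have -> : h%:E = mu I.
    rewrite /I lebesgue_measure_itv/= lte_fin ltrDl; case: ltP h0 => [_ _|h1 h2].
      by rewrite -EFinB addrAC subrr add0r.
    by congr EFin; lra.
  have mxh : measurable I by exact: measurable_itv.
  have disj : (U `&` `[a, x]) `&` I = set0.
    rewrite -subset0 => y [[_]]; rewrite /I /= !in_itv/=; lra.
  have <- : (mu (U `&` `[a, x] `|` I) = mu (U `&` `[a, x]) + mu I)%E.
    by exact: (measureU mu (mI x) mxh disj).
  apply: le_lebesgue_measure => //; first exact: measurableU.
  move=> y [[Uy ay]|Iy]; split=> //.
  - by move: ay; rewrite /= !in_itv/=; lra.
  - exact: hU.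
  - by move: Iy; rewrite /I /= !in_itv/=; lra.
(* Continuous induction from [a]: the supremum of [S] belongs to [S], and can be pushed further to
   the right unless it is [b]. *)
pose S := [set x | a <= x <= b /\ V x - V a <= e * (x - a) + L * m x].
have Sa : S a.
  by split; rewrite ?lexx// !subrr mulr0 add0r mulr_ge0.
have Sb : has_ubound S by exists b => x [/andP[]].
pose s := sup S.
have supS : has_sup S by split; [exists a|].
have S_s x : S x -> x <= s by move=> Sx; exact: ub_le_sup.
have sS : S s.
  split; first by rewrite S_s//= ge_sup//; [exists a|move=> x [/andP[]]].
  apply/ler_addgt0Pl => r r0.
  have rL : 0 < r / (L + 1) by rewrite divr_gt0// ltr_wpDl.
  have [x Sx xs] := sup_adherent rL supS; have xs' := S_s x Sx.
  have [/andP[ax xb] Vx] := Sx.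
  have Vsx := V_lip s x.
  have : L * `|s - x| <= r.
    rewrite ger0_norm ?subr_ge0//; apply: (@le_trans _ _ ((L + 1) * (r / (L + 1)))).
      by rewrite ler_pM ?subr_ge0// ?lerDl//; rewrite -/s in xs; lra.
    by rewrite mulrC divfK// lt0r_neq0// ltr_wpDl.
  have : L * m x <= L * m s by rewrite ler_wpM2l// m_le.
  have : e * (x - a) <= e * (s - a) by rewrite ler_wpM2l ?(ltW e_gt0)//; lra.
  by move: Vsx; rewrite ler_norml; lra.
have [/andP[as_ sb] Vs] := sS.
have sE : s = b.
  apply/eqP; rewrite eq_le sb /= leNgt; apply/negP => s_lt_b.
  suff [h [h0 Sh]] : exists h, 0 < h /\ S (s + h) by have := S_s _ Sh; lra.
  have [sU|nsU] := pselect (U s).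
    have [r /= r0 rU] : exists2 r : R, 0 < r & ball s r `<=` U.
      by apply/nbhs_ballP; exact: open_nbhs_nbhs.
    pose h := Num.min (r / 2) (b - s).
    have h0 : 0 < h by rewrite lt_min; apply/andP; split; lra.
    have hr : h <= r / 2 by rewrite ge_min lexx.
    have hb : h <= b - s by rewrite ge_min lexx orbT.
    exists h; split=> //; split; first lra.
    have mh : m s + h <= m (s + h).
      apply: m_add; [lra|exact: ltW|move=> y; rewrite /= in_itv/= => /andP[y1 y2]].
      by apply: rU; rewrite /ball/= ltr_norml; lra.
    have Vh := V_lip (s + h) s; rewrite addrAC subrr add0r (gtr0_norm h0) in Vh.
    have : L * (m s + h) <= L * m (s + h) by rewrite ler_wpM2l.
    have : 0 <= e * h by rewrite mulr_ge0// ltW.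
    by move: Vh; rewrite ler_norml; lra.
  have [dV V'0] : derivable V s 1 /\ derive1 V s <= 0.
    by apply: contrapT => nV; apply: nsU; apply: EU; apply: V_dec.
  have [r r0 rV] : exists2 r : R, 0 < r &
      forall h, h != 0 -> `|h| < r -> `|derive1 V s - h^-1 * (V (h + s) - V s)| <= e.
    have c : (fun h : R => h^-1 *: (V (h + s) - V s)) @ 0^' --> derive1 V s.
      move: dV; rewrite /derivable /derive1.
      have -> // : (fun h : R => h^-1 *: ((V \o shift s) (h *: (1 : R)) - V s)) =
                (fun h : R => h^-1 *: (V (h + s) - V s)).
      by apply/funext => h; rewrite /= [h%:A]mulr1.
    move/cvgrPdist_le/(_ e e_gt0) : c; rewrite near_withinE => /nbhs_ballP[r /= r0 hr].
    exists r => // h h0 hlt; apply: hr => //.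
    by rewrite /ball/= sub0r normrN.
  pose h := Num.min (r / 2) (b - s).
  have h0 : 0 < h by rewrite lt_min; apply/andP; split; lra.
  have hr : h <= r / 2 by rewrite ge_min lexx.
  have hb : h <= b - s by rewrite ge_min lexx orbT.
  exists h; split=> //; split; first lra.
  have := rV h (lt0r_neq0 h0); rewrite (gtr0_norm h0) (addrC h s) => /(_ ltac:(lra)).
  rewrite ler_norml => /andP[q1 _].
  have : h^-1 * (V (s + h) - V s) <= e by lra.
  rewrite ler_pdivrMl// => Vh.
  have : L * m s <= L * m (s + h) by rewrite ler_wpM2l// m_le// lerDl ltW.
  lra.
rewrite sE in Vs; have : L * m b <= L * e by rewrite ler_wpM2l.
have : e0 = e * (b - a + L + 1) by rewrite divfK// lt0r_neq0.
by move: e_gt0; lra.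
Qed.

End monotonicity_from_derivative.

Lemma Linfty_bounded d (T : measurableType d) (R : realType) (m : {measure set T -> \bar R})
    (f : T -> R) : f \in Lfun m +oo%E ->
  measurable_fun setT f /\ exists B : R, {ae m, forall x, `|f x| <= B}.
Proof.
move=> fL; split; first by have := sub_Lfun_mfun fL; rewrite inE.
have := sub_Lfun_finLfun fL; rewrite inE/= /finite_norm unlock.
case: ifPn => [_|mT _]; last first.
  exists 0, setT; split=> //; apply/eqP; rewrite -measure_le0.
  by rewrite leNgt.
case E : (ess_sup m (abse \o (EFin \o f))) => [B| |] // _.
  by exists B; apply: ae_impl (ess_sup_ge m (abse \o (EFin \o f))) => x; rewrite E.
exists 0; apply: ae_impl (ess_sup_ge m (abse \o (EFin \o f))) => x; rewrite E.
by rewrite /= leeNy_eq.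
Qed.

(** * Pointwise properties of the rescaled kernel *)

Section rescaled_kernel.
Context {R : realType}.
Notation mu := (@lebesgue_measure R).

(** Serves to turn almost-everywhere bounds on a monotone function into bounds at every point, by
    comparison with a good point on the left for a lower bound and on the right for an upper one. *)
Lemma ae_exists_itv (P : R -> Prop) (a b : R) : a < b -> {ae mu, forall x, P x} ->
  exists2 x, a < x < b & P x.
Proof.
move=> ab [N [mN N0 PN]]; apply: contrapT => nex.
have IN : `]a, b[%classic `<=` (N : set R).
  move=> x; rewrite /= in_itv/= => xab; apply: PN => /= Px; apply: nex.
  by exists x.
have := le_lebesgue_measure (measurable_itv _) mN IN.
have -> : mu N = 0%E by exact: N0.
rewrite lebesgue_measure_itv/= lte_fin ab -EFinB lee_fin; lra.
Qed.

Lemma ae_affine (c b : R) (P : set R) : 0 < c ->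
  {ae mu, forall y, P y} -> {ae mu, forall y, P (c * y + b)}.
Proof.
move=> c0 [N [mN N0 PN]].
exists ((fun y : R => c * y + b) @^-1` N); split; last by move=> y /= /PN.
- by rewrite -[X in measurable X]setTI; exact: measurable_affine.
- have h := lebesgue_measure_affine b c0 mN.
  by rewrite h (_ : mu N = 0%E)// mule0.
Qed.

Variables (eta : R -> R) (eps : R).
Hypothesis eps_gt0 : 0 < eps.
Hypothesis eta_ge0 : {ae mu, forall x, 0 <= eta x}.
Hypothesis eta_supp : {ae mu, forall x, 0 < x -> eta x = 0}.
Hypothesis eta_nondecr : {in `]-oo, 0[ &, {homo eta : x y / x <= y}}.
Hypothesis eta_convex : convex_function (`]-oo, 0[ : set (R^o)) eta.

Let neg_scale w : w < 0 -> w / eps < 0.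
Proof. by move=> w0; rewrite pmulr_llt0// invr_gt0. Qed.

Let eta_mono x y : x <= y -> y < 0 -> eta x <= eta y.
Proof. by move=> xy y0; apply: eta_nondecr; rewrite // in_itv/=; lra. Qed.

Lemma rescale_ge0 w : w < 0 -> 0 <= rescale eta eps w.
Proof.
move=> /neg_scale w0; rewrite mulr_ge0 ?invr_ge0 ?(ltW eps_gt0)//.
have [|y /andP[_ yw] y0] := @ae_exists_itv _ (w / eps - 1) (w / eps) _ eta_ge0; first lra.
exact: (le_trans y0 (eta_mono (ltW yw) w0)).
Qed.

Lemma rescale_le (B : R) : {ae mu, forall x, `|eta x| <= B} ->
  forall w, w < 0 -> rescale eta eps w <= eps^-1 * B.
Proof.
move=> etaB w /neg_scale w0; rewrite ler_wpM2l ?invr_ge0 ?(ltW eps_gt0)//.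
have [y /andP[wy y0] yB] := ae_exists_itv w0 etaB.
by apply: (le_trans (eta_mono (ltW wy) y0)); apply: le_trans (ler_norm _) yB.
Qed.

Lemma rescale_mono x y : x <= y -> y < 0 -> rescale eta eps x <= rescale eta eps y.
Proof.
move=> xy /neg_scale y0; rewrite ler_wpM2l ?invr_ge0 ?(ltW eps_gt0)//.
by apply: eta_mono => //; rewrite ler_wpM2r ?invr_ge0 ?(ltW eps_gt0).
Qed.

Lemma rescale_convex x y l : x < 0 -> y < 0 -> 0 <= l <= 1 ->
  rescale eta eps ((1 - l) * x + l * y) <=
  (1 - l) * rescale eta eps x + l * rescale eta eps y.
Proof.
move=> /neg_scale x0 /neg_scale y0 /andP[l0 l1].
have := eta_convex (Itv01 l0 l1); move=> /(_ (y / eps) (x / eps)).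
rewrite !mem_setE !in_itv/= x0 y0 => /(_ isT isT).
move=> cvx0; have cvx : eta (l * (y / eps) + (1 - l) * (x / eps)) <=
  l * eta (y / eps) + (1 - l) * eta (x / eps) := cvx0.
rewrite /rescale.
have -> : ((1 - l) * x + l * y) / eps = l * (y / eps) + (1 - l) * (x / eps) by ring.
have := ler_wpM2l (_ : 0 <= eps^-1) cvx; rewrite invr_ge0 (ltW eps_gt0) => /(_ isT).
lra.
Qed.

Lemma rescale_supp : {ae mu, forall w, 0 < w -> rescale eta eps w = 0}.
Proof.
have e0 : 0 < eps^-1 by rewrite invr_gt0.
apply: ae_impl (ae_affine 0 e0 eta_supp) => w h w0.
by rewrite /rescale mulrC [w / eps]mulrC -[_ * w]addr0 h ?mul0r// addr0 mulr_gt0.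
Qed.

Lemma integrable_rescale : mu.-integrable setT (EFin \o eta) ->
  mu.-integrable setT (EFin \o rescale eta eps).
Proof.
move=> ei; have e0 : 0 < eps^-1 by rewrite invr_gt0.
have me : measurable_fun setT eta by apply/measurable_EFinP; exact: measurable_int ei.
apply: integrable_EFinZl => //; apply/integrableP; split.
  apply/measurable_EFinP; apply: measurableT_comp => //.
  exact: measurable_funM.
have h := @ge0_integral_affine R eps^-1 0 (fun y => `|(eta y)%:E|)%E e0 _ (fun=> abse_ge0 _).
under eq_integral => w _ do rewrite /= mulrC -[_ * w]addr0.
rewrite h; first last.
  by do 2 apply: measurableT_comp => //.
by apply: lte_mul_pinfty => //; [rewrite lee_fin invr_ge0 ltW|have /integrableP[] := ei].
Qed.

End rescaled_kernel.

(** * Modification on null sets *)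

Section truncation.
Context {R : realType}.
Notation mu := (@lebesgue_measure R).

Definition clip (a b x : R) : R := Num.max a (Num.min b x).

Lemma clip_itv a b x : a <= b -> a <= clip a b x <= b.
Proof. by move=> ab; rewrite le_max lexx/= ge_max ab/= ge_min lexx. Qed.

Lemma clip_id a b x : a <= x <= b -> clip a b x = x.
Proof. by move=> /andP[ax xb]; rewrite /clip (min_idPr xb) (max_idPr ax). Qed.

Lemma measurable_clip d (T : measurableType d) (f : T -> R) a b :
  measurable_fun setT f -> measurable_fun setT (fun x => clip a b (f x)).
Proof. by move=> mf; apply: measurable_maxr => //; exact: measurable_minr. Qed.

Lemma ae_eq_Rintegral (D : set R) (f g : R -> R) : measurable D ->
  measurable_fun D f -> measurable_fun D g -> {ae mu, forall x, D x -> f x = g x} ->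
  \int[mu]_(x in D) f x = \int[mu]_(x in D) g x.
Proof.
move=> mD mf mg fg; congr fine; apply: ae_eq_integral => //; try exact/measurable_EFinP.
by apply: ae_impl fg => x h Dx; rewrite /= h.
Qed.

Lemma ae_prod_section (P : R * R -> Prop) : {ae (mu \x mu)%E, forall z, P z} ->
  {ae mu, forall t, {ae mu, forall x, P (t, x)}}.
Proof.
move=> [N [mN N0 PN]].
have mx : measurable_fun setT (fun t : R => mu (xsection N t)).
  exact: measurable_fun_xsection.
have abs0 : (\int[mu]_t `|mu (xsection N t)| = 0)%E.
  by rewrite -[RHS]N0; apply: eq_integral => t _; rewrite gee0_abs.
have sec0 : {ae mu, forall t : R, setT t -> mu (xsection N t) = 0%E}.
  have [h _] := ae_eq_integral_abs mu measurableT mx.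
  by apply: ae_impl (h abs0) => t.
apply: ae_impl sec0 => t Nt; exists (xsection N t); split.
- exact: measurable_xsection.
- exact: Nt.
- by move=> x nP; rewrite /xsection/= inE; exact: PN.
Qed.

Lemma ae_eq_convolution (v w q : R -> R) x : measurable_fun setT v -> measurable_fun setT w ->
  measurable_fun setT q -> {ae mu, forall y, v y = w y} -> convolution v q x = convolution w q x.
Proof.
move=> mv mw mq vw.
have mr : measurable_fun setT (fun y : R => q (x - y)).
  by apply: measurableT_comp => //; exact: measurable_funB.
apply: ae_eq_Rintegral => //; try exact: measurable_funM.
by apply: ae_impl vw => y -> _.
Qed.

Lemma measurable_weak_density (f : R -> R -> R) (k V theta beta : R -> R) :
  measurable_fun setT (fun z : R * R => f z.1 z.2) -> measurable_fun setT k ->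
  continuous V -> smooth1 theta -> smooth1 beta ->
  let phi t x := theta t * beta x in
  measurable_fun setT (fun z : R * R => f z.1 z.2 *
    (partial_t phi z.1 z.2 + V (convolution (f z.1) k z.2) * partial_x phi z.1 z.2)).
Proof.
move=> mf mk Vc st sb phi.
have [_ st'] := smooth1_is_derive st; have [_ sb'] := smooth1_is_derive sb.
have fst_snd (v w : R -> R) : smooth1 v -> smooth1 w ->
    measurable_fun setT (fun z : R * R => v z.1 * w z.2).
  by move=> sv sw; apply: measurable_funM; apply: measurableT_comp => //; exact: measurable_smooth1.
apply: measurable_funM => //; apply: measurable_funD.
  rewrite (_ : (fun z : R * R => _) = (fun z => derive1 theta z.1 * beta z.2)); first exact: fst_snd.
  by apply/funext => z; rewrite partial_t_tensor.
apply: measurable_funM; first exact: (measurable_nonlocal_speed mf mk Vc).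
rewrite (_ : (fun z : R * R => _) = (fun z => theta z.1 * derive1 beta z.2)); first exact: fst_snd.
by apply/funext => z; rewrite partial_x_tensor.
Qed.

End truncation.

Lemma lipschitz_ex_bound (R : realType) (V : R -> R) : lipschitz V ->
  exists L, forall x y, `|V x - V y| <= L * `|x - y|.
Proof.
case/pinfty_ex_gt0 => L _ h; exists L => x y; exact: (h (x, y)).
Qed.

(* w_eps (t, .) is [convolution (u t) (rescale eta eps)]; at t = 0, where u is
   only prescribed through its initial datum u0, it is
   [convolution u0 (rescale eta eps)]. *)
Theorem theorem2p1 (R : realType) (V u0 eta : R -> R)
  (V_lip : lipschitz V)
  (V_dec : {ae lebesgue_measure, forall x, derivable V x 1 /\ derive1 V x <= 0})
  (u0_Linfty : u0 \in Lfun lebesgue_measure +oo%E)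
  (u0_01 : {ae lebesgue_measure, forall x, 0 <= u0 x <= 1})
  (u0_BV : (ess_TotVar u0 < +oo)%E)
  (eta_L1 : eta \in Lfun lebesgue_measure 1%E)
  (eta_Linfty : eta \in Lfun lebesgue_measure +oo%E)
  (eta_ge0 : {ae lebesgue_measure, forall x, 0 <= eta x})
  (eta_int : \int[lebesgue_measure]_x eta x = 1)
  (eta_supp : {ae lebesgue_measure, forall x, 0 < x -> eta x = 0})
  (eta_nondecr : {in `]-oo, 0[ &, {homo eta : x y / x <= y}})
  (eta_convex : convex_function (`]-oo, 0[ : set (R^o)) eta)
  (eps : R) (eps_gt0 : 0 < eps)
  (u : R -> R -> R) (u_sol : nonlocal_solution V (rescale eta eps) u0 u) :
  {ae lebesgue_measure, forall t, 0 < t ->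
    (TotVar (convolution (u t) (rescale eta eps))
      <= TotVar (convolution u0 (rescale eta eps)))%E}.
Proof.
set k := rescale eta eps in u_sol *.
have [L V_L] := lipschitz_ex_bound V_lip.
have V_nonincr := lipschitz_nonincreasing V_L V_dec.
have V_continuous := lipschitz_bound_continuous V_L.
have [_ [Kb eta_le]] := Linfty_bounded eta_Linfty.
have ieta : lebesgue_measure.-integrable setT (EFin \o eta) by exact/Lfun1_integrable.
have ik := integrable_rescale eps_gt0 ieta.
have mk : measurable_fun setT k by apply/measurable_EFinP; exact: measurable_int ik.
have [measurable_u0 _] := Linfty_bounded u0_Linfty.
(* [conv_TotVar_decreases] asks for bounds at every point, so [u0], and [u] below, are replaced by
   truncated representatives; at almost every time this leaves the convolutions unchanged. *)
pose v0 x := clip 0 1 (u0 x).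
have mv0 : measurable_fun setT v0 by exact: measurable_clip.
have v0_01 x : 0 <= v0 x <= 1 by exact: clip_itv.
have u0_v0 : {ae lebesgue_measure, forall x, u0 x = v0 x}.
  by apply: ae_impl u0_01 => x x01; rewrite /v0 clip_id.
have [T [g v0_g g_T]] : exists T, exists2 g : R -> R,
    {ae lebesgue_measure, forall x, v0 x = g x} & (TotVar g <= T%:E)%E.
  have [_ [g gu0 <-] gT] := ereal_inf_lt u0_BV.
  exists (fine (TotVar g)), g.
    by apply: ae_impl2 u0_v0 gu0 => x -> ->.
  rewrite fineK// ge0_fin_numE//.
  by have := @sum_le_TotVar _ g (fun=> 0) 0 (fun=> lexx _); rewrite big_ord0.
have [uL weak] := u_sol; have [mu_ [B uB]] := Linfty_bounded uL.
(* [u] is controlled only for [t >= 0]; extension by 0 gives a function measurable on the whole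
   plane. *)
pose f t x := ((fun z => u z.1 z.2) \_ half_plane) (t, x).
have fE t : 0 <= t -> f t = u t.
  by move=> t0; apply/funext => x; rewrite /f patchT// inE.
have mf : measurable_fun setT (fun z : R * R => f z.1 z.2).
  have -> // : (fun z : R * R => f z.1 z.2) = (fun z => u z.1 z.2) \_ half_plane.
  by apply/funext => -[].
pose M := 1 + `|B|; pose v t x := clip (- M) M (f t x).
have M_ge1 : 1 <= M by rewrite lerDl.
have mv : measurable_fun setT (fun z : R * R => v z.1 z.2) by exact: measurable_clip.
have v_le t x : `|v t x| <= M by rewrite ler_norml clip_itv//; lra.
have f_v : {ae lebesgue_measure, forall t, {ae lebesgue_measure, forall x, f t x = v t x}}.
  apply: ae_impl (ae_prod_section uB) => t; apply: ae_impl => x fB.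
  by rewrite /v clip_id// -ler_norml (le_trans fB)// (le_trans (ler_norm B))// lerDr.
have mft t : measurable_fun setT (f t) by exact: (measurable_fun_pair2 t mf).
have mvt t : measurable_fun setT (v t) by exact: (measurable_fun_pair2 t mv).
have conv_v t : {ae lebesgue_measure, forall x, f t x = v t x} ->
    convolution (f t) k = convolution (v t) k.
  by move=> fv; apply/funext => x; exact: ae_eq_convolution.
have conv_v0 : convolution u0 k = convolution v0 k.
  by apply/funext => x; exact: ae_eq_convolution.
(* On almost every time slice [f] and [v] agree almost everywhere, so their convolutions coincide at
   every point and the inner integrals, speed included, are equal. *)
have v_weak : tensor_solution v (fun t x => V (convolution (v t) k x)) v0.
  move=> theta beta smooth_theta smooth_beta phi test_phi.
  have md (w : R -> R -> R) : measurable_fun setT (fun z : R * R => w z.1 z.2) ->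
      measurable_fun setT (fun z : R * R => w z.1 z.2 * (partial_t phi z.1 z.2
        + V (convolution (w z.1) k z.2) * partial_x phi z.1 z.2)).
    by move=> mw; exact: measurable_weak_density.
  apply: (etrans _ (weak phi test_phi)); apply: (f_equal2 +%R); last first.
    have mphi0 : measurable_fun setT (phi 0).
      by apply: measurable_funM => //; exact: measurable_smooth1.
    apply: ae_eq_Rintegral => //; try exact: measurable_funM.
    by apply: ae_impl u0_v0 => x -> _.
  transitivity (\int[lebesgue_measure]_(t in `[0, +oo[) (\int[lebesgue_measure]_x
      (f t x * (partial_t phi t x + V (convolution (f t) k x) * partial_x phi t x)))).
    apply: ae_eq_Rintegral => //.
    - by apply: measurable_funTS; exact: (measurable_Rintegral_slice (md v mv)).
    - by apply: measurable_funTS; exact: (measurable_Rintegral_slice (md f mf)).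
    apply: ae_impl f_v => t fv _; rewrite -(conv_v t fv).
    apply: ae_eq_Rintegral => //.
    - rewrite (conv_v t fv); exact: (measurable_fun_pair2 t (md v mv)).
    - exact: (measurable_fun_pair2 t (md f mf)).
    - by apply: ae_impl fv => x -> _.
  by apply: eq_Rintegral => t; rewrite inE/= in_itv/= andbT => t0; rewrite fE.
have := conv_TotVar_decreases V_L V_nonincr mv v_le M_ge1 mv0 v0_01 v0_g g_T
  (rescale_ge0 eps_gt0 eta_ge0 eta_nondecr) (rescale_le eps_gt0 eta_nondecr eta_le)
  (rescale_mono eps_gt0 eta_nondecr) (rescale_convex eps_gt0 eta_convex) ik
  (rescale_supp eps_gt0 eta_supp) v_weak.
rewrite conv_v0; apply: ae_impl2 f_v => t fv hv t0.
have -> : convolution (u t) k = convolution (v t) k by rewrite -(conv_v t fv) (fE t (ltW t0)).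
exact: (hv t0).
Qed.
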